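(* Let $p\in(2,\infty)$, let $\Omega\subset\mathbb{R}^n$ be a bounded NTA-domain with constants $M,r_0$, $T>0$, and let $u$ be a non-negative solution to $\partial_t u-\Delta_p u=0$ in $\Omega_T=\Omega\times(0,T)$. Let $w\in\partial\Omega$, $r>0$, $\epsilon>0$, $(t_0-\epsilon,t_0)\subset(0,T)$, and $E:=B_r(w)\times(t_0-\epsilon,t_0)$. Assume that $u$ vanishes continuously on $E\cap\partial_p\Omega_T$ and that $$\sup_{(x,t)\in E\cap\Omega_T}\frac{d(x,\partial\Omega)}{u(x,t)}=\Lambda^{-1}<\infty .$$ Then the boundary type Riesz measure $\mu$ associated to $u$ is positive on $E\cap\partial_p\Omega_T$, i.e. $\mu(E\cap\partial_p\Omega_T)>0$.
   Context: Here $\Delta_p u=\nabla\cdot(|\nabla u|^{p-2}\nabla u)$ with gradient and divergence in the space variable. A (weak) solution to $\partial_t u-\Delta_p u=0$ in $\Omega_T$ is a function $u\in L^p_{\rm loc}(0,T;W^{1,p}_{\rm loc}(\Omega))$ with $$\int_{\Omega\times(0,T)}\left(-u\,\partial_t\phi+|\nabla u|^{p-2}\nabla u\cdot\nabla\phi\right)dx\,dt=0\quad\text{for all }\phi\in C_0^\infty(\Omega\times(0,T));$$ solutions are always identified with their (locally Hölder) continuous representative. NTA-domain: a bounded domain $\Omega$ is NTA (non-tangentially accessible) with constants $M\ge2$ and $r_0>0$ if: (1) for any $w\in\partial\Omega$, $0<r<r_0$, there is a point $a_r(w)\in\Omega$ with $M^{-1}r<|a_r(w)-w|<r$ and $d(a_r(w),\partial\Omega)>M^{-1}r$;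 (2) $\mathbb{R}^n\setminus\Omega$ satisfies (1); (3) if $w\in\partial\Omega$, $0<r<r_0$, and $w_1,w_2\in B_r(w)\cap\Omega$, there is a rectifiable curve $\gamma:[0,1]\to\Omega$ with $\gamma(0)=w_1$, $\gamma(1)=w_2$, $H^1(\gamma)\le M|w_1-w_2|$ and $\min\{H^1(\gamma([0,t])),H^1(\gamma([t,1]))\}\le M\,d(\gamma(t),\partial\Omega)$ for all $t\in[0,1]$. $d(x,\partial\Omega)$ is the Euclidean distance from $x$ to $\partial\Omega$; a quotient $d(x,\partial\Omega)/u(x,t)$ is understood as $+\infty$ when $u(x,t)=0$. Parabolic boundary: $\partial_p\Omega_T=S_T\cup(\overline\Omega\times\{0\})$, $S_T=\partial\Omega\times[0,T]$. Riesz measure: let $Q$ be an open set in space-time such that $u$ vanishes continuously on $\partial_p\Omega_T\cap Q$ (here $Q=E$). Extending $u$ by zero in $Q\setminus\Omega_T$, $u$ becomes a continuous weak subsolution in $Q$, and there is a unique locally finite positive Borel measure $\mu$, supported on $S_T\cap Q$, such that $$-\int_Q u\,\partial_t\phi\,dx\,dt+\int_Q|\nabla u|^{p-2}\nabla u\cdot\nabla\phi\,dx\,dt=-\int_Q\phi\,d\mu\qquad\text{for all }\phi\in C_0^\infty(Q).$$ *)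

(* Defs.v *)
From HB Require Import structures.
From mathcomp Require Import all_boot all_order all_algebra.
From mathcomp Require Import all_classical all_reals all_analysis.
Set Implicit Arguments. Unset Strict Implicit. Unset Printing Implicit Defensive.
Import Order.TTheory GRing.Theory Num.Theory.
Import numFieldNormedType.Exports.
Local Open Scope classical_set_scope.
Local Open Scope ring_scope.

(* R^n is 'rV[R]_n and space-time is 'rV[R]_n * R.  The library equips both
   with the product topology and the sup norm; Euclidean lengths are given by
   [enorm] below.  'rV[R]_n carries its Borel sigma-algebra.  The product
   sigma-algebra on 'rV[R]_n * R is then the Borel one, since both factors are
   second countable. *)

Section borel_rV.
Context (R : realType) (n : nat).

Definition borel_rV : set (set 'rV[R]_n) := <<s @open 'rV[R]_n >>.

Let borel_rV0 : borel_rV set0. Proof. exact: sigma_algebra0. Qed.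

Let borel_rVC A : borel_rV A -> borel_rV (~` A).
Proof. exact: sigma_algebraC. Qed.

Let borel_rV_bigcup (F : (set 'rV[R]_n)^nat) :
  (forall i, borel_rV (F i)) -> borel_rV (\bigcup_i F i).
Proof. exact: sigma_algebra_bigcup. Qed.

HB.instance Definition _ := @isMeasurable.Build default_measure_display
  'rV[R]_n borel_rV borel_rV0 borel_rVC borel_rV_bigcup.

Lemma open_measurable_rV (A : set 'rV[R]_n) : open A -> measurable A.
Proof. exact: sub_sigma_algebra. Qed.

Lemma measurable_coord_rV (i : 'I_n) :
  measurable_fun [set: 'rV[R]_n] (fun x : 'rV[R]_n => x ord0 i).
Proof.
apply: (measurability _ (measurable_realfun.RGenOpens.measurableE R)) => _ [_ [a [b ->] <-]].
rewrite setTI; apply: open_measurable_rV.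
apply: open_comp; last exact: interval_open.
by move=> x _; exact: coord_continuous.
Qed.

Lemma measurable_fun_rVP d (T : measurableType d) (f : T -> 'rV[R]_n) :
  (forall i, measurable_fun [set: T] (fun t => f t ord0 i)) ->
  measurable_fun [set: T] f.
Proof.
move=> mf; apply: (@measurability _ _ _ _ _ _ (@open 'rV[R]_n)) => //.
move=> _ [A oA <-]; rewrite setTI.
pose c (q : 'rV[rat]_n * nat) : 'rV[R]_n := \row_j ratr (q.1 ord0 j).
pose B (q : 'rV[rat]_n * nat) : set 'rV[R]_n :=
  [set x | forall j, `|c q ord0 j - x ord0 j| < (q.2.+1%:R)^-1].
pose F q := if pselect (B q `<=` A) then f @^-1` B q else set0.
have -> : f @^-1` A = \bigcup_q F q.
  apply/seteqP; split => [t /= At|t [q _]]; last first.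
    by rewrite /F; case: pselect => /= BA Bt; [exact: BA|by []].
  have /nbhs_ballP[e /= e0 eA] : nbhs (f t) A by exact: open_nbhs_nbhs.
  have [k ke] : exists k : nat, (k.+1%:R)^-1 < e / 2 :> R.
    have e20 : 0 < e / 2 by rewrite divr_gt0.
    have [N _ /(_ N (leqnn N))] := near_infty_natSinv_lt (PosNum e20).
    by exists N.
  have qE j : exists q : rat, `|ratr q - f t ord0 j| < (k.+1%:R)^-1.
    have [|q] := @rat_in_itvoo R (f t ord0 j) (f t ord0 j + (k.+1%:R)^-1).
      by rewrite ltrDl invr_gt0.
    rewrite in_itv/= => /andP[q1 q2]; exists q.
    by rewrite ger0_norm ?subr_ge0 ?ltrBlDl// ltW.
  pose q : 'rV[rat]_n * nat := (\row_j sval (cid (qE j)), k).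
  have Bf : B q (f t) by move=> j; rewrite !mxE; case: cid.
  exists q => //; rewrite /F; case: pselect => [BA|[]]; first exact: Bf.
  move=> x Bx.
  apply: eA; split => // i j; rewrite (ord1 i) /ball/=.
  rewrite (splitr e) (le_lt_trans (ler_distD (c q ord0 j) _ _))//.
  by rewrite ltrD// (lt_trans _ ke)// distrC.
apply: countable_bigcupT_measurable => [|q]; first exact: countableP.
rewrite /F; case: pselect => BA /=; last exact: measurable0.
rewrite (_ : _ @^-1` _ = \bigcap_(j in [set: 'I_n])
    ((fun t => f t ord0 j) @^-1` ball (c q ord0 j) (q.2.+1%:R)^-1)); last first.
  by apply/seteqP; split => [t Bt j _|t Bt j]; [exact: Bt|exact: (Bt j I)].
apply: fin_bigcap_measurable => [|j _]; first exact: finite_finset.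
rewrite -[X in measurable X]setTI; apply: mf => //.
by apply: measurable_realfun.open_measurable; exact: ball_open.
Qed.

End borel_rV.

Section lebesgue_rV.
Context (R : realType).

Definition cons_rV n (z : R * 'rV[R]_n) : 'rV[R]_n.+1 :=
  row_mx (const_mx z.1 : 'rV[R]_1) z.2.

Lemma cons_rV0 n (z : R * 'rV[R]_n) : cons_rV z ord0 ord0 = z.1.
Proof.
have j0 : lshift n (ord0 : 'I_1) = ord0 :> 'I_(1 + n) by exact: val_inj.
by have := row_mxEl (const_mx z.1 : 'rV[R]_1) z.2 ord0 ord0; rewrite j0 /cons_rV => ->; rewrite mxE.
Qed.

Lemma cons_rVS n (z : R * 'rV[R]_n) i :
  cons_rV z ord0 (lift ord0 i) = z.2 ord0 i.
Proof.
have ji : rshift 1 i = lift ord0 i :> 'I_(1 + n) by exact: val_inj.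
by have := row_mxEr (const_mx z.1 : 'rV[R]_1) z.2 ord0 i; rewrite ji /cons_rV => ->.
Qed.

Lemma measurable_cons_rV n : measurable_fun setT (@cons_rV n).
Proof.
apply: measurable_fun_rVP => i.
rewrite /cons_rV; under eq_fun do rewrite mxE.
case: (@splitP 1 n i) => [j _|j _].
  by under eq_fun do rewrite mxE; exact: measurable_fst.
by apply: (measurableT_comp (measurable_coord_rV j)); exact: measurable_snd.
Qed.


Section step.
Variables (n : nat) (m : {sigma_finite_measure set 'rV[R]_n -> \bar R}).

Definition lebesgue_rVS : set 'rV[R]_n.+1 -> \bar R :=
  pushforward (@lebesgue_measure R \x m)%E (@cons_rV n).

Let mpre A : measurable A -> measurable (@cons_rV n @^-1` A).
Proof.
by move=> mA; rewrite -[X in measurable X]setTI; exact: measurable_cons_rV.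
Qed.

Let lebesgue_rVS0 : lebesgue_rVS set0 = 0%E.
Proof. by rewrite /lebesgue_rVS /pushforward preimage_set0 measure0. Qed.

Let lebesgue_rVS_ge0 A : (0 <= lebesgue_rVS A)%E.
Proof. by rewrite /lebesgue_rVS /pushforward; exact: measure_ge0. Qed.

Let lebesgue_rVS_sigma_additive : semi_sigma_additive lebesgue_rVS.
Proof.
move=> F mF tF mUF; rewrite /lebesgue_rVS /pushforward preimage_bigcup.
apply: measure_semi_sigma_additive.
- by move=> k; exact: mpre.
- apply/trivIsetP => /= i j _ _ ij; rewrite -preimage_setI.
  by move/trivIsetP : tF => /(_ _ _ _ _ ij) ->//; rewrite preimage_set0.
- by rewrite -preimage_bigcup; exact: mpre.
Qed.

HB.instance Definition _ := isMeasure.Build _ _ _ lebesgue_rVS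
  lebesgue_rVS0 lebesgue_rVS_ge0 lebesgue_rVS_sigma_additive.

Let uncons (x : 'rV[R]_n.+1) : R * 'rV[R]_n :=
  (x ord0 ord0, rsubmx (x : 'rV[R]_(1 + n))).

Let cons_rVK : cancel (@cons_rV n) uncons.
Proof.
case=> a y; rewrite /uncons cons_rV0; congr pair.
by rewrite /cons_rV row_mxKr.
Qed.

Let measurable_uncons : measurable_fun setT uncons.
Proof.
apply: measurable_fun_pair; first exact: measurable_coord_rV.
apply: measurable_fun_rVP => i; under eq_fun do rewrite mxE.
exact: measurable_coord_rV.
Qed.

Let lebesgue_rVS_sigma_finite : sigma_finite setT lebesgue_rVS.
Proof.
have [F TF Foo] : sigma_finite setT (@lebesgue_measure R \x m)%E.
  have /sigma_finiteP[F [TF ndF Foo]] := sigma_finiteT (@lebesgue_measure R).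
  have /sigma_finiteP[G [TG ndG Goo]] := sigma_finiteT m.
  exists (fun k => F k `*` G k).
    rewrite -setXTT TF TG predeqE => -[x y]; split; last first.
      by move=> [k _ []/= ? ?]; split; exists k.
    move=> [/= [i _ Fix] [j _ Gjy]]; exists (maxn i j) => //; split.
      by move: x Fix; exact/subsetPset/ndF/leq_maxl.
    by move: y Gjy; exact/subsetPset/ndG/leq_maxr.
  move=> k; have [? ?] := Foo k; have [? ?] := Goo k.
  split; first exact: measurableX.
  by rewrite product_measure1E// lte_mul_pinfty// ge0_fin_numE.
exists (fun k => uncons @^-1` F k).
  by rewrite -preimage_bigcup -TF preimage_setT.
move=> k; have [mF Fk] := Foo k; split.
  by rewrite -[X in measurable X]setTI; exact: measurable_uncons.
rewrite /lebesgue_rVS /pushforward -comp_preimage (_ : _ \o _ = id)//.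
by apply/funext => z /=; rewrite cons_rVK.
Qed.

HB.instance Definition _ := @Measure_isSigmaFinite.Build _ _ _ lebesgue_rVS
  lebesgue_rVS_sigma_finite.

End step.

Fixpoint lebesgue_rV n : {sigma_finite_measure set 'rV[R]_n -> \bar R} :=
  if n is n'.+1 then lebesgue_rVS (lebesgue_rV n') else dirac (0 : 'rV[R]_0).

Lemma lebesgue_rV_box n (a b : 'I_n -> R) : (forall i, a i <= b i) ->
  lebesgue_rV n [set x | forall i, x ord0 i \in `[a i, b i]] =
  (\prod_i (b i - a i))%:E.
Proof.
elim: n a b => [|n IH] a b ab.
  by rewrite big_ord0 /= diracE mem_set//= => -[].
rewrite /= /lebesgue_rVS /pushforward.
rewrite (_ : _ @^-1` _ = `[a ord0, b ord0] `*`
  [set x : 'rV[R]_n | forall i, x ord0 i \in `[a (lift ord0 i), b (lift ord0 i)]]).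
  rewrite product_measure1E//; last first.
    rewrite (_ : [set _ | _] = \bigcap_(j in [set: 'I_n])
      ((fun x : 'rV[R]_n => x ord0 j) @^-1` `[a (lift ord0 j), b (lift ord0 j)])).
      apply: fin_bigcap_measurable => [|j _]; first exact: finite_finset.
      by rewrite -[X in measurable X]setTI; exact: measurable_coord_rV.
    by apply/seteqP; split => [x Bx j _|x Bx j]; [exact: Bx|exact: (Bx j I)].
  rewrite IH// big_ord_recl EFinM; congr (_ * _)%E.
  apply: etrans (lebesgue_measure_itv `[a ord0, b ord0]) _.
  by rewrite /= lte_fin; case: ltgtP (ab ord0) => // ->; rewrite subrr.
apply/seteqP; split => [z /= Az|z [/= A0 AS] i].
  by split => [|i] /=; rewrite -?cons_rV0 -?cons_rVS; exact: Az.
by case: (unliftP ord0 i) => [j|] ->; rewrite ?cons_rV0 ?cons_rVS//; exact: AS.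
Qed.

End lebesgue_rV.

Section euclidean.
Context (R : realType) (n : nat).
Implicit Types (x y : 'rV[R]_n) (A : set 'rV[R]_n).

Definition dotv x y : R := \sum_i x ord0 i * y ord0 i.

Definition enorm x : R := Num.sqrt (dotv x x).

Definition eball x (r : R) : set 'rV[R]_n := [set y | enorm (y - x) < r].

Definition dist_to x A : R := inf [set enorm (x - y) | y in A].

Definition bdry A : set 'rV[R]_n := closure A `\` interior A.

(* The singleton makes the diameter of the empty set 0 instead of -oo. *)
Definition ediam A : \bar R :=
  ereal_sup ([set 0%E] `|` [set (enorm (z.1 - z.2))%:E | z in A `*` A]).

(* One-dimensional Hausdorff measure H^1, with the usual normalization under
   which H^1 of a segment is its length. *)
Definition hausdorff1_content (delta : R) A : \bar R :=
  ereal_inf [set (\sum_(0 <= i <oo) ediam (U i))%E | U in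
    [set U : (set 'rV[R]_n)^nat | A `<=` \bigcup_i U i /\
      forall i, (ediam (U i) <= delta%:E)%E]].

Definition hausdorff1 A : \bar R :=
  ereal_sup [set hausdorff1_content delta A | delta in [set d : R | 0 < d]].

End euclidean.

Section nta.
Context (R : realType) (n : nat).
Implicit Types (A Omega : set 'rV[R]_n) (gamma : R -> 'rV[R]_n).

(* Only the values of gamma on [0, 1] matter. *)
Definition rectifiable gamma : Prop :=
  {within `[0, 1], continuous gamma} /\
  exists L : R, forall s : seq R, sorted <=%R s -> all (mem `[0, 1]) s ->
    \sum_(i < (size s).-1) enorm (gamma s`_i.+1 - gamma s`_i) <= L.

Definition corkscrew (M r0 : R) A : Prop :=
  forall w r, bdry A w -> 0 < r < r0 ->
    exists a, [/\ A a, M^-1 * r < enorm (a - w) < r &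
      M^-1 * r < dist_to a (bdry A)].

Definition joined_by_cigars (M r0 : R) Omega : Prop :=
  forall w r w1 w2, bdry Omega w -> 0 < r < r0 ->
    (eball w r `&` Omega) w1 -> (eball w r `&` Omega) w2 ->
    exists gamma, [/\ rectifiable gamma,
      forall t, t \in `[0, 1] -> Omega (gamma t),
      gamma 0 = w1 /\ gamma 1 = w2,
      (hausdorff1 (gamma @` `[0%R, 1%R]) <= (M * enorm (w1 - w2))%:E)%E &
      forall t, t \in `[0, 1] ->
        (mine (hausdorff1 (gamma @` `[0%R, t])) (hausdorff1 (gamma @` `[t, 1%R]))
         <= (M * dist_to (gamma t) (bdry Omega))%:E)%E].

Definition bounded_domain Omega : Prop :=
  [/\ open Omega, connected Omega, Omega !=set0 & bounded_set Omega].

Definition NTA_domain (M r0 : R) Omega : Prop :=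
  [/\ bounded_domain Omega, 2 <= M /\ 0 < r0, corkscrew M r0 Omega,
      corkscrew M r0 (~` Omega) & joined_by_cigars M r0 Omega].

End nta.

Section test_functions.
Context (R : realType) (V : normedModType R).
Implicit Types (Q : set V) (phi : V -> R).

(* V is meant to be finite-dimensional: there, phi is C^(k+1) if and only if
   all its directional derivatives exist and are C^k. *)
Fixpoint Ck (k : nat) phi : Prop :=
  continuous phi /\
  (if k is k'.+1 then
     forall v, (forall x, derivable phi x v) /\ Ck k' (fun x => 'D_v phi x)
   else True).

Definition supp phi : set V := closure [set x | phi x != 0].

(* C_0^oo(Q) *)
Definition test_function Q phi : Prop :=
  [/\ forall k, Ck k phi, compact (supp phi) & supp phi `<=` Q].

End test_functions.

Section sobolev.
Context (R : realType) (n : nat).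
Implicit Types (V Omega : set 'rV[R]_n) (p a b : R).
Implicit Types (u : 'rV[R]_n * R -> R) (G : 'rV[R]_n * R -> 'rV[R]_n).

Definition lebesgue_spacetime :
    {measure set ('rV[R]_n * measurableTypeR R) -> \bar R} :=
  (lebesgue_rV R n \x @lebesgue_measure R)%E.

Definition cyl V a b : set ('rV[R]_n * R) := V `*` `]a, b[.

Definition weak_gradient V (f : 'rV[R]_n -> R) (g : 'rV[R]_n -> 'rV[R]_n) :=
  forall phi, test_function V phi -> forall i : 'I_n,
    (\int[lebesgue_rV R n]_(x in V) (f x * 'D_(delta_mx ord0 i) phi x)) =
    - (\int[lebesgue_rV R n]_(x in V) (g x ord0 i * phi x)).

(* f belongs to W^{1,p}(V) and g is its gradient *)
Definition sobolev p V (f : 'rV[R]_n -> R) (g : 'rV[R]_n -> 'rV[R]_n) :=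
  [/\ measurable_fun V f /\ measurable_fun V g,
      (\int[lebesgue_rV R n]_(x in V) (`|f x| `^ p)%:E < +oo)%E,
      (\int[lebesgue_rV R n]_(x in V) (enorm (g x) `^ p)%:E < +oo)%E &
      weak_gradient V f g].

(* u belongs to L^p(a, b; W^{1,p}(V)) and G is its spatial gradient *)
Definition Lp_sobolev p V a b u G :=
  [/\ measurable_fun (cyl V a b) u, measurable_fun (cyl V a b) G,
      {ae @lebesgue_measure R, forall t, t \in `]a, b[ ->
        sobolev p V (fun x => u (x, t)) (fun x => G (x, t))} &
      (\int[lebesgue_spacetime]_(z in cyl V a b)
        (`|u z| `^ p + enorm (G z) `^ p)%:E < +oo)%E].

(* u belongs to L^p_loc(a, b; W^{1,p}_loc(V)) and G is its spatial gradient *)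
Definition Lp_sobolev_loc p Omega a b u G :=
  forall V c d, open V -> compact (closure V) -> closure V `<=` Omega ->
    a < c -> d < b -> Lp_sobolev p V c d u G.

End sobolev.

Section p_parabolic.
Context (R : realType) (n : nat).
Implicit Types (U Omega : set 'rV[R]_n) (p T a b : R).
Implicit Types (u phi : 'rV[R]_n * R -> R).

Definition dt phi (z : 'rV[R]_n * R) : R := 'D_(0, 1) phi z.

Definition grad phi (z : 'rV[R]_n * R) : 'rV[R]_n :=
  \row_i 'D_(delta_mx ord0 i, 0) phi z.

Definition p_flux p (g : 'rV[R]_n) : 'rV[R]_n := (enorm g `^ (p - 2)) *: g.

(* Solutions are identified with their continuous representative, whence the
   continuity requirement.  The values of u outside Omega * ]0, T[ are
   irrelevant. *)
Definition p_parabolic_solution p Omega T u : Prop :=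
  (forall z, cyl Omega 0 T z -> {for z, continuous u}) /\
  exists G, Lp_sobolev_loc p Omega 0 T u G /\
    forall phi, test_function (cyl Omega 0 T) phi ->
      (\int[lebesgue_spacetime R n]_(z in cyl Omega 0 T)
         (- u z * dt phi z + dotv (p_flux p (G z)) (grad phi z))) = 0.

Definition lateral_boundary Omega T : set ('rV[R]_n * R) :=
  bdry Omega `*` `[0, T].

Definition parabolic_boundary Omega T : set ('rV[R]_n * R) :=
  lateral_boundary Omega T `|` closure Omega `*` [set 0].

Definition vanishes_continuously Omega T u (S : set ('rV[R]_n * R)) : Prop :=
  forall z, S z -> u y @[y --> within (cyl Omega 0 T) (nbhs z)] --> (0 : R).

(* mu is the Riesz measure of u on Q = U * ]a, b[.  Here ubar is the extension
   of u by zero and G its spatial gradient on Q.  A measure on Q supported on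
   S_T is represented by its extension by zero to the whole space-time. *)
Definition riesz_measure p Omega T u U a b
    (mu : {measure set ('rV[R]_n * R) -> \bar R}) : Prop :=
  let Q := cyl U a b in
  let ubar := patch (fun=> 0) (cyl Omega 0 T) u in
  [/\ forall K, compact K -> K `<=` Q -> (mu K < +oo)%E,
      mu (~` (lateral_boundary Omega T `&` Q)) = 0%E &
      exists G, Lp_sobolev_loc p U a b ubar G /\
        forall phi, test_function Q phi ->
          (- (\int[lebesgue_spacetime R n]_(z in Q) (ubar z * dt phi z)))
          + (\int[lebesgue_spacetime R n]_(z in Q)
               dotv (p_flux p (G z)) (grad phi z))
          = - (\int[mu]_(z in Q) phi z)].

(* d(x, bdry Omega) / u(x, t), equal to +oo where u vanishes *)
Definition dist_quotient Omega u (z : 'rV[R]_n * R) : \bar R :=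
  if u z == 0 then +oo%E else (dist_to z.1 (bdry Omega) / u z)%:E.

End p_parabolic.

(* Main.v *)
Require Import Defs.
From HB Require Import structures.
From mathcomp Require Import all_boot all_order all_algebra.
From mathcomp Require Import all_classical all_reals all_analysis measurable_realfun.
From mathcomp Require Import ring lra.
Set Implicit Arguments. Unset Strict Implicit. Unset Printing Implicit Defensive.
Import Order.TTheory GRing.Theory Num.Theory.
Import numFieldNormedType.Exports.
Local Open Scope classical_set_scope.
Local Open Scope ring_scope.

(** If mu did not charge the boundary piece, the zero extension of u would be a
    genuine weak solution across it, with u >= c0 * q near an interior corkscrew
    point at scale q and u = 0 near an exterior one.  Testing the (mollified)
    equation with psi * (u + d)^(1 - p), d = h * q, on a fixed time interval
    gives the logarithmic Caccioppoli estimate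
      \int psi |grad u|^p / (u + d)^p <= c * (q^(-p) + d^(2 - p)) * |support|,
    in which the first term dominates as q -> 0 because p > 2.  On the other
    hand log (u + d) drops by L = log (1 + c0 / h) between the two corkscrew
    boxes, which forces the left-hand side to be at least
    c * (L / q)^p * |support|.  A large L, then a small q, is a contradiction. *)

(** * Translation invariance of Lebesgue measure *)

(** The weight exponent 1 - p does two things. Paired with the flux, the gradient of (u + d)^(1 - p)
    gives exactly |grad log (u + d)|^p. Its primitive in u is a multiple of (u + d)^(2 - p), bounded
    by a multiple of d^(2 - p) whatever the size of u. Taking d proportional to q makes the drop of
    the logarithm independent of q. The obstacle is that u has no time derivative, so it cannot
    enter a test function. The equation is therefore convolved in space and time with a smooth
    kernel, after which all integrations by parts concern C^1 functions. But the flux is nonlinear: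
    the mollified flux is not the flux of the mollified gradient, and its monotonicity is lost. It
    is recovered up to an error by approximating the gradient in L^p by Lipschitz functions, which
    barely vary at the scale of the kernel. This error carries a factor d^(-p), which is harmless
    because d is fixed before the kernel is chosen. *)

Section translation.
Context (R : realType).

Lemma lebesgue_measure_translation (a : R) (A : set (measurableTypeR R)) :
  measurable A ->
  pushforward (@lebesgue_measure R)
    (fun x : R => x + a : measurableTypeR R) A = @lebesgue_measure R A.
Proof.
have ma : measurable_fun [set: measurableTypeR R]
    (fun x : R => x + a : measurableTypeR R).
  by apply: measurable_funD => //; exact: measurable_cst.
move=> mA; apply/esym/lebesgue_measure_unique => //= _ [[x y]] _ <-.
rewrite /pushforward (_ : _ @^-1` _ = `]x - a, y - a]%classic).
  rewrite !lebesgue_measure_itv/= !lte_fin ltrD2r -!EFinB.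
  by case: ifP => // _; congr (_%:E); ring.
by apply/seteqP; split => z /=; rewrite !in_itv/= ltrBlDr lerBrDr.
Qed.

Lemma measurable_fun_translation_rV n (a : 'rV[R]_n) :
  measurable_fun [set: 'rV[R]_n] (fun x : 'rV[R]_n => x + a).
Proof.
apply: measurable_fun_rVP => i; under eq_fun do rewrite mxE.
by apply: measurable_funD; [exact: measurable_coord_rV|exact: measurable_cst].
Qed.

(** The product measure is determined by its values on measurable rectangles, and the preimage of a
    rectangle under a product map is again a rectangle. *)
Lemma product_measure_pushforward d1 d2 (T1 : measurableType d1)
    (T2 : measurableType d2) (m1 : {sigma_finite_measure set T1 -> \bar R})
    (m2 : {sigma_finite_measure set T2 -> \bar R}) (f1 : T1 -> T1) (f2 : T2 -> T2) :
  measurable_fun setT f1 -> measurable_fun setT f2 ->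
  (forall A, measurable A -> pushforward m1 f1 A = m1 A) ->
  (forall A, measurable A -> pushforward m2 f2 A = m2 A) ->
  forall A, measurable A ->
    pushforward (m1 \x m2)%E (fun z => (f1 z.1, f2 z.2)) A = (m1 \x m2)%E A.
Proof.
move=> mf1 mf2 inv1 inv2 A mA.
apply/esym/product_measure_unique => //= [|mf B C mB mC].
  apply: measurable_fun_pair; apply: measurableT_comp => //.
rewrite /pushforward (_ : _ @^-1` _ = (f1 @^-1` B) `*` (f2 @^-1` C))//.
have m1B : measurable (f1 @^-1` B) by rewrite -[X in measurable X]setTI; exact: mf1.
have m2C : measurable (f2 @^-1` C) by rewrite -[X in measurable X]setTI; exact: mf2.
by rewrite product_measure1E//; congr (_ * _)%E; [exact: inv1|exact: inv2].
Qed.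

(** Induction on the dimension: [cons_rV] conjugates the translation by [a] to the product of the
    translations by its first coordinate and by the remaining ones. *)
Lemma lebesgue_rV_translation n (a : 'rV[R]_n) (A : set 'rV[R]_n) :
  measurable A ->
  pushforward (lebesgue_rV R n) (fun x => x + a) A = lebesgue_rV R n A.
Proof.
elim: n a A => [|n IH] a A mA.
  rewrite (_ : (fun x => x + a) = id)//; apply/funext => x.
  by rewrite [LHS]thinmx0 [RHS]thinmx0.
rewrite /pushforward /= /lebesgue_rVS /pushforward.
pose a1 := a ord0 ord0; pose a2 : 'rV[R]_n := \row_i a ord0 (lift ord0 i).
have mpA : measurable (@cons_rV R n @^-1` A).
  by rewrite -[X in measurable X]setTI; exact: measurable_cons_rV.
have cE (z : R * 'rV[R]_n) : cons_rV (z.1 + a1, z.2 + a2) = cons_rV z + a.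
  apply/rowP => i; rewrite [RHS]mxE; case: (unliftP ord0 i) => [j|] ->.
    by rewrite !cons_rVS mxE mxE.
  by rewrite !cons_rV0.
rewrite -(@product_measure_pushforward _ _ _ _ lebesgue_measure (lebesgue_rV R n)
  (fun x => x + a1 : measurableTypeR R) (fun x => x + a2) _ _ _ (IH a2) _ mpA).
- rewrite /pushforward; congr (_ _); apply/seteqP.
  by split => z /=; rewrite cE.
- by apply: measurable_funD => //; exact: measurable_cst.
- exact: measurable_fun_translation_rV.
- by move=> *; exact: lebesgue_measure_translation.
Qed.

Local Notation V n := ('rV[R]_n * R)%type.
Local Notation X n := ('rV[R]_n * measurableTypeR R)%type.

Lemma sigma_finite_lebesgue_spacetime n :
  sigma_finite setT (lebesgue_spacetime R n).
Proof.
have /sigma_finiteP[F [TF ndF Foo]] := sigma_finiteT (lebesgue_rV R n).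
have /sigma_finiteP[G [TG ndG Goo]] := sigma_finiteT (@lebesgue_measure R).
exists (fun k => F k `*` G k).
  rewrite -setXTT TF TG predeqE => -[x y]; split; last first.
    by move=> [k _ []/= ? ?]; split; exists k.
  move=> [/= [i _ Fix] [j _ Gjy]]; exists (maxn i j) => //; split.
    by move: x Fix; exact/subsetPset/ndF/leq_maxl.
  by move: y Gjy; exact/subsetPset/ndG/leq_maxr.
move=> k; have [? ?] := Foo k; have [? ?] := Goo k.
split; first exact: measurableX.
by rewrite /= product_measure1E// lte_mul_pinfty// ge0_fin_numE.
Qed.

(* Convertible to [lebesgue_spacetime R n], which is declared only as a measure
   and so cannot be used directly with Fubini's theorem. *)
Definition Leb n : {sigma_finite_measure set X n -> \bar R} :=
  HB.pack_for {sigma_finite_measure set X n -> \bar R}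
    (Measure.sort (lebesgue_spacetime R n))
    (Measure.class (lebesgue_spacetime R n))
    (Measure_isSigmaFinite.Build _ _ _ _ (@sigma_finite_lebesgue_spacetime n)).

(* measurableTypeR R is not an instance of zmodType, hence the casts. *)
Definition translate n (a : V n) (z : X n) : X n := ((z : V n) + a)%R.

Lemma translateE n (a : V n) :
  translate a = fun z : X n => (z.1 + a.1, z.2 + a.2 : measurableTypeR R).
Proof. by apply/funext => -[]. Qed.

Lemma measurable_translate n (a : V n) : measurable_fun setT (translate a).
Proof.
rewrite translateE; apply: measurable_fun_pair => /=.
  exact: (measurableT_comp (measurable_fun_translation_rV a.1) measurable_fst).
by apply: measurable_funD; [exact: measurable_snd|exact: measurable_cst].
Qed.

Lemma Leb_translate n (a : V n) (A : set (X n)) :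
  measurable A -> pushforward (Leb n) (translate a) A = Leb n A.
Proof.
move=> mA; rewrite translateE; apply: (@product_measure_pushforward _ _ _ _ (lebesgue_rV R n)
  lebesgue_measure (fun x => x + a.1) (fun x : R => x + a.2 : measurableTypeR R)) => //.
- exact: measurable_fun_translation_rV.
- by apply: measurable_funD => //; exact: measurable_cst.
- by move=> *; exact: lebesgue_rV_translation.
- by move=> *; exact: lebesgue_measure_translation.
Qed.

Lemma ge0_integral_translate n (a : V n) (f : X n -> \bar R) :
  measurable_fun setT f -> (forall z, 0 <= f z)%E ->
  (\int[Leb n]_z f (translate a z) = \int[Leb n]_z f z)%E.
Proof.
move=> mf f0; transitivity (\int[pushforward (Leb n) (translate a)]_z f z)%E.
  apply/esym; rewrite ge0_integral_pushforward//; exact: measurable_translate.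
apply: eq_measure_integral => [|mt A mA _]; first exact: measurable_translate.
exact: Leb_translate.
Qed.

Lemma integrable_translate n (a : V n) (f : X n -> R) :
  (Leb n).-integrable setT (EFin \o f) ->
  (Leb n).-integrable setT (EFin \o (f \o translate a)).
Proof.
move=> /integrableP[mf fi]; apply/integrableP; split.
  by apply: (measurableT_comp mf); exact: measurable_translate.
rewrite (ge0_integral_translate a (f := fun z => `|(f z)%:E|%E))//.
exact: measurableT_comp.
Qed.

Lemma Rintegral_translate n (a : V n) (f : X n -> R) :
  (Leb n).-integrable setT (EFin \o f) ->
  \int[Leb n]_z f (translate a z) = \int[Leb n]_z f z.
Proof.
move=> fi; have mf := measurable_int _ fi; rewrite /Rintegral; congr fine.
transitivity (\int[pushforward (Leb n) (translate a)]_z (f z)%:E)%E.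
  apply/esym; rewrite (integral_pushforward _ mf)//; first exact: measurable_translate.
  exact: integrable_translate.
apply: eq_measure_integral => [|mt A mA _]; first exact: measurable_translate.
exact: Leb_translate.
Qed.

End translation.

(** * Smooth functions and cut-offs *)

Section directional_derivatives.
Context (R : realType) (V : normedModType R).
Implicit Types (f g : V -> R) (z v : V).

(** Reduces a directional derivative to the derivative at 0 of a function of one real variable, to
    which the one-variable chain rule applies. *)
Lemma is_derive_line f z v df :
  is_derive z v f df <-> is_derive (0 : R) (1 : R) (fun h : R => f (h *: v + z)) df.
Proof.
have E : (fun h : R => h^-1 *: (f (h *: v + z) - f z)) =
    (fun h : R => h^-1 *: (f ((h *: (1 : R) + 0) *: v + z) - f ((0 : R) *: v + z))).
  by apply/funext => h; rewrite scale0r add0r addr0 [h *: 1]mulr1.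
split=> -[d1 d2]; split.
- by move: d1; rewrite /derivable /= E.
- by move: d2; rewrite /derive /= E.
- by move: d1; rewrite /derivable /= E.
- by move: d2; rewrite /derive /= E.
Qed.

Lemma is_derive_comp_line f (F : R -> R) z v df dF :
  is_derive z v f df -> is_derive (f z) 1 F dF ->
  is_derive z v (F \o f) (dF * df).
Proof.
move=> /is_derive_line hf hF; apply/is_derive_line.
apply: (@is_derive1_comp _ F (fun h : R => f (h *: v + z))) => //.
by rewrite scale0r add0r.
Qed.

Lemma is_derive_at f z v df (s : R) :
  is_derive (s *: v + z) v f df -> is_derive s 1 (fun h : R => f (h *: v + z)) df.
Proof.
move=> [d1 d2].
have E : (fun h : R => h^-1 *: (f (h *: v + (s *: v + z)) - f (s *: v + z))) =
    (fun h : R => h^-1 *: (f ((h *: (1 : R) + s) *: v + z) - f (s *: v + z))).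
  by apply/funext => h; rewrite [h *: 1]mulr1 scalerDl addrA.
by split; [move: d1; rewrite /derivable /= E|move: d2; rewrite /derive /= E].
Qed.

Lemma is_derive_affine (W : normedModType R) (f : W -> R) (L : V -> W) (l : W) z v df :
  (forall h : R, L (h *: v + z) = h *: l + L z) ->
  is_derive (L z) l f df -> is_derive z v (f \o L) df.
Proof.
move=> Ll [d1 d2].
have E : (fun h : R => h^-1 *: ((f \o L) (h *: v + z) - (f \o L) z)) =
    (fun h : R => h^-1 *: (f (h *: l + L z) - f (L z))).
  by apply/funext => h /=; rewrite Ll.
by split; [move: d1; rewrite /derivable /= E|move: d2; rewrite /derive /= E].
Qed.

End directional_derivatives.

Section Ck_theory.
Context (R : realType) (V : normedModType R).
Implicit Types (f g : V -> R).

Lemma Ck_continuous k f : Ck k f -> forall x, {for x, continuous f}.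
Proof. by case: k => [|k] []. Qed.

Lemma Ck_is_derive k f z v : Ck k.+1 f -> is_derive z v f ('D_v f z).
Proof. by move=> [_ /(_ v)[df _]]; split. Qed.

Lemma Ck_derive k f v : Ck k.+1 f -> Ck k (fun z => 'D_v f z).
Proof. by move=> [_ /(_ v)[]]. Qed.

Lemma CkW k f : Ck k.+1 f -> Ck k f.
Proof.
elim: k f => [|k IH] f [cf df]; split => // v.
by have [dv /IH] := df v.
Qed.

Lemma CkSI k f (df : V -> V -> R) : continuous f ->
  (forall z v, is_derive z v f (df v z)) -> (forall v, Ck k (df v)) -> Ck k.+1 f.
Proof.
move=> cf fd Cd; split => // v; split; first by move=> z; have [] := fd z v.
by rewrite (_ : (fun _ => _) = df v)//; apply/funext => z; have [] := fd z v.
Qed.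

Lemma Ck_cst k (c : R) : Ck k (fun _ : V => c).
Proof.
elim: k c => [|k IH] c; first by split => // z; exact: cst_continuous.
by apply: (CkSI (df := fun _ _ => 0)) => // z; exact: cst_continuous.
Qed.

Lemma CkD k f g : Ck k f -> Ck k g -> Ck k (fun z => f z + g z).
Proof.
elim: k f g => [|k IH] f g.
  by move=> [cf _] [cg _]; split => // z; apply: cvgD; [exact: cf|exact: cg].
move=> Cf Cg; apply: (CkSI (df := fun v z => 'D_v f z + 'D_v g z)).
- by move=> z; apply: cvgD; [exact: (Ck_continuous Cf)|exact: (Ck_continuous Cg)].
- by move=> z v; exact: (is_deriveD (Ck_is_derive z v Cf) (Ck_is_derive z v Cg)).
- by move=> v; apply: IH; (exact: (Ck_derive v Cf) || exact: (Ck_derive v Cg)).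
Qed.

Lemma CkM k f g : Ck k f -> Ck k g -> Ck k (fun z => f z * g z).
Proof.
elim: k f g => [|k IH] f g.
  by move=> [cf _] [cg _]; split => // z; apply: cvgM; [exact: cf|exact: cg].
move=> Cf Cg; apply: (CkSI (df := fun v z => f z * 'D_v g z + g z * 'D_v f z)).
- by move=> z; apply: cvgM; [exact: (Ck_continuous Cf)|exact: (Ck_continuous Cg)].
- by move=> z v; exact: (is_deriveM (Ck_is_derive z v Cf) (Ck_is_derive z v Cg)).
- move=> v; apply: CkD; apply: IH; by [exact: CkW | exact: (Ck_derive v Cf)
    | exact: (Ck_derive v Cg)].
Qed.

Lemma Ck_prod k (I : Type) (s : seq I) (P : pred I) (F : I -> V -> R) :
  (forall i, Ck k (F i)) -> Ck k (fun z => \prod_(i <- s | P i) F i z).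
Proof.
move=> CF; elim: s => [|i s IH].
  by under eq_fun do rewrite big_nil; exact: Ck_cst.
under eq_fun do rewrite big_cons.
by case: (P i) => //; exact: CkM.
Qed.

End Ck_theory.

(** The second hypothesis makes [L] affine with linear part [l], so a derivative of [f \o L] is a
    derivative of [f] composed with [L], and the induction closes. Rescalings, reflections and time
    slices are all of this kind. *)
Lemma Ck_comp_affine (R : realType) (V W : normedModType R) k (f : W -> R) (L l : V -> W) :
  continuous L -> (forall z v (h : R), L (h *: v + z) = h *: l v + L z) ->
  Ck k f -> Ck k (f \o L).
Proof.
move=> cL Ll; elim: k f => [|k IH] f.
  by move=> [cf _]; split => // z; apply: continuous_comp; [exact: cL|exact: cf].
move=> Cf; apply: (CkSI (df := fun v z => 'D_(l v) f (L z))).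
- by move=> z; apply: continuous_comp; [exact: cL|exact: (Ck_continuous Cf)].
- by move=> z v; exact: (is_derive_affine (Ll z v) (Ck_is_derive (L z) (l v) Cf)).
- by move=> v; apply: (IH (fun y => 'D_(l v) f y)); exact: (Ck_derive (l v) Cf).
Qed.

(** * The flat exponential and the one-dimensional bump *)

Section bump.
Context (R : realType).
Implicit Types (x : R) (m k : nat).

(* Closing the family under differentiation is what makes [expflat 0] smooth. *)
Definition expflat m x : R := if 0 < x then x^-1 ^+ m * expR (- x^-1) else 0.

Lemma expflat_ge0 m x : 0 <= expflat m x.
Proof.
rewrite /expflat; case: ifPn => // x0.
by rewrite mulr_ge0 ?expR_ge0// exprn_ge0// invr_ge0 ltW.
Qed.

(** With y = 1/x, the term y^(m+1) / (m+1)! of the exponential series is at most e^y. The linear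
    bound shows that each [expflat m] tends to 0 at 0. *)
Lemma expflat_le m x : 0 <= x -> expflat m x <= (m.+1)`!%:R * x.
Proof.
move=> x0; rewrite /expflat; case: ifPn => [{}x0|_]; last by rewrite mulr_ge0.
have ix : 0 < x^-1 by rewrite invr_gt0.
rewrite expRN ler_pdivrMr ?expR_gt0//.
have := expR_ge1Dxn m (ltW ix); set e := expR _ => he.
have {he} : x^-1 ^+ m.+1 / (m.+1)`!%:R <= e by apply: le_trans he; rewrite lerDr.
rewrite ler_pdivrMr ?ltr0n ?fact_gt0// exprSr ler_pdivrMr// => he.
by rewrite (_ : _ * x * e = e * (m.+1)`!%:R * x)//; ring.
Qed.

Lemma expflatV m x : x^-1 * expflat m x = expflat m.+1 x.
Proof.
rewrite /expflat; case: ifPn => [x0|]; last by rewrite mulr0.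
by rewrite mulrA -exprS.
Qed.

(** At 0 the difference quotient of [expflat m] is [expflat m.+1] itself, which tends to 0. For x >
    0 the formula is the product rule. *)
Lemma is_derive_expflat m x :
  is_derive x 1 (expflat m) (expflat m.+2 x - m%:R * expflat m.+1 x).
Proof.
have [x0|x0|->] := ltgtP x 0.
- rewrite {2 3}/expflat ltNge (ltW x0)/= mulr0 subrr.
  apply: (near_eq_is_derive (f := cst 0)) => //.
  near=> y; rewrite /expflat ltNge (_ : y <= 0)//.
  by apply: ltW; near: y; exact: lt_nbhsl.
- apply: (near_eq_is_derive (f := fun y : R => (y^-1 ^+ m * expR (- y^-1) : R))) => //.
    near=> y; rewrite /expflat (_ : 0 < y)//.
    by near: y; exact: lt_nbhsr.
  have x1 : x != 0 by rewrite gt_eqF.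
  have dV : is_derive x 1 (fun y : R => y^-1) (- x ^- 2).
    apply: (is_derive_eq (@is_deriveV _ id x 1 1 x1 (is_derive_id x 1))).
    by rewrite [_ *: _]mulr1.
  have dE : is_derive x 1 (fun y : R => expR (- y^-1)) (expR (- x^-1) * - (- x ^- 2)).
    exact: (@is_derive1_comp _ expR (fun y => - y^-1)).
  have dX : is_derive x 1 (fun y : R => y^-1 ^+ m) (m%:R * x^-1 ^+ m.-1 * - x ^- 2).
    by have := is_deriveX m dV; rewrite exprfctE.
  apply: (is_derive_eq (is_deriveM dX dE)).
  rewrite /expflat x0 /= -exprVn; set e := expR _; set y := x^-1.
  rewrite /GRing.scale/=; case: (m) => [|k] /=; first by ring.
  by rewrite !exprS; ring.
- rewrite /expflat ltxx mulr0 subr0.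
  have H : (fun h : R => h^-1 *: (expflat m (h *: (1 : R) + 0) - expflat m 0)) @ 0^' --> (0 : R).
    rewrite (_ : (fun _ => _) = expflat m.+1); last first.
      apply/funext => h; rewrite addr0 [h *: 1]mulr1 {2}/expflat ltxx subr0.
      exact: expflatV.
    apply/cvgrPdist_le => e e0; near=> h; rewrite sub0r normrN.
    have [h0|h0] := ltP 0 h; last by rewrite /expflat ltNge h0/= normr0 ltW.
    rewrite ger0_norm ?expflat_ge0// (le_trans (expflat_le _ (ltW h0)))//.
    rewrite mulrC -ler_pdivlMr ?ltr0n ?fact_gt0//.
    rewrite (le_trans (ler_norm _))//; near: h.
    apply: dnbhs0_le; rewrite divr_gt0// ltr0n fact_gt0//.
  split; first by apply/cvg_ex; exists 0.
  exact/cvg_lim.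
Unshelve. all: by end_near. Qed.

Lemma continuous_expflat m : continuous (expflat m).
Proof.
move=> x; apply/differentiable_continuous/derivable1_diffP.
by have [] := is_derive_expflat m x.
Qed.

Lemma Ck_expflat (V : normedModType R) k m (L l : V -> R) :
  continuous L -> (forall z v (h : R), L (h *: v + z) = h *: l v + L z) ->
  Ck k (expflat m \o L).
Proof.
move=> cL Ll; elim: k m => [|k IH] m.
  by split => // z; apply: continuous_comp; [exact: cL|exact: continuous_expflat].
apply: (CkSI (df := fun v z => (expflat m.+2 (L z) - m%:R * expflat m.+1 (L z)) * l v)).
- by move=> z; apply: continuous_comp; [exact: cL|exact: continuous_expflat].
- move=> z v; apply: is_derive_comp_line; last exact: is_derive_expflat.
  have /(is_derive_affine (Ll z v)) : is_derive (L z) (l v) (id : R -> R) (l v) by exact: is_derive_id.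
  by [].
- move=> v; apply: CkM; last exact: Ck_cst.
  apply: CkD; first exact: IH.
  rewrite (_ : (fun _ => _) = fun z => (- m%:R) * expflat m.+1 (L z)).
    by apply: CkM; [exact: Ck_cst|exact: IH].
  by apply/funext => z; rewrite mulNr.
Qed.

Definition bump1 x := expflat 0 (1 + x) * expflat 0 (1 - x).

Lemma expflat0E x : 0 < x -> expflat 0 x = expR (- x^-1).
Proof. by move=> x0; rewrite /expflat x0 expr0 mul1r. Qed.

Lemma bump1_ge0 x : 0 <= bump1 x.
Proof. by rewrite mulr_ge0 ?expflat_ge0. Qed.

Lemma bump1_le1 x : bump1 x <= 1.
Proof.
have H y : expflat 0 y <= 1.
  rewrite /expflat; case: ifPn => // y0; rewrite expr0 mul1r -expR0 ler_expR.
  by rewrite oppr_le0 invr_ge0 ltW.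
by rewrite mulr_ile1 ?expflat_ge0.
Qed.

Lemma bump1N x : bump1 (- x) = bump1 x.
Proof. by rewrite /bump1 opprK mulrC. Qed.

Lemma bump1_eq0 x : 1 <= `|x| -> bump1 x = 0.
Proof.
rewrite ler_normr => /orP[] h; rewrite /bump1 /expflat.
  by rewrite (ltNge _ (1 - x)) (_ : 1 - x <= 0) ?mulr0//; lra.
by rewrite ltNge (_ : 1 + x <= 0) ?mul0r//; lra.
Qed.

(** Both factors are evaluated at points y >= 1/3, where e^(-1/y) >= e^(-3). This is the origin of
    the inner boxes of ratio 2/3 used for all cut-offs. *)
Lemma bump1_lb x : `|x| <= 2 / 3 -> expR (- 6) <= bump1 x.
Proof.
rewrite ler_norml => /andP[x1 x2].
have H y : 1 / 3 <= y -> expR (- 3) <= expflat 0 y.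
  move=> y3; have y0 : 0 < y by lra.
  rewrite expflat0E// ler_expR lerN2 invf_ple ?posrE//.
  by lra.
rewrite (_ : - 6 = - 3 + - 3); last by lra.
by rewrite expRD ler_pM ?expR_ge0// H; lra.
Qed.

End bump.

(** * Boxes and Borel functions in space-time *)

Section spacetime_topology.
Context (R : realType) (n : nat).
Local Notation V := ('rV[R]_n * R)%type.
Local Notation X := ('rV[R]_n * measurableTypeR R)%type.
Implicit Types (z c : V) (a b : R).

Lemma continuous_row (T : topologicalType) m (f : T -> 'rV[R]_m) :
  (forall i, continuous (fun t => f t ord0 i)) -> continuous f.
Proof.
move=> cf t; apply/cvg_ballP => e e0.
have H : \forall s \near t, forall k, ball (f t ord0 k) e (f s ord0 k).
  by apply: filter_forall => k; have /cvg_ballP/(_ e e0) := cf k t.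
by apply: filterS H => s Hs; split => // i j; rewrite (ord1 i); exact: Hs.
Qed.

Lemma continuous_space_coord (i : 'I_n) : continuous (fun z : V => z.1 ord0 i).
Proof.
move=> z; apply: (@continuous_comp _ _ _ fst (fun x : 'rV[R]_n => x ord0 i)).
  exact: cvg_fst.
exact: coord_continuous.
Qed.

Lemma continuous_time_coord : continuous (fun z : V => z.2).
Proof. by move=> z; exact: cvg_snd. Qed.

(** The half-widths in space and in time are independent because boxes later shrink in space at a
    fixed height in time. The sup norm in space makes them products of intervals, of explicit
    measure. *)
Definition cbox c a b : set V :=
  [set z : V | (forall i, `|z.1 ord0 i - c.1 ord0 i| <= a) /\ `|z.2 - c.2| <= b].

Lemma cboxE c a b : cbox c a b =
  [set x : 'rV[R]_n | forall i, x ord0 i \in `[c.1 ord0 i - a, c.1 ord0 i + a]] `*`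
  `[c.2 - b, c.2 + b].
Proof.
apply/seteqP; split => z [/= h1 h2]; split => /=.
- by move=> i; rewrite in_itv/= -ler_distl.
- by rewrite in_itv/= -ler_distl.
- by move=> i; rewrite ler_distl; have := h1 i; rewrite in_itv.
- by rewrite ler_distl; have := h2; rewrite in_itv.
Qed.

Lemma cboxS c a b a' b' : a <= a' -> b <= b' -> cbox c a b `<=` cbox c a' b'.
Proof.
move=> aa bb z [h1 h2]; split => [i|]; last exact: le_trans bb.
exact: le_trans aa.
Qed.

Lemma cbox_compact c a b : compact (cbox c a b).
Proof.
rewrite cboxE; apply: compact_setX; last exact: segment_compact.
exact: (@rV_compact R n (fun i => `[c.1 ord0 i - a, c.1 ord0 i + a]%classic)
  (fun i => @segment_compact _ _ _)).
Qed.

Lemma cbox_measurable c a b : measurable (cbox c a b : set X).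
Proof.
rewrite cboxE; apply: measurableX; last exact: measurable_itv.
rewrite (_ : [set _ | _] = \bigcap_(j in [set: 'I_n])
  ((fun x : 'rV[R]_n => x ord0 j) @^-1` `[c.1 ord0 j - a, c.1 ord0 j + a])).
  apply: fin_bigcap_measurable => [|j _]; first exact: finite_finset.
  by rewrite -[X in measurable X]setTI; exact: measurable_coord_rV.
by apply/seteqP; split => [x Bx j _|x Bx j]; [exact: Bx|exact: (Bx j I)].
Qed.

Lemma Leb_cbox c a b : 0 <= a -> 0 <= b ->
  Leb R n (cbox c a b : set X) = ((2 * a) ^+ n * (2 * b))%:E.
Proof.
move=> a0 b0; have := cbox_measurable c a b; rewrite cboxE => _.
rewrite /= product_measure1E; last 2 first.
- rewrite (_ : [set _ | _] = \bigcap_(j in [set: 'I_n])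
    ((fun x : 'rV[R]_n => x ord0 j) @^-1` `[c.1 ord0 j - a, c.1 ord0 j + a])).
    apply: fin_bigcap_measurable => [|j _]; first exact: finite_finset.
    by rewrite -[X in measurable X]setTI; exact: measurable_coord_rV.
  by apply/seteqP; split => [x Bx j _|x Bx j]; [exact: Bx|exact: (Bx j I)].
- exact: measurable_itv.
rewrite EFinM; congr (_ * _)%E.
  apply: etrans (lebesgue_rV_box (a := fun i => c.1 ord0 i - a)
    (b := fun i => c.1 ord0 i + a) _) _; first by move=> i; lra.
  congr (_%:E).
  rewrite (eq_bigr (fun=> 2 * a)); last by move=> i _; ring.
  by rewrite prodr_const card_ord.
apply: etrans (lebesgue_measure_itv `[_, _]) _ => /=.
rewrite lte_fin; case: ifPn => [_|]; first by rewrite -EFinB; congr (_%:E); ring.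
by rewrite -leNgt => h; congr (_%:E); lra.
Qed.

(** The function is factored through row vectors of length n + 1, whose sigma-algebra is generated
    by the open sets; there the preimage of an open interval is open. *)
Lemma continuous_measurable_spacetime (f : V -> R) :
  continuous f -> measurable_fun [set: X] f.
Proof.
move=> cf.
pose tot (z : X) : R * 'rV[R]_n := (z.2 : R, z.1).
pose of_rV (x : 'rV[R]_n.+1) : V :=
  (\row_i x ord0 (lift ord0 i), x ord0 ord0).
have E : f = f \o of_rV \o (@cons_rV R n \o tot).
  apply/funext => -[x t] /=; congr f; rewrite /of_rV cons_rV0; congr pair.
  by apply/rowP => i; rewrite mxE cons_rVS.
rewrite E; apply: measurableT_comp; last first.
  apply: measurable_fun_rVP => i /=; case: (unliftP ord0 i) => [j|] ->.
    under eq_fun do rewrite cons_rVS.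
    exact: (measurableT_comp (measurable_coord_rV j) measurable_fst).
  under eq_fun do rewrite cons_rV0.
  exact: measurable_snd.
apply: (measurability _ (measurable_realfun.RGenOpens.measurableE R)) => _ [_ [x [y ->] <-]].
rewrite setTI; apply: open_measurable_rV.
apply: open_comp; last exact: interval_open.
move=> x0 _; apply: continuous_comp; last exact: cf.
have c1 : {for x0, continuous (fun x : 'rV[R]_n.+1 => (\row_i x ord0 (lift ord0 i)) : 'rV[R]_n)}.
  by apply: continuous_row => i; under eq_fun do rewrite mxE; exact: coord_continuous.
have c2 : {for x0, continuous (fun x : 'rV[R]_n.+1 => x ord0 ord0)}.
  exact: coord_continuous.
exact: (cvg_pair c1 c2).
Qed.

End spacetime_topology.

Section cutoff.
Context (R : realType) (n : nat).
Local Notation V := ('rV[R]_n * R)%type.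
Local Notation X := ('rV[R]_n * measurableTypeR R)%type.
Implicit Types (z c v : V) (a b : R) (f : V -> R).

Definition ebase (i : 'I_n) : V := (delta_mx ord0 i, 0).
Definition etime : V := (0, 1).

(** Compact support recorded by an explicit box. Derivatives keep the same box, because its
    complement is open. *)
Definition vanish_off (B : set V) f := forall z, ~ B z -> f z = 0.

Lemma closed_cbox c a b : closed (cbox c a b).
Proof. exact: compact_closed (@cbox_compact _ _ _ _ _). Qed.

Lemma vanish_off_derive c a b f v : vanish_off (cbox c a b) f ->
  vanish_off (cbox c a b) (fun z => 'D_v f z).
Proof.
move=> f0 z Bz; transitivity ('D_v (cst (0 : R)) z).
  apply: near_eq_derive.
  have /open_nbhs_nbhs : open_nbhs z (~` cbox c a b).
    by split => //; exact/closed_openC/closed_cbox.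
  by apply: filterS => y /f0.
by have [] := is_derive_cst (0 : R) z v.
Qed.

Lemma vanish_off_bounded c a b f : continuous f -> vanish_off (cbox c a b) f ->
  exists2 B, 0 <= B & forall z, `|f z| <= B.
Proof.
move=> cf f0.
have /compact_bounded[M [_ hM]] : compact (f @` cbox c a b).
  apply: continuous_compact; last exact: cbox_compact.
  exact: continuous_subspaceT.
exists (Num.max 0 (M + 1)); first by rewrite le_max lexx.
move=> z; rewrite le_max; have [Bz|/f0 ->] := pselect (cbox c a b z); last by rewrite normr0 lexx.
by apply/orP; right; apply: (hM (M + 1)); [rewrite ltrDl|exists z].
Qed.

Lemma Leb_cbox_lty c a b : 0 <= a -> 0 <= b ->
  (Leb R n (cbox c a b : set X) < +oo)%E.
Proof. by move=> a0 b0; rewrite Leb_cbox// ltry. Qed.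

Lemma vanish_off_integrable c a b f : 0 <= a -> 0 <= b -> continuous f ->
  vanish_off (cbox c a b) f -> (Leb R n).-integrable setT (EFin \o (f : X -> R)).
Proof.
move=> a0 b0 cf f0; have [B B0 fB] := vanish_off_bounded cf f0.
have mf := continuous_measurable_spacetime cf.
rewrite (_ : (f : X -> R) = f \_ (cbox c a b : set X)); last first.
  by apply/funext => z; rewrite patchE; case: ifPn => // /negP; rewrite inE => /f0.
rewrite -restrict_EFin; apply/(integrable_mkcond _ (cbox_measurable c a b)).
apply: measurable_bounded_integrable.
- exact: cbox_measurable.
- exact: Leb_cbox_lty.
- exact: measurable_funTS.
- by exists B; split; [exact: num_real|move=> x Bx y _ /=; rewrite (le_trans (fB y))// ltW].
Qed.

Definition bumpV z : R := (\prod_i bump1 (z.1 ord0 i)) * bump1 z.2.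

Lemma Ck_bumpV k : Ck k bumpV.
Proof.
have C1 m (L l : V -> R) : continuous L ->
    (forall z v (h : R), L (h *: v + z) = h *: l v + L z) -> Ck m (@bump1 R \o L).
  move=> cL Ll; apply: CkM.
    apply: (Ck_expflat _ _ (L := fun z => 1 + L z) (l := l)).
      by move=> z; apply: cvgD; [exact: cvg_cst|exact: cL].
    by move=> z v h; rewrite Ll; ring.
  apply: (Ck_expflat _ _ (L := fun z => 1 - L z) (l := fun v => - l v)).
    by move=> z; apply: cvgB; [exact: cvg_cst|exact: cL].
  by move=> z v h; rewrite Ll /GRing.scale/=; ring.
apply: CkM.
  apply: Ck_prod => i; apply: (C1 _ (fun z => z.1 ord0 i) (fun z => z.1 ord0 i)).
    exact: continuous_space_coord.
  by move=> z v h; rewrite !mxE.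
by apply: (C1 _ (fun z => z.2) (fun z => z.2)); first exact: continuous_time_coord.
Qed.

Lemma bumpVN z : bumpV (- z) = bumpV z.
Proof.
rewrite /bumpV bump1N; congr (_ * _).
by apply: eq_bigr => i _; rewrite mxE bump1N.
Qed.

Lemma bumpV_ge0 z : 0 <= bumpV z.
Proof. by rewrite mulr_ge0 ?bump1_ge0// prodr_ge0// => i _; exact: bump1_ge0. Qed.

Lemma bumpV_le1 z : bumpV z <= 1.
Proof.
rewrite mulr_ile1 ?bump1_ge0 ?bump1_le1// ?prodr_ge0// => [i _|].
  exact: bump1_ge0.
by apply: prodr_ile1 => i _; rewrite bump1_ge0 bump1_le1.
Qed.

Lemma bumpV_eq0 : vanish_off (cbox 0 1 1) bumpV.
Proof.
move=> z /not_andP[/existsNP[i]|] /negP; rewrite -ltNge.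
  rewrite mxE subr0 => /ltW/bump1_eq0 h.
  by rewrite /bumpV (bigD1 i)//= h !mul0r.
by rewrite subr0 => /ltW/bump1_eq0 h; rewrite /bumpV h mulr0.
Qed.

Definition rescale c a b z : V := (a^-1 *: (z.1 - c.1), b^-1 * (z.2 - c.2)).

Definition cutoff c a b z : R := bumpV (rescale c a b z).

Lemma continuous_rescale c a b : continuous (rescale c a b).
Proof.
move=> z.
have c1 : {for z, continuous (fun t : V => a^-1 *: (t.1 - c.1))}.
  apply: continuous_row => i; rewrite (_ : (fun _ => _) =
      fun t : V => a^-1 * (t.1 ord0 i - c.1 ord0 i)); last first.
    by apply/funext => t; rewrite !mxE.
  move=> t; apply: cvgM; first exact: cvg_cst.
  by apply: cvgB; [exact: continuous_space_coord|exact: cvg_cst].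
have c2 : {for z, continuous (fun t : V => b^-1 * (t.2 - c.2))}.
  apply: cvgM; first exact: cvg_cst.
  by apply: cvgB; [exact: continuous_time_coord|exact: cvg_cst].
exact: (cvg_pair c1 c2).
Qed.

Lemma rescale_affine c a b z v (h : R) :
  rescale c a b (h *: v + z) = h *: rescale 0 a b v + rescale c a b z.
Proof.
rewrite /rescale; congr pair => /=; last by rewrite /GRing.scale/=; ring.
by apply/rowP => i; rewrite !mxE; ring.
Qed.

Lemma Ck_cutoff k c a b : Ck k (cutoff c a b).
Proof.
apply: (@Ck_comp_affine R V V k bumpV (rescale c a b) (rescale 0 a b)).
- exact: continuous_rescale.
- exact: rescale_affine.
- exact: Ck_bumpV.
Qed.

Lemma cutoff_ge0 c a b z : 0 <= cutoff c a b z.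
Proof. exact: bumpV_ge0. Qed.

Lemma cutoff_le1 c a b z : cutoff c a b z <= 1.
Proof. exact: bumpV_le1. Qed.

Lemma rescale_cbox c a b r z : 0 < a -> 0 < b ->
  cbox 0 r r (rescale c a b z) <-> cbox c (r * a) (r * b) z.
Proof.
have N d x : 0 < d -> (`|d^-1 * x - 0| <= r) = (`|x| <= r * d) :> bool.
  by move=> d0; rewrite subr0 normrM gtr0_norm ?invr_gt0// mulrC ler_pdivrMr.
move=> a0 b0; split=> -[h1 h2]; split.
- by move=> i; have := h1 i; rewrite !mxE N.
- by have := h2; rewrite N.
- by move=> i; rewrite !mxE N.
- by rewrite N.
Qed.

Lemma cutoff_eq0 c a b : 0 < a -> 0 < b -> vanish_off (cbox c a b) (cutoff c a b).
Proof.
move=> a0 b0 z Bz; apply: bumpV_eq0; apply: contra_not Bz.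
by move/rescale_cbox; rewrite !mul1r; exact.
Qed.

(** Lower bound of a cut-off on the concentric box of ratio 2/3: a factor e^(-6) for each space
    coordinate and one for time, independently of the scale. *)
Definition cutoff_min : R := expR (- 6) ^+ n * expR (- 6).

Lemma cutoff_min_gt0 : 0 < cutoff_min.
Proof. by rewrite mulr_gt0// ?exprn_gt0// expR_gt0. Qed.

Lemma cutoff_lb c a b z : 0 < a -> 0 < b ->
  cbox c (2 / 3 * a) (2 / 3 * b) z -> cutoff_min <= cutoff c a b z.
Proof.
move=> a0 b0 /rescale_cbox => /(_ a0 b0)[h1 h2].
rewrite ler_pM ?exprn_ge0 ?expR_ge0//; last first.
  by apply: bump1_lb; move: h2; rewrite subr0.
rewrite -[X in _ ^+ X]card_ord -prodr_const; apply: ler_prod => i _.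
rewrite expR_ge0/=; apply: bump1_lb.
by have := h1 i; rewrite [X in _ - X]mxE subr0.
Qed.

Lemma is_deriveZdir f z v df (k : R) :
  is_derive z v f df -> is_derive z (k *: v) f (k * df).
Proof.
move=> /is_derive_line h; apply/is_derive_line.
have dk : is_derive (0 : R) 1 (fun s : R => s * k) k.
  apply: (is_derive_eq (is_deriveM (is_derive_id (0 : R) 1) (is_derive_cst k (0 : R) 1))).
  by rewrite scaler0 add0r [_ *: _]mulr1.
rewrite mulrC (_ : (fun _ => _) = (fun s : R => f (s *: v + z)) \o (fun s => s * k)).
  by apply: is_derive1_comp => //; rewrite mul0r.
by apply/funext => s /=; rewrite scalerA.
Qed.

(** The derivatives of a rescaled bump are those of [bumpV] divided by the half-width, so one
    constant serves for all centres and scales. *)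
Lemma cutoff_derive_bound : exists2 B, 0 <= B & forall c a b z, 0 < a -> 0 < b ->
  (forall i, `|'D_(ebase i) (cutoff c a b) z| <= B / a) /\
  `|'D_etime (cutoff c a b) z| <= B / b.
Proof.
have bd v : exists2 B, 0 <= B & forall z, `|'D_v bumpV z| <= B.
  apply: (@vanish_off_bounded 0 1 1).
    exact: (Ck_continuous (Ck_derive v (Ck_bumpV 1))).
  exact: vanish_off_derive bumpV_eq0.
have [Bt Bt0 hBt] := bd etime.
have /choice[Bi hBi] : forall i, exists B, 0 <= B /\ forall z, `|'D_(ebase i) bumpV z| <= B.
  by move=> i; have [B ? ?] := bd (ebase i); exists B.
have B0 : 0 <= \sum_i Bi i by apply: sumr_ge0 => i _; have [] := hBi i.
exists (Bt + \sum_i Bi i); first by rewrite addr_ge0.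
move=> c a b z a0 b0.
have D v k w : rescale 0 a b v = k *: w ->
    'D_v (cutoff c a b) z = k * 'D_w bumpV (rescale c a b z).
  move=> vw; have dw := Ck_is_derive (rescale c a b z) w (Ck_bumpV 1).
  have := is_deriveZdir k dw; rewrite -vw => /(is_derive_affine (rescale_affine c a b z v)).
  by case.
split=> [i|].
  rewrite (D _ a^-1 (ebase i)); last first.
    by congr pair; rewrite /= subr0 // ?mulr0 ?scaler0.
  rewrite normrM gtr0_norm ?invr_gt0// mulrC ler_pM2r ?invr_gt0//.
  have [_ /(_ (rescale c a b z)) h] := hBi i.
  rewrite (le_trans h)// (bigD1 i)//= addrCA lerDl addr_ge0//.
  by apply: sumr_ge0 => j _; have [] := hBi j.
rewrite (D _ b^-1 etime); last first.
  by congr pair; rewrite /= subr0 // ?mulr0 ?scaler0.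
rewrite normrM gtr0_norm ?invr_gt0// mulrC ler_pM2r ?invr_gt0//.
by rewrite (le_trans (hBt _))// lerDl.
Qed.

End cutoff.

(** * Mollification *)

Section convolution.
Context (R : realType) (n : nat).
Local Notation V := ('rV[R]_n * R)%type.
Local Notation X := ('rV[R]_n * measurableTypeR R)%type.
Implicit Types (z c v : V) (a b s : R) (f g K : V -> R).
Local Notation integrable f := ((Leb R n).-integrable setT (EFin \o (f : X -> R))).

Definition convol f K z : R := \int[Leb R n]_y (f y * K (z - (y : V))).

Lemma continuous_subl z : continuous (fun y : V => z - y).
Proof. by move=> y; apply: cvgB; [exact: cvg_cst|exact: cvg_id]. Qed.

Lemma integrableRD f g : integrable f -> integrable g ->
  integrable (fun z => f z + g z).
Proof.
by move=> fi gi; apply: eq_integrable (integrableD measurableT fi gi).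
Qed.

Lemma integrableRZ (k : R) f : integrable f -> integrable (fun z => k * f z).
Proof.
by move=> fi; apply: eq_integrable (integrableZl measurableT k fi).
Qed.

Lemma integrableRN f : integrable f -> integrable (fun z => - f z).
Proof.
by move=> fi; apply: eq_integrable (integrableN fi).
Qed.

Lemma integrableRB f g : integrable f -> integrable g ->
  integrable (fun z => f z - g z).
Proof. by move=> fi gi; apply: integrableRD => //; exact: integrableRN. Qed.

Lemma integrableR_norm f : integrable f -> integrable (fun z => `|f z|).
Proof. by move=> fi; exact: integrable_norm. Qed.

Lemma Rintegral_sum (I : Type) (r : seq I) (h : I -> V -> R) :
  (forall i, integrable (h i)) ->
  integrable (fun z => \sum_(i <- r) h i z) /\
  \int[Leb R n]_z (\sum_(i <- r) h i (z : V)) =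
  \sum_(i <- r) \int[Leb R n]_z h i (z : V).
Proof.
move=> hi; elim: r => [|i r [IH1 IH2]].
  rewrite (_ : (fun z : V => _) = fun=> 0); last by apply/funext => y; rewrite big_nil.
  split; first exact: integrable0.
  by rewrite Rintegral_cst// mul0r big_nil.
rewrite (_ : (fun z : V => _) = fun z => h i z + \sum_(j <- r) h j z); last first.
  by apply/funext => y; rewrite big_cons.
split; first exact: integrableRD.
by rewrite RintegralD// IH2 big_cons.
Qed.

Lemma integrable_mul_bounded f (g : V -> R) (B : R) : integrable f ->
  measurable_fun [set: X] (g : X -> R) -> (forall z, `|g z| <= B) ->
  integrable (fun y => f y * g y).
Proof.
move=> fi mg gB; apply: (@integrableMl _ _ _ _ _ measurableT _ (g : X -> R) fi mg).
by exists B; split; [exact: num_real|move=> x Bx y _ /=; rewrite (le_trans (gB y))// ltW].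
Qed.

Lemma convol_integrand f K s z : integrable f -> continuous K ->
  vanish_off (cbox 0 s s) K -> integrable (fun y => f y * K (z - y)).
Proof.
move=> fi cK K0; have [B B0 KB] := vanish_off_bounded cK K0.
apply: (integrable_mul_bounded fi (B := B)) => [|y]; last exact: KB.
apply: continuous_measurable_spacetime => y.
by apply: continuous_comp; [exact: continuous_subl|exact: cK].
Qed.

Lemma nbhs_cbox c a b : 0 < a -> 0 < b -> \forall z \near (c : V), cbox c a b z.
Proof.
move=> a0 b0; rewrite /cbox.
have H1 : \forall z \near c, forall i, `|(z : V).1 ord0 i - c.1 ord0 i| <= a.
  apply: (@filter_forall _ _ _ _ (nbhs_filter c)) => i.
  have /cvgrPdist_le/(_ a a0) := @continuous_space_coord R n i c.
  by apply: filterS => z; rewrite distrC.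
have H2 : \forall z \near c, `|(z : V).2 - c.2| <= b.
  have /cvgrPdist_le/(_ b b0) := @continuous_time_coord R n c.
  by apply: filterS => z; rewrite distrC.
exact: filterS2 H1 H2.
Qed.

Lemma cboxD c a b a' b' (h z : V) : cbox 0 a' b' h -> cbox c a b z ->
  cbox c (a' + a) (b' + b) (h + z).
Proof.
move=> [h1 h2] [z1 z2]; split=> [i|].
  have := h1 i; rewrite !mxE subr0 -addrA => k.
  by rewrite (le_trans (ler_normD _ _))// lerD.
by move: h2; rewrite subr0 => h2; rewrite -addrA (le_trans (ler_normD _ _))// lerD.
Qed.

Lemma cboxN a b (h : V) : cbox 0 a b h -> cbox 0 a b (- h).
Proof.
move=> [h1 h2]; split=> [i|]; last by move: h2; rewrite !subr0 normrN.
by have := h1 i; rewrite !mxE !subr0 normrN.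
Qed.

(** Compactness of the box enlarged by 1 gives a common neighbourhood of increments. Outside that
    box a shift by at most 1 cannot reach the original one, and both values vanish. *)
Lemma vanish_off_unif_continuous c a b K : continuous K -> vanish_off (cbox c a b) K ->
  forall e : R, 0 < e -> \forall h \near (0 : V), forall y, `|K (h + y) - K y| <= e.
Proof.
move=> cK K0 e e0.
have /compact_near_coveringP cov := @cbox_compact R n c (1 + a) (1 + b).
have := cov V (nbhs (0 : V)) (fun h y => `|K (h + y) - K y| <= e) _ _.
move=> H; have {}H : \forall h \near (0 : V),
    forall y, cbox c (1 + a) (1 + b) y -> `|K (h + y) - K y| <= e.
  apply: H => x _.
  have e2 : 0 < e / 2 by rewrite divr_gt0.
  have H1 : \forall x' \near (x : V) & h \near (0 : V), `|K (h + x') - K x| <= e / 2.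
    have cs : (fun p : V * V => K (p.2 + p.1)) @ ((x : V), (0 : V)) --> K x.
      have {2}-> : x = ((x : V, 0 : V).2 + (x : V, 0 : V).1) by rewrite /= add0r.
      apply: (@continuous_comp _ _ _ (fun p : V * V => p.2 + p.1) K); last exact: cK.
      by apply: cvgD; [exact: cvg_snd|exact: cvg_fst].
    move/cvgrPdist_le : cs => /(_ _ e2) [[A1 A2]/= [HA1 HA2] A].
    exists (A1, A2) => // -[p q] [/= Ap Aq]; rewrite distrC; exact: (A (p, q)).
  have H2 : \forall x' \near (x : V) & h \near (0 : V), `|K x' - K x| <= e / 2.
    move/cvgrPdist_le : (cK x) => /(_ _ e2) h2.
    exists ([set y | `|K x - K y| <= e / 2], setT); first by split => //; exact: filterT.
    by move=> [p q] [/= Ap _]; rewrite distrC.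
  apply: filterS2 H1 H2 => -[p q] /= h1 h2.
  by rewrite (splitr e) (le_trans (ler_distD (K x) _ _))// lerD// distrC.
have N1 := @nbhs_cbox 0 1 1 ltr01 ltr01.
near=> h => y; have [yB|yB] := pselect (cbox c (1 + a) (1 + b) y).
  by move: y yB; near: h; exact: H.
have h1 : cbox 0 1 1 h by near: h.
rewrite (K0 y) ?(K0 (h + y)) ?subrr ?normr0 ?ltW//.
- apply: contra_not yB => /(cboxD (cboxN h1)); by rewrite addKr.
- apply: contra_not yB; apply: cboxS; by rewrite lerDr.
Unshelve. all: by end_near. Qed.

Lemma continuous_convol f K s : integrable f -> continuous K ->
  vanish_off (cbox 0 s s) K -> continuous (convol f K).
Proof.
move=> fi cK K0 z; apply/cvgrPdist_le => e e0.
pose N := \int[Leb R n]_y `|f y|.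
have N0 : 0 <= N by apply: Rintegral_ge0.
have eN : 0 < e / (N + 1) by rewrite divr_gt0// ltr_wpDl.
have U := vanish_off_unif_continuous cK K0 eN.
apply/(@nbhs0P _ _ (fun t : V => `|convol f K z - convol f K t| <= e : Prop) z).
apply: filterS U => h hK.
have fz (x : V) := convol_integrand x fi cK K0.
rewrite /convol -RintegralB//.
have fn := integrableR_norm fi.
have fd := integrableRB (fz z) (fz (z + h)).
rewrite (le_trans (le_normr_Rintegral _ fd))//.
apply: (@le_trans _ _ (\int[Leb R n]_y (e / (N + 1) * `|f y|))).
  apply: le_Rintegral => //.
  - exact: integrableR_norm.
  - exact: integrableRZ.
  - move=> y _; rewrite -mulrBr normrM mulrC ler_wpM2r// distrC.
    by rewrite (_ : z + h - y = h + (z - y))//; rewrite addrCA addrA.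
rewrite RintegralZl//.
rewrite -/N mulrAC ler_pdivrMr ?ltr_wpDl//.
by rewrite ler_pM2l// lerDl.
Qed.

(** The derivative falls on the kernel alone, so [f] need only be integrable: differentiation under
    the integral is dominated by [B * |f|], where [B] bounds the derivative of [K]. *)
Lemma is_derive_convol f K s z v : integrable f -> Ck 1 K ->
  vanish_off (cbox 0 s s) K ->
  is_derive z v (convol f K) (convol f (fun y => 'D_v K y) z).
Proof.
move=> fi CK K0; have cK := Ck_continuous CK.
have K'0 := @vanish_off_derive R n 0 s s K v K0.
have cK' := Ck_continuous (Ck_derive v CK).
have [B B0 KB] := vanish_off_bounded cK' K'0.
apply/is_derive_line.
pose g (h : R) (y : X) : R := f y * K (h *: v + z - (y : V)).
have dg (h : R) (y : X) : is_derive h 1 (g ^~ y) (f y * 'D_v K (h *: v + z - (y : V))).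
  have dK : is_derive h 1 (fun h => K (h *: v + (z - (y : V)))) ('D_v K (h *: v + z - (y : V))).
    by rewrite -addrA; apply: is_derive_at; exact: (Ck_is_derive _ _ CK).
  rewrite /g; under eq_fun do rewrite -addrA.
  by apply: (is_derive_eq (is_deriveZ (f y) dK)).
have Z0 : `](-1), 1[%classic (0 : R) by rewrite /= in_itv/= ltrN10 ltr01.
have gi h : `](-1), 1[%classic h -> (Leb R n).-integrable setT (EFin \o g h).
  by move=> _; exact: (convol_integrand _ fi cK K0).
have dg1 h (y : X) : `](-1), 1[%classic h -> setT y -> derivable (g ^~ y) h 1.
  by move=> _ _; have [] := dg h y.
have Gi : (Leb R n).-integrable setT (EFin \o (fun y : X => B * `|f y|)).
  by apply: integrableRZ; exact: integrableR_norm.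
have gB h (y : X) : `](-1), 1[%classic h -> setT y -> `|partial1of2 g h y| <= B * `|f y|.
  move=> _ _; rewrite partial1of2E; have [_ ->] := dg h y.
  by rewrite normrM mulrC ler_wpM2r.
have G0 (y : X) : 0 <= B * `|f y| by rewrite mulr_ge0.
have H := cvg_differentiation_under_integral measurableT Z0 gi dg1 G0 Gi gB.
have E : convol f (fun y => 'D_v K y) z = \int[Leb R n]_y partial1of2 g 0 y.
  apply: eq_Rintegral => y _; rewrite partial1of2E; have [_ ->] := dg 0 y.
  by rewrite scale0r add0r.
have H' : (fun h : R => h^-1 *: (convol f K ((h *: (1 : R) + 0) *: v + z) -
    convol f K ((0 : R) *: v + z))) @ 0^' --> convol f (fun y => 'D_v K y) z.
  rewrite E; apply: cvg_trans H; apply: near_eq_cvg; apply: nearW => h.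
  by rewrite [h *: 1]mulr1.
split; first by apply/cvg_ex; exists (convol f (fun y => 'D_v K y) z).
exact/cvg_lim.
Qed.

End convolution.

(** * Mollifiers, integration by parts and integrals along segments *)

Section integral_calculus.
Context (R : realType) (n : nat).
Local Notation V := ('rV[R]_n * R)%type.
Local Notation X := ('rV[R]_n * measurableTypeR R)%type.
Implicit Types (z c v : V) (a b s : R) (f g K : V -> R).
Local Notation integrable f := ((Leb R n).-integrable setT (EFin \o (f : X -> R))).

Lemma measurable_sub : measurable_fun [set: X * X]
  (fun p : X * X => ((p.1 : V) - (p.2 : V) : V) : X).
Proof.
rewrite (_ : (fun _ => _) = fun p : X * X =>
  ((p.1.1 - p.2.1, p.1.2 - p.2.2 : measurableTypeR R) : X)); last first.
  by apply/funext => -[[x t] [y s]].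
apply: measurable_fun_pair => /=.
  apply: measurable_fun_rVP => i; under eq_fun do rewrite !mxE.
  apply: measurable_funB; apply: (measurableT_comp (measurable_coord_rV i)).
    exact: (measurableT_comp measurable_fst measurable_fst).
  exact: (measurableT_comp measurable_fst measurable_snd).
apply: measurable_funB.
  exact: (measurableT_comp measurable_snd measurable_fst).
exact: (measurableT_comp measurable_snd measurable_snd).
Qed.

(** Evenness turns y |-> K (z - y) into a translate of [K], so that its integral is 1 by translation
    invariance alone. *)
Definition mollifier s K :=
  [/\ forall k, Ck k K, forall z, 0 <= K z, forall z, K (- z) = K z,
      vanish_off (cbox 0 s s) K & \int[Leb R n]_z K (z : V) = 1].

Lemma mollifier_continuous s K : mollifier s K -> continuous K.
Proof. by move=> [CK _ _ _ _]; exact: (Ck_continuous (CK 0)). Qed.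

Lemma mollifier_integrable s K : 0 <= s -> mollifier s K -> integrable K.
Proof.
move=> s0 kK; have cK := mollifier_continuous kK; have [_ _ _ K0 _] := kK.
exact: vanish_off_integrable K0.
Qed.

Lemma convol_ge0 s f K z : mollifier s K -> (forall y, 0 <= f y) -> 0 <= convol f K z.
Proof. by move=> [_ K0 _ _ _] f0; apply: Rintegral_ge0 => y _; rewrite mulr_ge0. Qed.

(** Tonelli: integrated in z first, each K (z - y) is a translate of [K] and has mass 1. This is how
    the integral of a mollified error is traded for that of the error. *)
Lemma integrable_convol s f K : 0 <= s -> mollifier s K -> integrable f ->
  (forall z, 0 <= f z) ->
  integrable (convol f K) /\
  \int[Leb R n]_z convol f K (z : V) = \int[Leb R n]_z f (z : V).
Proof.
move=> s0 kK fi f0; have cK := mollifier_continuous kK; have [_ K0 KN Ks K1] := kK.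
have mK := continuous_measurable_spacetime cK.
have mf : measurable_fun [set: X] (f : X -> R) by apply/measurable_EFinP; exact: (measurable_int _ fi).
pose F (p : X * X) : \bar R := (f p.2 * K ((p.1 : V) - (p.2 : V)))%:E.
have mF : measurable_fun setT F.
  apply/measurable_EFinP/measurable_funM; first exact: (measurableT_comp mf measurable_snd).
  exact: (measurableT_comp mK measurable_sub).
have F0 p : (0 <= F p)%E by rewrite lee_fin mulr_ge0.
have cE z : (convol f K z)%:E = (\int[Leb R n]_y F (z, y))%E.
  rewrite /convol /Rintegral fineK//.
  by apply: integrable_fin_num => //; exact: (convol_integrand z fi cK Ks).
have tot : (\int[Leb R n]_z (convol f K (z : V))%:E = \int[Leb R n]_z (f (z : V))%:E)%E.
  under eq_integral do rewrite cE.
  rewrite (fubini_tonelli (m1 := Leb R n) (m2 := Leb R n) F mF F0).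
  apply: eq_integral => y _; rewrite /F /=.
  under eq_integral do rewrite EFinM.
  rewrite ge0_integralZl//; last 3 first.
  - apply/measurable_EFinP.
    exact: (measurableT_comp mK (measurable_translate (- (y : V)))).
  - by move=> z _; rewrite lee_fin.
  - by rewrite lee_fin.
  rewrite (ge0_integral_translate (- (y : V)) (f := fun z => (K (z : V))%:E)); last 2 first.
  - exact/measurable_EFinP.
  - by move=> z; rewrite lee_fin.
  rewrite -[X in (_ * X)%E]fineK ?[fine _]K1 ?mule1//.
  by apply: integrable_fin_num => //; exact: (mollifier_integrable s0 kK).
have ci : integrable (convol f K).
  have mc := continuous_measurable_spacetime (continuous_convol fi cK Ks).
  apply/integrableP; split; first exact/measurable_EFinP.
  under eq_integral do rewrite gee0_abs ?lee_fin ?(convol_ge0 _ kK)//.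
  by rewrite [ltLHS]tot; exact: integrable_lty.
by split => //; rewrite /Rintegral [X in fine X = _]tot.
Qed.

Lemma mollifier_exists s : 0 < s -> exists K, mollifier s K.
Proof.
move=> s0; pose k0 : V -> R := cutoff (0 : V) s s.
have ck0 : continuous k0 by exact: (Ck_continuous (Ck_cutoff 0 _ _ _)).
have k00 : vanish_off (cbox 0 s s) k0 by exact: cutoff_eq0.
have ik0 := vanish_off_integrable (ltW s0) (ltW s0) ck0 k00.
pose Z := \int[Leb R n]_z k0 (z : V).
(* The bump is at least [cutoff_min] on the box of ratio 2/3, which has positive measure. *)
have Z0 : 0 < Z.
  pose b := cbox (0 : V) (2 / 3 * s) (2 / 3 * s).
  have s23 : 0 < 2 / 3 * s by rewrite mulr_gt0.
  apply: (@lt_le_trans _ _ (\int[Leb R n]_(z in (b : set X)) cutoff_min R n)).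
    rewrite Rintegral_cst; last exact: cbox_measurable.
    rewrite [X in fine X](Leb_cbox _ (ltW s23) (ltW s23)) /=.
    rewrite mulr_gt0 ?cutoff_min_gt0// mulr_gt0//; last by rewrite mulr_gt0.
    by rewrite exprn_gt0// mulr_gt0.
  rewrite Rintegral_mkcond; apply: le_Rintegral => //.
    rewrite -restrict_EFin; apply/(integrable_mkcond _ (cbox_measurable _ _ _)).
    apply: measurable_bounded_integrable => //.
    - exact: cbox_measurable.
    - exact: (Leb_cbox_lty _ (ltW s23) (ltW s23)).
    - exact: (@bounded_cst _ R^o).
  move=> z _; rewrite patchE; case: ifPn => [|_]; last exact: cutoff_ge0.
  by rewrite inE => bz; exact: cutoff_lb.
exists (fun z => Z^-1 * k0 z); split.
- by move=> k; apply: CkM; [exact: Ck_cst|exact: Ck_cutoff].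
- by move=> z; rewrite mulr_ge0 ?cutoff_ge0// invr_ge0 ltW.
- move=> z; rewrite /k0 /cutoff -bumpVN; congr (_ * bumpV _).
  by congr pair; rewrite /= ?subr0 -?scalerN ?opprK // -mulrN opprK.
- by move=> z /k00 ->; rewrite mulr0.
- by rewrite RintegralZl// mulVf// gt_eqF.
Qed.

(** Integration by parts without boundary term, from translation invariance: the integral of H (h v
    + z) over z is constant in h, and its derivative at h = 0 is the integral of [dH]. *)
Lemma Rintegral_derive_eq0 c a b v (H dH : V -> R) : 0 <= a -> 0 <= b -> cbox 0 1 1 v ->
  continuous H -> continuous dH ->
  vanish_off (cbox c a b) H -> (forall z, is_derive z v H (dH z)) ->
  \int[Leb R n]_z dH (z : V) = 0.
Proof.
move=> a0 b0 v1 cH cdH H0 HdH.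
have dH0 : vanish_off (cbox c a b) dH.
  by move=> z /(@vanish_off_derive R n c a b H v H0); have [_ ->] := HdH z.
have [B B0 dHB] := vanish_off_bounded cdH dH0.
have Hi := vanish_off_integrable a0 b0 cH H0.
pose g (h : R) (y : X) : R := H (h *: v + (y : V)).
have dg (h : R) (y : X) : is_derive h 1 (g ^~ y) (dH (h *: v + (y : V))).
  exact: is_derive_at.
(* A majorant valid for all |h| < 1: [v] lies in the unit box, so the shift moves the support by at
   most 1 in every direction. *)
pose G : X -> R := (fun=> B) \_ (cbox c (1 + a) (1 + b) : set X).
have Z0 : `](-1), 1[%classic (0 : R) by rewrite /= in_itv/= ltrN10 ltr01.
have gE h : g h = (H : X -> R) \o translate (h *: v).
  by apply/funext => y; rewrite /g /translate /= addrC.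
have gi h : `](-1), 1[%classic h -> (Leb R n).-integrable setT (EFin \o g h).
  by move=> _; rewrite gE; exact: integrable_translate.
have dg1 h (y : X) : `](-1), 1[%classic h -> setT y -> derivable (g ^~ y) h 1.
  by move=> _ _; have [] := dg h y.
have Gi : (Leb R n).-integrable setT (EFin \o G).
  rewrite -restrict_EFin; apply/(integrable_mkcond _ (cbox_measurable _ _ _)).
  apply: measurable_bounded_integrable => //.
  - exact: cbox_measurable.
  - by apply: Leb_cbox_lty; rewrite addr_ge0.
  - exact: (@bounded_cst _ R^o).
have G0 (y : X) : 0 <= G y by rewrite /G patchE; case: ifPn.
have gB h (y : X) : `](-1), 1[%classic h -> setT y -> `|partial1of2 g h y| <= G y.
  rewrite /= in_itv/= => /andP[h1 h2] _; rewrite partial1of2E; have [_ ->] := dg h y.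
  rewrite /G patchE; case: ifPn => [_|/negP]; first exact: dHB.
  rewrite inE => yB; rewrite dH0 ?normr0//; apply: contra_not yB.
  move=> /(cboxD (h := - (h *: v)) (a' := 1) (b' := 1)); rewrite addKr; apply.
  apply: cboxN; have [v1' v2'] := v1.
  have hn : `|h| <= 1 by rewrite ler_norml !ltW.
  split=> [i|]; last by rewrite subr0 normrM mulr_ile1//; move: v2'; rewrite subr0.
  rewrite !mxE subr0 normrM mulr_ile1//; by have := v1' i; rewrite mxE subr0.
have L := cvg_differentiation_under_integral measurableT Z0 gi dg1 G0 Gi gB.
have E : \int[Leb R n]_z dH (z : V) = \int[Leb R n]_y partial1of2 g 0 y.
  apply: eq_Rintegral => y _; rewrite partial1of2E; have [_ ->] := dg 0 y.
  by rewrite scale0r add0r.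
rewrite E; apply: (cvg_unique _ L) => //.
rewrite (_ : (fun _ => _) = cst 0); first exact: cvg_cst.
apply/funext => h; rewrite !gE /=.
by rewrite !(Rintegral_translate _ Hi) subrr scaler0.
Qed.

Lemma bounded_on_cbox c a b f : continuous f ->
  exists2 B : R, 0 <= B & forall z, cbox c a b z -> `|f z| <= B.
Proof.
move=> cf.
have /compact_bounded[M [_ hM]] : compact (f @` cbox c a b).
  apply: continuous_compact; last exact: cbox_compact.
  exact: continuous_subspaceT.
exists (Num.max 0 (M + 1)); first by rewrite le_max lexx.
move=> z Bz; rewrite le_max; apply/orP; right.
by apply: (hM (M + 1)); [rewrite ltrDl|exists z].
Qed.

Lemma integrable_on_cbox (B : set X) c a b f : measurable B -> B `<=` cbox c a b ->
  0 <= a -> 0 <= b -> continuous f ->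
  (Leb R n).-integrable B (EFin \o (f : X -> R)).
Proof.
move=> mB Bc a0 b0 cf; have [M M0 hM] := bounded_on_cbox c a b cf.
apply: measurable_bounded_integrable => //.
- apply: (le_lt_trans _ (Leb_cbox_lty c a0 b0)); apply: le_measure => //.
  + by rewrite inE.
  + by rewrite inE; exact: cbox_measurable.
- apply: measurable_funTS; exact: continuous_measurable_spacetime.
- exists M; split; first exact: num_real.
  by move=> x Mx y /Bc/hM /= h; rewrite (le_trans h)// ltW.
Qed.

(** Mean value theorem for the integral of w (h v + z) over [B] as a function of h: the difference
    is, up to sign, the derivative at a single h. A bound at each h suffices, and nothing is
    integrated in h. *)
Lemma path_integral_le (B : set X) v (w dw : V -> R) (M m : R) c a b :
  measurable B -> B `<=` cbox c a b -> 0 <= a -> 0 <= b -> 0 <= m ->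
  cbox 0 m m v ->
  continuous w -> continuous dw -> (forall z, is_derive z v w (dw z)) ->
  (forall h : R, 0 <= h <= 1 -> \int[Leb R n]_(z in B) `|dw (h *: v + (z : V))| <= M) ->
  \int[Leb R n]_(z in B) w (z : V) - \int[Leb R n]_(z in B) w (v + (z : V)) <= M.
Proof.
move=> mB Bc a0 b0 m0 vm cw cdw wdw hM.
have cs f (h : R) : continuous f -> continuous (fun z : V => f (h *: v + z)).
  move=> cf z; apply: (@continuous_comp _ _ _ (fun z : V => h *: v + z) f); last exact: cf.
  by apply: cvgD; [exact: cvg_cst|exact: cvg_id].
pose g (h : R) (y : X) : R := w (h *: v + (y : V)).
have dg (h : R) (y : X) : is_derive h 1 (g ^~ y) (dw (h *: v + (y : V))).
  exact: is_derive_at.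
(* The parameter runs in the open interval ]-1, 2[, which contains [0, 1]; there |h| <= 2, whence
   the enlargement by [2 * m]. *)
have [N N0 hN] := bounded_on_cbox c (2 * m + a) (2 * m + b) cdw.
have gi h : `](-1), 2[%classic h -> (Leb R n).-integrable B (EFin \o g h).
  by move=> _; apply: (integrable_on_cbox mB Bc a0 b0); exact: cs.
have dg1 h (y : X) : `](-1), 2[%classic h -> B y -> derivable (g ^~ y) h 1.
  by move=> _ _; have [] := dg h y.
have Gi : (Leb R n).-integrable B (EFin \o (cst N)).
  by apply: (integrable_on_cbox mB Bc a0 b0) => z; exact: cst_continuous.
have gB h (y : X) : `](-1), 2[%classic h -> B y -> `|partial1of2 g h y| <= N.
  rewrite /= in_itv/= => /andP[h1 h2] By; rewrite partial1of2E; have [_ ->] := dg h y.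
  apply: hN; apply: cboxD; last exact: Bc.
  have [v1 v2] := vm; have hn : `|h| <= 2 by rewrite ler_norml !ltW//; lra.
  split=> [i|]; last first.
    by rewrite subr0 normrM ler_pM//; move: v2; rewrite subr0.
  rewrite !mxE subr0 normrM ler_pM//; by have := v1 i; rewrite mxE subr0.
pose Phi (h : R) := \int[Leb R n]_(y in B) g h y.
pose dPhi (h : R) := \int[Leb R n]_(y in B) partial1of2 g h y.
have dPhiP (h : R) : `](-1), 2[%classic h -> is_derive h 1 Phi (dPhi h).
  move=> hI.
  have L := cvg_differentiation_under_integral mB hI gi dg1 (fun _ => N0) Gi gB.
  have L' : (fun k : R => k^-1 *: (Phi (k *: (1 : R) + h) - Phi h)) @ 0^' --> dPhi h.
    apply: cvg_trans L; apply: near_eq_cvg; apply: nearW => k.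
    by rewrite [k *: 1]mulr1.
  split; first by apply/cvg_ex; exists (dPhi h).
  exact/cvg_lim.
have I01 (h : R) : h \in `[0, 1] -> `](-1), 2[%classic h.
  rewrite /= !in_itv/= => /andP[h1 h2]; apply/andP; split; lra.
have cPhi : {within `[0, 1], continuous Phi}.
  apply: derivable_within_continuous => h h01.
  by have [] := dPhiP h (I01 h h01).
have dP01 (h : R) : h \in `]0, 1[ -> is_derive h 1 Phi (dPhi h).
  rewrite in_itv/= => /andP[h1 h2].
  by apply: dPhiP; apply: I01; rewrite in_itv/= !ltW.
have [h h01] := MVT ltr01 dP01 cPhi.
rewrite subr0 mulr1 => PhiE.
have -> : \int[Leb R n]_(z in B) w (z : V) = Phi 0.
  by apply: eq_Rintegral => y _; rewrite /g scale0r add0r.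
have -> : \int[Leb R n]_(z in B) w (v + (z : V)) = Phi 1.
  by apply: eq_Rintegral => y _; rewrite /g scale1r.
rewrite -opprB PhiE.
have dE y : partial1of2 g h y = dw (h *: v + (y : V)).
  by rewrite partial1of2E; have [_ ->] := dg h y.
have di : (Leb R n).-integrable B (EFin \o (fun y : X => dw (h *: v + (y : V)))).
  by apply: (integrable_on_cbox mB Bc a0 b0); exact: cs.
apply: le_trans (hM h _); last by move: h01; rewrite in_itv/= => /andP[? ?]; rewrite !ltW.
rewrite /dPhi (eq_Rintegral _ (g := fun y : X => dw (h *: v + (y : V)))); last by move=> y _; exact: dE.
by rewrite (le_trans (ler_norm _))// normrN; exact: le_normr_Rintegral.
Qed.

End integral_calculus.

(** * Approximation in L^p by Lipschitz functions *)

Section lipschitz_density.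
Context (R : realType) (n : nat).
Local Notation V := ('rV[R]_n * R)%type.
Local Notation X := ('rV[R]_n * measurableTypeR R)%type.

Definition box_lipschitz (g : V -> R) :=
  exists2 L : R, 0 <= L & forall (r : R) (z h : V),
    cbox 0 r r h -> `|g (h + z) - g z| <= L * r.

Variables (p : R) (p0 : 0 < p) (c : V) (a b : R) (a0 : 0 <= a) (b0 : 0 <= b).
Let N : set X := cbox c a b.
Let mN : measurable N. Proof. exact: cbox_measurable. Qed.
#[local] Hint Resolve mN : core.

(** The closure of the Lipschitz functions in L^p of the box [N], together with measurability.
    Comparing the p-th power of the norm with [e] avoids roots. *)
Definition lips_approx (f : X -> R) := measurable_fun setT f /\
  forall e : R, 0 < e -> exists g : V -> R,
    [/\ box_lipschitz g, measurable_fun setT (g : X -> R) &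
      (\int[Leb R n]_(z in N) (`|f z - g z| `^ p)%:E < e%:E)%E].

Lemma powR_leD (C x y t : R) : 0 <= C -> 0 <= x -> 0 <= y -> 0 <= t ->
  t <= C * (x + y) -> t `^ p <= (2 * C) `^ p * (x `^ p + y `^ p).
Proof.
move=> C0 x0 y0 t0 tC.
have : t <= 2 * C * Num.max x y.
  apply: (le_trans tC); rewrite -mulrA mulrCA ler_wpM2l//.
  by case: (leP x y) => xy; lra.
move=> /(ge0_ler_powR (ltW p0)); rewrite !nnegrE => /(_ t0).
have m0 : 0 <= Num.max x y by rewrite le_max x0.
rewrite !mulr_ge0// => /(_ isT)/le_trans; apply.
rewrite powRM ?mulr_ge0// ler_wpM2l ?powR_ge0//.
by case: (leP x y) => xy; rewrite ?lerDl ?lerDr powR_ge0.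
Qed.

Lemma measurable_powR_norm (f : X -> R) : measurable_fun setT f ->
  measurable_fun setT (fun z => `|f z| `^ p).
Proof.
move=> mf; apply: (measurableT_comp (measurable_powR p)).
exact: (measurableT_comp (@normr_measurable R setT)).
Qed.

(** A Lipschitz operation on values preserves approximability in L^p. One proof covers linear
    combinations, maxima and complements. *)
Lemma lips_approx_op2 (op : R -> R -> R) (C : R) (f1 f2 : X -> R) : 0 <= C ->
  (forall x y x' y', `|op x y - op x' y'| <= C * (`|x - x'| + `|y - y'|)) ->
  (forall h1 h2 : X -> R, measurable_fun setT h1 -> measurable_fun setT h2 ->
    measurable_fun setT (fun z => op (h1 z) (h2 z))) ->
  lips_approx f1 -> lips_approx f2 -> lips_approx (fun z => op (f1 z) (f2 z)).
Proof.
move=> C0 opC mop [mf1 H1] [mf2 H2]; split; first exact: mop.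
move=> e e0.
pose D := (2 * C) `^ p.
have D0 : 0 <= D by exact: powR_ge0.
(* The total error is then at most e D / (D + 1), strictly below [e]; the added 1 keeps the
   denominator positive when [D] is 0. *)
have e2 : 0 < e / 2 / (D + 1) by rewrite !divr_gt0// ltr_wpDl.
have [g1 [[L1 L10 lg1] mg1 Hg1]] := H1 _ e2.
have [g2 [[L2 L20 lg2] mg2 Hg2]] := H2 _ e2.
exists (fun z => op (g1 z) (g2 z)); split; last 2 first.
- exact: (mop _ _ mg1 mg2).
- have mB (f g : X -> R) : measurable_fun setT f -> measurable_fun setT g ->
      measurable_fun N (EFin \o (fun z => `|f z - g z| `^ p)).
    move=> mf mg; apply/measurable_EFinP/measurable_funTS.
    by apply: measurable_powR_norm; exact: measurable_funB.
  apply: (@le_lt_trans _ _ (\int[Leb R n]_(z in N)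
    (D%:E * ((`|f1 z - g1 z| `^ p)%:E + (`|f2 z - g2 z| `^ p)%:E)))%E).
    apply: ge0_le_integral => //.
    + by apply: mB; [exact: (mop _ _ mf1 mf2)|exact: (mop _ _ mg1 mg2)].
    + by apply: measurable_funeM; apply: emeasurable_funD; exact: mB.
    + by move=> z _; rewrite -EFinD -EFinM lee_fin powR_leD.
  rewrite ge0_integralZl//; last 2 first.
  + by apply: emeasurable_funD; exact: mB.
  + by move=> z _; rewrite -EFinD lee_fin addr_ge0 ?powR_ge0.
  rewrite ge0_integralD//; [|exact: mB..].
  apply: (@le_lt_trans _ _ (D%:E * ((e / 2 / (D + 1))%:E + (e / 2 / (D + 1))%:E))%E).
    have hD : (0 <= D%:E)%E by rewrite lee_fin.
    exact: (lee_wpmul2l hD (leeD (ltW Hg1) (ltW Hg2))).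
  rewrite -EFinD -EFinM lte_fin -mulrDl -splitr mulrCA -[X in _ < X]mulr1 ltr_pM2l//.
  by rewrite ltr_pdivrMr ?ltr_wpDl// mul1r ltrDl.
exists (C * (L1 + L2)); first by rewrite mulr_ge0 ?addr_ge0.
move=> r z h hr; rewrite (le_trans (opC _ _ _ _))// -mulrA mulrDl ler_wpM2l//.
by rewrite lerD ?lg1 ?lg2.
Qed.

Lemma box_lipschitz_approx (g : V -> R) : box_lipschitz g ->
  measurable_fun setT (g : X -> R) -> lips_approx g.
Proof.
move=> lg mg; split => // e e0; exists g; split => //.
under eq_integral do rewrite subrr normr0 powR0 ?gt_eqF//.
by rewrite integral0.
Qed.

(** Dominated convergence makes some [f_ k] close to [f] in L^p, and a Lipschitz approximation of
    that [f_ k] serves for [f]. *)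
Lemma lips_approx_lim (f_ : nat -> X -> R) (f G : X -> R) :
  (forall k, lips_approx (f_ k)) -> measurable_fun setT f ->
  (forall z, N z -> f_ k z @[k --> \oo] --> f z) ->
  (forall k z, N z -> `|f z - f_ k z| `^ p <= G z) ->
  (Leb R n).-integrable N (EFin \o G) ->
  lips_approx f.
Proof.
move=> Hf mf f_f f_G iG; split => // e e0.
pose g_ k (z : X) := (`|f z - f_ k z| `^ p)%:E.
have mg k : measurable_fun N (g_ k).
  apply/measurable_EFinP/measurable_funTS.
  by apply: measurable_powR_norm; apply: measurable_funB => //; case: (Hf k).
have pw z : N z -> g_ ^~ z @ \oo --> 0%E.
  move=> Nz; apply/fine_cvgP; split; first exact: nearW.
  apply/cvgrPdist_lt => r r0.
  have r1 : 0 < r `^ p^-1 by rewrite powR_gt0.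
  have /cvgrPdist_lt/(_ _ r1) := f_f z Nz.
  apply: filterS => k hk; rewrite /g_/= sub0r normrN ger0_norm ?powR_ge0//.
  have := gt0_ltr_powR p0 _ _ hk; rewrite !nnegrE normr_ge0 powR_ge0 => /(_ isT isT).
  by rewrite -powRrM mulVf ?gt_eqF// powRr1// ltW.
have gG k z : N z -> (`|g_ k z| <= (EFin \o G) z)%E.
  by move=> Nz; rewrite /g_/= lee_fin ger0_norm ?powR_ge0// f_G.
have cv := @dominated_cvg _ _ _ (Leb R n) N mN g_ (cst 0%E) (EFin \o G) mg pw
  (fun z _ => isT) iG gG.
have {cv} [k hk] : exists k, (\int[Leb R n]_(z in N) g_ k z < (e / 2 / (2 `^ p + 1))%:E)%E.
  rewrite integral0 in cv.
  have d0 : 0 < e / 2 / (2 `^ p + 1) by rewrite !divr_gt0// ltr_wpDl// powR_ge0.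
  have /fine_cvgP[[n1 _ fin1]] := cv.
  move=> /cvgrPdist_lt/(_ _ d0)[n2 _ h2]; exists (maxn n1 n2).
  have := h2 (maxn n1 n2) (leq_maxr _ _); rewrite /= sub0r normrN.
  have := fin1 (maxn n1 n2) (leq_maxl _ _) => /fineK => <- /=.
  by move=> h; rewrite lte_fin (le_lt_trans (ler_norm _)).
have [mfk /(_ (e / 2 / (2 `^ p + 1)))[|g [lg mgg Hg]]] := Hf k.
  by rewrite !divr_gt0// ltr_wpDl// powR_ge0.
exists g; split => //.
have mB (f1 f2 : X -> R) : measurable_fun setT f1 -> measurable_fun setT f2 ->
    measurable_fun N (EFin \o (fun z => `|f1 z - f2 z| `^ p)).
  move=> m1 m2; apply/measurable_EFinP/measurable_funTS.
  by apply: measurable_powR_norm; exact: measurable_funB.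
apply: (@le_lt_trans _ _ (\int[Leb R n]_(z in N)
    ((2 `^ p)%:E * (g_ k z + (`|f_ k z - g z| `^ p)%:E)))%E).
  apply: ge0_le_integral => //.
  + exact: mB.
  + by apply: measurable_funeM; apply: emeasurable_funD; exact: mB.
  + move=> z _; rewrite -EFinD -EFinM lee_fin -[X in X `^ p * _]mulr1.
    by rewrite powR_leD// mul1r ler_distD.
rewrite ge0_integralZl ?lee_fin ?powR_ge0//; last 2 first.
+ by apply: emeasurable_funD; exact: mB.
+ by move=> z _; rewrite -EFinD lee_fin addr_ge0 ?powR_ge0.
rewrite ge0_integralD//; last 2 first.
+ by move=> z _; rewrite lee_fin powR_ge0.
+ exact: mB.
apply: (@le_lt_trans _ _ ((2 `^ p)%:E * ((e / 2 / (2 `^ p + 1))%:E + (e / 2 / (2 `^ p + 1))%:E))%E).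
  have hD : (0 <= (2 `^ p)%:E)%E by rewrite lee_fin powR_ge0.
  exact: (lee_wpmul2l hD (leeD (ltW hk) (ltW Hg))).
rewrite -EFinD -EFinM lte_fin -mulrDl -splitr mulrCA -[X in _ < X]mulr1 ltr_pM2l//.
by rewrite ltr_pdivrMr ?ltr_wpDl ?powR_ge0// mul1r ltrDl.
Qed.

Lemma integrable_cst_N (k : R) : (Leb R n).-integrable N (EFin \o cst k).
Proof.
apply: measurable_bounded_integrable => //; first exact: Leb_cbox_lty.
exact: (@bounded_cst _ R^o).
Qed.

Definition lips_set (A : set X) := measurable A /\ lips_approx (\1_A : X -> R).

Lemma lips_setC A : lips_set A -> lips_set (~` A).
Proof.
move=> [mA HA]; split; first exact: measurableC.
rewrite (_ : \1_(~` A) = fun z => 1 - \1_A z); last first.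
  apply/funext => z; rewrite !indicE in_setC.
  by case: (z \in A); rewrite /= ?subrr ?subr0.
apply: (@lips_approx_op2 (fun x _ => 1 - x) 1 _ _ ler01 _ _ HA HA).
- move=> x y x' y'; rewrite mul1r (_ : 1 - x - (1 - x') = x' - x); last by ring.
  by rewrite distrC lerDl.
- by move=> h1 h2 m1 m2; apply: measurable_funB => //; exact: measurable_cst.
Qed.

Lemma lips_setU A B : lips_set A -> lips_set B -> lips_set (A `|` B).
Proof.
move=> [mA HA] [mB HB]; split; first exact: measurableU.
rewrite (_ : \1_(A `|` B) = fun z => Num.max (\1_A z) (\1_B z : R)); last first.
  apply/funext => z; rewrite !indicE in_setU.
  by case: (z \in A); case: (z \in B); rewrite /= /Num.max ?ltxx ?ltr01// ltNge ler01.
apply: (@lips_approx_op2 Num.max 1 _ _ ler01 _ _ HA HB); last first.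
  by move=> *; exact: measurable_maxr.
move=> x y x' y'; rewrite mul1r ler_norml.
have := ler_norm (x - x'); have := ler_norm (y - y').
have := ler_norm (x' - x); have := ler_norm (y' - y).
rewrite (distrC x' x) (distrC y' y) => h1 h2 h3 h4.
have := normr_ge0 (x - x'); have := normr_ge0 (y - y') => k1 k2.
by case: (leP x y) => a1; case: (leP x' y') => a2; apply/andP; split; lra.
Qed.

Lemma lips_set0 : lips_set set0.
Proof.
split => //; rewrite indic0; apply: (@box_lipschitz_approx (cst 0)).
  by exists 0 => // r z h _; rewrite subrr normr0 mul0r.
exact: measurable_cst.
Qed.

(** The indicators of the finite unions converge pointwise, and the constant 1 dominates on a box of
    finite measure. *)
Lemma lips_set_bigcup (F : (set X)^nat) : (forall k, lips_set (F k)) ->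
  lips_set (\bigcup_k F k).
Proof.
move=> HF; have mF k : measurable (F k) by have [] := HF k.
have mU : measurable (\bigcup_k F k) by exact: bigcupT_measurable.
split => //.
have HB k : lips_set (\big[setU/set0]_(i < k) F i).
  elim: k => [|k IH]; first by rewrite big_ord0; exact: lips_set0.
  by rewrite big_ord_recr /=; exact: (lips_setU IH (HF k)).
apply: (@lips_approx_lim (fun k => \1_(\big[setU/set0]_(i < k) F i)) _ (cst 1)).
- by move=> k; have [] := HB k.
- exact: measurable_indic.
- move=> z _; have [[k _ Fkz]|nz] := pselect ((\bigcup_k F k) z); last first.
    rewrite (_ : (fun k => _) = cst (\1_(\bigcup_k F k) z : R)); first exact: cvg_cst.
    apply/funext => k; rewrite !indicE !memNset//.
    by move=> /mem_set; rewrite -bigcup_mkord inE => -[i _ Fi]; apply: nz; exists i.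
  apply: cvg_near_cst; exists k.+1 => // m /= km.
  rewrite !indicE !mem_set//; first by exists k.
  by rewrite -bigcup_mkord; exists k.
- move=> k z _ /=; rewrite !indicE; apply: (@le_trans _ _ (1 `^ p)); last by rewrite powR1.
  apply: ge0_ler_powR; rewrite ?nnegrE ?(ltW p0)//.
  by do 2 case: (z \in _); rewrite /= ?subrr ?subr0 ?sub0r ?normrN ?normr1 ?normr0.
- exact: integrable_cst_N.
Qed.

(** The indicator is the pointwise limit of the ramps min (1, max (0, k (l - t))), Lipschitz with
    constant k because [l] has constant 1. *)
Lemma lips_set_halfspace (l : V -> R) (t : R) : continuous l ->
  (forall (r : R) z h, cbox 0 r r h -> `|l (h + z) - l z| <= r) ->
  lips_set [set z | t < l (z : V)].
Proof.
move=> cl ll; have ml := continuous_measurable_spacetime cl.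
have mA : measurable [set z : X | t < l z].
  have := ml measurableT _ (measurable_itv `]t, +oo[).
  rewrite setTI (_ : _ @^-1` _ = [set z : X | t < l z])//.
  by apply/seteqP; split => z /=; rewrite in_itv/= andbT.
split => //.
pose g k (z : V) : R := Num.min 1 (Num.max 0 (k%:R * (l z - t))).
have g01 k z : 0 <= g k z <= 1.
  by rewrite /g le_min ler01 le_max lexx/= ge_min lexx.
apply: (@lips_approx_lim (fun k => g k) _ (cst 1)).
- move=> k; apply: box_lipschitz_approx.
    exists k%:R => // r z h /ll hr.
    have : `|k%:R * (l (h + z) - t) - k%:R * (l z - t)| <= k%:R * r.
      rewrite -mulrBr normrM ger0_norm// ler_wpM2l//.
      by rewrite (_ : l (h + z) - t - (l z - t) = l (h + z) - l z)//; ring.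
    apply: le_trans; rewrite /g; set x := k%:R * _; set y := k%:R * _.
    have := ler_norm (x - y); have := ler_norm (y - x); rewrite (distrC y x).
    have := normr_ge0 (x - y) => k1 k2 k3.
    by rewrite ler_norml /Num.min /Num.max; do !case: ifPn; rewrite -?leNgt; move=> *; apply/andP; split; lra.
  apply: measurable_minr; first exact: measurable_cst.
  apply: measurable_maxr; first exact: measurable_cst.
  by apply: measurable_funM; [exact: measurable_cst|apply: measurable_funB => //; exact: measurable_cst].
- exact: measurable_indic.
- move=> z _; have [tz|zt] := ltP t (l z); last first.
    rewrite (_ : (fun k => _) = cst (\1_[set z | t < l (z : V)] z : R)); first exact: cvg_cst.
    apply/funext => k; rewrite indicE memNset /=; last by apply/negP; rewrite -leNgt.
    rewrite /g (max_idPl _) ?(min_idPr _)//.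
    by rewrite mulr_ge0_le0// subr_le0.
  apply: cvg_near_cst.
  have d0 : 0 < l z - t by rewrite subr_gt0.
  exists (Num.trunc (l z - t)^-1).+1 => // m /= km.
  rewrite indicE mem_set//= /g (min_idPl _)//.
  rewrite le_max -ler_pdivrMr// mul1r; apply/orP; right.
  by rewrite (le_trans (ltW (truncnS_gt _)))// ler_nat.
- move=> k z _ /=; apply: (@le_trans _ _ (1 `^ p)); last by rewrite powR1.
  apply: ge0_ler_powR; rewrite ?nnegrE ?(ltW p0)//.
  have /andP[g0 g1] := g01 k z.
  by rewrite indicE ler_norml; case: (z \in _) => /=; apply/andP; split; lra.
- exact: integrable_cst_N.
Qed.

End lipschitz_density.

Import HBNNSimple.

Section lipschitz_density_Lp.
Context (R : realType) (n : nat).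
Local Notation V := ('rV[R]_n * R)%type.
Local Notation X := ('rV[R]_n * measurableTypeR R)%type.
Variables (p : R) (p0 : 0 < p) (c : V) (a b : R) (a0 : 0 <= a) (b0 : 0 <= b).
Let N : set X := cbox c a b.
Let mN : measurable N. Proof. exact: cbox_measurable. Qed.
#[local] Hint Resolve mN : core.

(* The coordinate maps, hence the identity, are measurable for the
   sigma-algebra of the sets whose indicator can be approximated. *)
Lemma measurable_lips_set (A : set X) : measurable A -> lips_set p c a b A.
Proof.
pose D : set (set X) := lips_set p c a b.
have sD : sigma_algebra setT D.
  split.
  - exact: lips_set0.
  - by move=> B DB; rewrite setTD; exact: lips_setC.
  - exact: lips_set_bigcup.
have DE : <<s D >> = D by exact: sigma_algebra_id.
pose T := g_sigma_algebraType D.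
have mhalf (l : V -> R) : continuous l ->
    (forall (r : R) z h, cbox 0 r r h -> `|l (h + z) - l z| <= r) ->
    measurable_fun [set: T] (l : T -> measurableTypeR R).
  move=> cl ll.
  apply: (measurability _ (measurable_realfun.RGenOInfty.measurableE R)) => _ [_ [x ->] <-].
  rewrite setTI; apply: sub_sigma_algebra.
  rewrite (_ : _ @^-1` _ = [set z : X | x < l z]); first exact: lips_set_halfspace.
  by apply/seteqP; split => z /=; rewrite in_itv/= andbT.
have mid : measurable_fun [set: T] (fun z : T => (z : X)).
  rewrite (_ : (fun _ => _) = fun z : T => (((z : X).1, (z : X).2) : X)); last first.
    by apply/funext => -[].
  apply: measurable_fun_pair.
    apply: measurable_fun_rVP => i.
    apply: (mhalf (fun z : V => z.1 ord0 i)) => //.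
      exact: continuous_space_coord.
    by move=> r z h [h1 _]; rewrite mxE addrK; have := h1 i; rewrite mxE subr0.
  apply: (mhalf (fun z : V => z.2)) => //; first exact: continuous_time_coord.
  by move=> r z h [_ h2]; rewrite addrK; move: h2; rewrite subr0.
move=> mA; have := mid measurableT A mA; rewrite setTI.
by change (<<s D >> A -> D A); rewrite DE.
Qed.

Lemma lips_approx_sum (I : Type) (s : seq I) (k : I -> R) (A : I -> set X) :
  (forall i, measurable (A i)) ->
  lips_approx p c a b (fun z => \sum_(i <- s) (k i * \1_(A i) z)).
Proof.
move=> mA; elim: s => [|i s IH].
  rewrite (_ : (fun _ : X => _) = \1_set0); last first.
    by apply/funext => z; rewrite big_nil indic0.
  by have [_] := @lips_set0 R n p p0 c a b.
rewrite (_ : (fun _ : X => _) =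
  fun z => k i * \1_(A i) z + \sum_(j <- s) (k j * \1_(A j) z)); last first.
  by apply/funext => z; rewrite big_cons.
have [_ HA] := measurable_lips_set (mA i).
apply: (@lips_approx_op2 R n p p0 c a b (fun x y => k i * x + y) (`|k i| + 1) _ _ _ _ _ HA IH).
- by rewrite addr_ge0.
- move=> x y x' y'.
  rewrite (_ : _ - _ = k i * (x - x') + (y - y')); last by ring.
  rewrite (le_trans (ler_normD _ _))// normrM mulrDl mul1r mulrDr.
  have := mulr_ge0 (normr_ge0 (k i)) (normr_ge0 (y - y')).
  have := normr_ge0 (x - x'); lra.
- move=> h1 h2 m1 m2; apply: measurable_funD => //.
  by apply: measurable_funM => //; exact: measurable_cst.
Qed.

Lemma lips_approx_ge0 (f : X -> R) : measurable_fun setT f -> (forall z, 0 <= f z) ->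
  (Leb R n).-integrable N (EFin \o (fun z => f z `^ p)) ->
  lips_approx p c a b f.
Proof.
move=> mf f0 fi.
have mfE : measurable_fun setT (EFin \o f) by exact/measurable_EFinP.
pose s := nnsfun_approx measurableT mfE.
have sle k z : s k z <= f z.
  rewrite -lee_fin /s nnsfun_approxE; apply: le_approx => // y _ /=.
  by rewrite lee_fin.
apply: (@lips_approx_lim R n p p0 c a b (fun k => s k) f (fun z => f z `^ p)) => //.
- move=> k; have E := funext (fimfunEord (s k)).
  by apply: (eq_ind_r (lips_approx p c a b) _ E); exact: lips_approx_sum.
- move=> z Nz.
  have f0' (y : X) : setT y -> (0 <= (EFin \o f) y)%E by move=> _ /=; rewrite lee_fin.
  have := @cvg_nnsfun_approx _ _ _ setT measurableT _ mfE f0' z I.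
  exact: fine_cvg.
- move=> k z Nz; apply: ge0_ler_powR; rewrite ?nnegrE ?(ltW p0)//.
  by rewrite ger0_norm ?subr_ge0// lerBlDr lerDl; exact: fun_ge0.
Qed.

(** Positive and negative parts reduce to a non-negative function, which simple functions approach
    from below with its p-th power as integrable majorant. *)
Lemma lips_approx_Lp (f : X -> R) : measurable_fun setT f ->
  (Leb R n).-integrable N (EFin \o (fun z => `|f z| `^ p)) ->
  lips_approx p c a b f.
Proof.
move=> mf fi.
have H (g : X -> R) : measurable_fun setT g -> (forall z, 0 <= g z <= `|f z|) ->
    lips_approx p c a b g.
  move=> mg gf; apply: lips_approx_ge0 => // [z|]; first by have /andP[] := gf z.
  apply: (le_integrable _ _ _ fi) => //.
    apply/measurable_EFinP/measurable_funTS; exact: (measurableT_comp (measurable_powR p)).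
  move=> z _ /=; rewrite lee_fin [leLHS]ger0_norm ?powR_ge0// [leRHS]ger0_norm ?powR_ge0//.
  have /andP[g0 g1] := gf z.
  by apply: ge0_ler_powR; rewrite ?nnegrE ?(ltW p0).
have -> : f = fun z => Num.max (f z) 0 - Num.max (- f z) 0.
  apply/funext => z; rewrite /Num.max.
  by do 2 (case: ifPn); rewrite -?leNgt => h1 h2; lra.
apply: (@lips_approx_op2 R n p p0 c a b (fun x y => x - y) 1).
- exact: ler01.
- move=> x y x' y'; rewrite mul1r (_ : _ - _ = (x - x') - (y - y')); last by ring.
  exact: ler_normB.
- by move=> *; exact: measurable_funB.
- apply: H => [|z].
    by apply: measurable_maxr => //; exact: measurable_cst.
  by case: (leP (f z) 0) => h; rewrite ?lexx ?normr_ge0// (ltW h) ler_norm.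
- apply: H => [|z].
    by apply: measurable_maxr; [exact: measurableT_comp|exact: measurable_cst].
  by case: (leP (- f z) 0) => h; rewrite ?lexx ?normr_ge0// (ltW h) -normrN ler_norm.
Qed.

End lipschitz_density_Lp.

(** * The logarithmic Caccioppoli estimate *)

Section pointwise_inequalities.
Context (R : realType) (n : nat) (p : R) (p2 : 2 < p).
Implicit Types (a b : 'rV[R]_n).

Let p0 : 0 < p. Proof. exact: lt_trans p2. Qed.
Let p1 : 0 < p - 1. Proof. by move: p2 => h; lra. Qed.

Lemma dotv_ge0 a : 0 <= dotv a a.
Proof. by apply: sumr_ge0 => i _; rewrite -expr2 sqr_ge0. Qed.

Lemma enorm_ge0 a : 0 <= enorm a.
Proof. exact: sqrtr_ge0. Qed.

Lemma enorm_sqr a : enorm a ^+ 2 = dotv a a.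
Proof. by rewrite sqr_sqrtr// dotv_ge0. Qed.

Lemma coord_le_enorm a i : `|a ord0 i| <= enorm a.
Proof.
rewrite -(ler_pXn2r (n := 2))// ?nnegrE ?enorm_ge0// enorm_sqr real_normK ?num_real//.
by rewrite /dotv (bigD1 i)//= -expr2 lerDl sumr_ge0// => j _; rewrite -expr2 sqr_ge0.
Qed.

Lemma enorm_le_sum a : enorm a <= \sum_i `|a ord0 i|.
Proof.
have S0 : 0 <= \sum_i `|a ord0 i| by exact: sumr_ge0.
rewrite -(ler_pXn2r (n := 2))// ?nnegrE ?enorm_ge0// enorm_sqr expr2 mulr_suml.
apply: ler_sum => i _; rewrite (le_trans (ler_norm _))// normrM ler_wpM2l//.
by rewrite (bigD1 i)//= lerDl sumr_ge0.
Qed.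

Lemma powR_pred (x : R) : 0 <= x -> x `^ (p - 1) * x = x `^ p.
Proof. by move=> x0; rewrite mulrC mulr_powRB1. Qed.

Lemma powR_pred2 (x : R) : 0 <= x -> x `^ (p - 2) * x = x `^ (p - 1).
Proof.
move=> x0; rewrite mulrC (_ : p - 2 = p - 1 - 1); last by (move: p2 => ?; lra).
by rewrite mulr_powRB1//; (move: p2 => ?; lra).
Qed.

(** Either g <= l, or (g / l)^(p - 1) >= 1 and the second term alone is at least g. The free
    parameter [l] later balances volume against energy. *)
Lemma le_add_powR (l g : R) : 0 < l -> 0 <= g -> g <= l + l `^ (1 - p) * g `^ p.
Proof.
move=> l0 g0; have [gl|lg] := leP g l; first by rewrite (le_trans gl)// lerDl mulr_ge0 ?powR_ge0.
rewrite (_ : 1 - p = - (p - 1)); last by (move: p2 => ?; lra).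
rewrite powRN -powR_pred// mulrA (le_trans _ (lerD (ltW l0) (lexx _)))// add0r.
rewrite ler_peMl// mulrC ler_pdivlMr ?powR_gt0// mul1r.
by apply: ge0_ler_powR; rewrite ?nnegrE ?(ltW l0) ?(ltW lg)//; (move: p2 => ?; lra).
Qed.

(** Young's inequality, by comparing [b] with [t * g * x]. When [b] is larger, x^(m - 1) <= x^(p -
    1) is needed, which is why the cut-off is raised to a power m >= p. *)
Lemma young_cutoff (g b t x : R) (m : nat) : 0 <= g -> 0 <= b -> 0 < t ->
  0 <= x <= 1 -> p <= m%:R ->
  g `^ (p - 1) * x ^+ m.-1 * b <= t * (g `^ p * x ^+ m) + t `^ (1 - p) * b `^ p.
Proof.
move=> g0 b0 t0 /andP[x0 x1] pm.
have m0 : (0 < m)%N by rewrite lt0n; apply: contraTneq pm => ->; rewrite -ltNge.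
have [h|h] := leP b (t * g * x).
  apply: (@le_trans _ _ (g `^ (p - 1) * x ^+ m.-1 * (t * g * x))).
    by rewrite ler_wpM2l// mulr_ge0 ?powR_ge0// exprn_ge0.
  rewrite -powR_pred// -[in leRHS](prednK m0) exprS.
  rewrite [leLHS](_ : _ = t * (g `^ (p - 1) * g * (x * x ^+ m.-1))); last by ring.
  by rewrite lerDl mulr_ge0 ?powR_ge0.
have b1 : 0 < b by apply: le_lt_trans h; rewrite !mulr_ge0// ltW.
have hx : x ^+ m.-1 <= x `^ (p - 1).
  have [->|xn0] := eqVneq x 0.
    rewrite expr0n (_ : m.-1 == 0%N = false) ?powR_ge0//.
    apply/negP => /eqP m1; have : (m%:R : R) <= 1 by rewrite -(prednK m0) m1.
    by move: p2 => h1 h2; lra.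
  rewrite -powR_mulrn//; apply: ger_powR.
    by rewrite lt0r xn0 x0.
  by rewrite -subn1 natrB//; (move: p2 => ?; lra).
apply: (@le_trans _ _ (g `^ (p - 1) * x `^ (p - 1) * b)).
  by rewrite ler_wpM2r// ler_wpM2l// powR_ge0.
rewrite -powRM//; apply: (@le_trans _ _ ((b / t) `^ (p - 1) * b)).
  rewrite ler_wpM2r//; apply: ge0_ler_powR; rewrite ?nnegrE ?mulr_ge0 ?invr_ge0 ?(ltW t0)//; first by (move: p2 => ?; lra).
  by rewrite ler_pdivlMr// mulrC mulrA ltW.
rewrite powRM ?invr_ge0 ?(ltW t0)// mulrAC powR_pred// mulrC.
rewrite -(powR_inv1 (ltW t0)) -powRrM mulN1r opprB.
by rewrite lerDr !mulr_ge0 ?powR_ge0 ?exprn_ge0// ltW.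
Qed.

Lemma p_flux_coord a i : `|p_flux p a ord0 i| <= enorm a `^ (p - 1).
Proof.
rewrite mxE normrM ger0_norm ?powR_ge0// -powR_pred2 ?enorm_ge0//.
by rewrite ler_wpM2l ?powR_ge0// coord_le_enorm.
Qed.

Lemma dotv_p_flux a : dotv (p_flux p a) a = enorm a `^ p.
Proof.
rewrite -powR_pred ?enorm_ge0// -powR_pred2 ?enorm_ge0// -mulrA -expr2 enorm_sqr.
by rewrite /dotv mulr_sumr; apply: eq_bigr => i _; rewrite mxE mulrA.
Qed.

(** Writing b = a + (b - a), the error is at most |a|^(p - 1) D. It is absorbed by half of |a|^p if
    D <= |a| / 2, and bounded by a multiple of D^p otherwise. *)
Lemma dotv_p_flux_ge a b :
  2^-1 * enorm a `^ p - 2 `^ (p - 1) * (\sum_i `|b ord0 i - a ord0 i|) `^ p <=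
  dotv (p_flux p a) b.
Proof.
set D := \sum_i _; have D0 : 0 <= D by exact: sumr_ge0.
have a0 := enorm_ge0 a.
have -> : dotv (p_flux p a) b = enorm a `^ p + \sum_i p_flux p a ord0 i * (b ord0 i - a ord0 i).
  rewrite -dotv_p_flux /dotv -big_split /=; apply: eq_bigr => i _.
  by rewrite -mulrDr addrC subrK.
have H : `|\sum_i p_flux p a ord0 i * (b ord0 i - a ord0 i)| <= enorm a `^ (p - 1) * D.
  rewrite (le_trans (ler_norm_sum _ _ _))// /D mulr_sumr; apply: ler_sum => i _.
  by rewrite normrM ler_wpM2r// p_flux_coord.
have {}H : - (enorm a `^ (p - 1) * D) <= \sum_i p_flux p a ord0 i * (b ord0 i - a ord0 i).
  by move: H; rewrite ler_norml => /andP[].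
suff : enorm a `^ (p - 1) * D <= 2^-1 * enorm a `^ p + 2 `^ (p - 1) * D `^ p by (move: p2 => ?; lra).
have [h|h] := leP D (2^-1 * enorm a).
  apply: (@le_trans _ _ (enorm a `^ (p - 1) * (2^-1 * enorm a))).
    by rewrite ler_wpM2l// powR_ge0.
  by rewrite mulrCA powR_pred// lerDl mulr_ge0 ?powR_ge0.
apply: (@le_trans _ _ ((2 * D) `^ (p - 1) * D)).
  rewrite ler_wpM2r//; apply: ge0_ler_powR; rewrite ?nnegrE ?mulr_ge0//; (move: p2 => ?; lra).
by rewrite powRM// -mulrA powR_pred// lerDr mulr_ge0 ?powR_ge0.
Qed.

Lemma powR_sum_le (x : 'I_n -> R) : (forall i, 0 <= x i) ->
  (\sum_i x i) `^ p <= n%:R `^ p * \sum_i x i `^ p.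
Proof.
move=> x0; case: (posnP n) => [n0|n0].
  have e : \sum_i x i = 0.
    by apply: big1 => i _; move: (ltn_ord i); rewrite {2}n0.
  rewrite e powR0 ?gt_eqF// mulr_ge0 ?powR_ge0// sumr_ge0// => i _; exact: powR_ge0.
pose i0 := Ordinal n0.
pose j := [arg max_(j > i0) x j]%O.
have hj i : x i <= x j by rewrite /j; case: arg_maxP => //= k _; apply.
have : \sum_i x i <= n%:R * x j.
  rewrite (le_trans (ler_sum _ (fun i _ => hj i)))// sumr_const card_ord.
  by rewrite mulr_natl.
move=> /(ge0_ler_powR (ltW p0)); rewrite !nnegrE sumr_ge0// mulr_ge0// => /(_ isT isT)/le_trans; apply.
rewrite powRM// ler_wpM2l ?powR_ge0// (bigD1 j)//= lerDl sumr_ge0// => i _; exact: powR_ge0.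
Qed.

Lemma powR_add3_le (x y z : R) : 0 <= x -> 0 <= y -> 0 <= z ->
  (x + y + z) `^ p <= 3 `^ p * (x `^ p + y `^ p + z `^ p).
Proof.
move=> x0 y0 z0; pose w := Num.max x (Num.max y z).
have w0 : 0 <= w by rewrite le_max x0.
have wx : x <= w by rewrite le_max lexx.
have wy : y <= w by rewrite !le_max lexx orbT.
have wz : z <= w by rewrite !le_max lexx !orbT.
have : x + y + z <= 3 * w by (move: p2 => ?; lra).
move=> /(ge0_ler_powR (ltW p0)); rewrite !nnegrE !addr_ge0// mulr_ge0// => /(_ isT isT)/le_trans; apply.
rewrite powRM// ler_wpM2l ?powR_ge0//.
have [px py pz] : [/\ 0 <= x `^ p, 0 <= y `^ p & 0 <= z `^ p] by rewrite !powR_ge0.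
have : [|| w == x, w == y | w == z].
  by rewrite /w; case: (leP y z) => h; case: leP; rewrite eqxx ?orbT.
by case/or3P => /eqP ->; (move: p2 => ?; lra).
Qed.

End pointwise_inequalities.

(** * Averages against a mollifier *)

Section averages.
Context (R : realType) (n : nat).
Local Notation V := ('rV[R]_n * R)%type.
Local Notation X := ('rV[R]_n * measurableTypeR R)%type.
Local Notation integrable f := ((Leb R n).-integrable setT (EFin \o (f : X -> R))).
Variables (s : R) (K : V -> R) (s0 : 0 <= s) (kK : mollifier s K).
Implicit Types (z : V) (h f g : V -> R).

Definition convol_integrable h z := integrable (fun y => h y * K (z - y)).

Lemma integrable_convolI h z : integrable h -> convol_integrable h z.
Proof.
move=> hi; have [_ _ _ K0 _] := kK.
exact: convol_integrand hi (mollifier_continuous kK) K0.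
Qed.

Lemma convol_integrableD h g z : convol_integrable h z -> convol_integrable g z ->
  convol_integrable (fun y => h y + g y) z.
Proof.
move=> hi gi; rewrite /convol_integrable; under eq_fun do rewrite mulrDl.
exact: integrableRD.
Qed.

Lemma convol_integrableZ (k : R) h z : convol_integrable h z ->
  convol_integrable (fun y => k * h y) z.
Proof.
move=> hi; rewrite /convol_integrable; under eq_fun do rewrite -mulrA.
exact: integrableRZ.
Qed.

Lemma mollifier_sub_integrable z :
  integrable (fun y => K (z - y)) /\ \int[Leb R n]_y K (z - (y : V)) = 1.
Proof.
have Ki := mollifier_integrable s0 kK; have [_ _ KN _ K1] := kK.
have E : (fun y : X => K (z - (y : V))) = (K : X -> R) \o translate (- z).
  by apply/funext => y; rewrite /= /translate -KN opprB.
split; first by rewrite E; exact: integrable_translate.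
by rewrite E (Rintegral_translate (- z) Ki).
Qed.

Lemma convol_integrable_cst (k : R) z : convol_integrable (fun=> k) z.
Proof. by apply: integrableRZ; have [] := mollifier_sub_integrable z. Qed.

Lemma convol_cst (k : R) z : convol (fun=> k) K z = k.
Proof.
have [Ki K1] := mollifier_sub_integrable z.
by rewrite /convol RintegralZl// K1 mulr1.
Qed.

Lemma convolD h g z : convol_integrable h z -> convol_integrable g z ->
  convol (fun y => h y + g y) K z = convol h K z + convol g K z.
Proof.
move=> hi gi; rewrite /convol -RintegralD//.
by apply: eq_Rintegral => y _; rewrite mulrDl.
Qed.

Lemma convolZ (k : R) h z : convol_integrable h z ->
  convol (fun y => k * h y) K z = k * convol h K z.
Proof.
move=> hi; rewrite /convol -RintegralZl//.
by apply: eq_Rintegral => y _; rewrite mulrA.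
Qed.

Lemma convol_sum (I : Type) (r : seq I) (h : I -> V -> R) z :
  (forall i, convol_integrable (h i) z) ->
  convol_integrable (fun y => \sum_(i <- r) h i y) z /\
  convol (fun y => \sum_(i <- r) h i y) K z = \sum_(i <- r) convol (h i) K z.
Proof.
move=> hi; elim: r => [|i r [IH1 IH2]].
  rewrite (_ : (fun y => _) = fun=> 0); last by apply/funext => y; rewrite big_nil.
  by rewrite big_nil convol_cst; split => //; exact: convol_integrable_cst.
rewrite (_ : (fun y => _) = fun y => h i y + \sum_(j <- r) h j y); last first.
  by apply/funext => y; rewrite big_cons.
by rewrite big_cons convolD// IH2; split => //; exact: convol_integrableD.
Qed.

Lemma mollifier_sub_eq0 z y : ~ cbox z s s y -> K (z - y) = 0.
Proof.
have [_ _ KN K0 _] := kK; move=> zy; apply: K0; apply: contra_not zy.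
move=> [h1 h2]; split => [i|]; last by move: h2; rewrite subr0 distrC.
by have := h1 i; rewrite !mxE subr0 distrC.
Qed.

Lemma convol_le h g z : convol_integrable h z -> convol_integrable g z ->
  (forall y, cbox z s s y -> h y <= g y) -> convol h K z <= convol g K z.
Proof.
move=> hi gi hg; apply: le_Rintegral => // y _.
have [_ K0 _ _ _] := kK.
have [zy|/mollifier_sub_eq0 ->] := pselect (cbox z s s y); last by rewrite !mulr0.
by rewrite ler_wpM2r// hg.
Qed.

(** A product of two averages is a double average, so the hypothesis on pairs is averaged first in
    y', then in y. Almost monotonicity of the flux thus passes to the mollified flux and
    gradient. *)
Lemma convol_dotv_ge (A G : 'I_n -> V -> R) (q e : V -> R) (C k : R) z : 0 <= C ->
  (forall i, integrable (A i)) -> (forall i, integrable (G i)) ->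
  integrable q -> integrable e ->
  (forall y y', cbox z s s y -> cbox z s s y' ->
     2^-1 * q y - C * (e y + e y' + k) <= \sum_i A i y * G i y') ->
  2^-1 * convol q K z - C * (2 * convol e K z + k) <=
  \sum_i convol (A i) K z * convol (G i) K z.
Proof.
move=> C0 Ai Gi qi ei AG.
have IA i := integrable_convolI z (Ai i); have IG i := integrable_convolI z (Gi i).
have Iq := integrable_convolI z qi; have Ie := integrable_convolI z ei.
have Ic := convol_integrable_cst ^~ z.
pose ez := convol e K z.
have inner y : cbox z s s y ->
    2^-1 * q y - C * (e y + ez + k) <= \sum_i A i y * convol (G i) K z.
  move=> zy.
  have [S1 S2] := convol_sum (index_enum 'I_n) (fun i => convol_integrableZ (A i y) (IG i)).
  rewrite (eq_bigr _ (fun i _ => esym (convolZ (A i y) (IG i)))) -S2.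
  have L : convol_integrable (fun y' => (2^-1 * q y - C * (e y + k)) + - C * e y') z.
    by apply: convol_integrableD => //; exact: convol_integrableZ.
  apply: le_trans (convol_le L S1 _); last first.
    by move=> y' zy'; apply: le_trans (AG y y' zy zy'); lra.
  rewrite (convolD (Ic _) (convol_integrableZ _ Ie)) convol_cst convolZ// -/ez.
  lra.
have [S1 S2] := convol_sum (index_enum 'I_n)
  (fun i => convol_integrableZ (convol (G i) K z) (IA i)).
rewrite (_ : \sum_i _ = convol (fun y => \sum_i convol (G i) K z * A i y) K z); last first.
  by rewrite S2; apply: eq_bigr => i _; rewrite convolZ// mulrC.
have L : convol_integrable (fun y => (2^-1 * q y + - C * e y) + - C * (ez + k)) z.
  apply: convol_integrableD => //.
  by apply: convol_integrableD; exact: convol_integrableZ.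
apply: le_trans (convol_le L S1 _); last first.
  move=> y zy; rewrite (eq_bigr (fun i => A i y * convol (G i) K z)); last first.
    by move=> i _; rewrite mulrC.
  by apply: le_trans (inner y zy); lra.
rewrite convolD//; last first.
  by apply: convol_integrableD; exact: convol_integrableZ.
rewrite convolD; [|exact: convol_integrableZ..].
rewrite !convolZ// convol_cst -/ez; lra.
Qed.

(** [young_cutoff] is applied at each y with gradient [a y / t] and then averaged. Here [t] stands
    for the mollified solution plus [d] at [z], a constant for the averaging; the sum over
    coordinates produces n b. *)
Lemma convol_dot_le (A : 'I_n -> V -> R) (a : V -> R) (d : 'I_n -> R)
    (p t th x b : R) (m : nat) z : 2 < p -> 0 < t -> 0 < th -> 0 <= x <= 1 ->
  p <= m%:R -> 0 <= b ->
  (forall i, integrable (A i)) -> integrable (fun y => a y `^ p) -> (forall y, 0 <= a y) ->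
  (forall i y, cbox z s s y -> `|A i y| <= a y `^ (p - 1)) ->
  (forall i, `|d i| <= x ^+ m.-1 * b) ->
  t `^ (1 - p) * \sum_i convol (A i) K z * d i <=
  th * (x ^+ m * (t `^ (- p) * convol (fun y => a y `^ p) K z)) +
  th `^ (1 - p) * (n%:R * b) `^ p.
Proof.
move=> p2 t0 th0 x01 pm b0 Ai ai a0 Aa db.
have IA i := integrable_convolI z (Ai i); have Ia := integrable_convolI z ai.
have [S1 S2] := convol_sum (index_enum 'I_n) (fun i => convol_integrableZ (d i) (IA i)).
rewrite (eq_bigr (fun i => convol (fun y => d i * A i y) K z)); last first.
  by move=> i _; rewrite convolZ// mulrC.
rewrite -S2 -convolZ//.
have L : convol_integrable (fun y => th * (x ^+ m * t `^ (- p)) * a y `^ p +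
    th `^ (1 - p) * (n%:R * b) `^ p) z.
  by apply: convol_integrableD; [exact: convol_integrableZ|exact: convol_integrable_cst].
apply: le_trans (convol_le (convol_integrableZ (t `^ (1 - p)) S1) L _) _; last first.
  rewrite convolD; [|exact: convol_integrableZ|exact: convol_integrable_cst].
  by rewrite convolZ// convol_cst !mulrA.
move=> y zy.
have xm : 0 <= x ^+ m.-1 by move/andP : x01 => [? _]; exact: exprn_ge0.
have H1 : \sum_i d i * A i y <= a y `^ (p - 1) * x ^+ m.-1 * (n%:R * b).
  apply: (@le_trans _ _ (\sum_(i < n) (a y `^ (p - 1) * (x ^+ m.-1 * b)))); last first.
    by rewrite sumr_const card_ord -mulr_natl; lra.
  apply: ler_sum => i _; rewrite (le_trans (ler_norm _))// normrM mulrC.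
  by rewrite ler_pM// ?Aa.
have g0 : 0 <= a y / t by rewrite divr_ge0// ltW.
have nb0 : 0 <= n%:R * b by rewrite mulr_ge0.
have Y := young_cutoff p2 g0 nb0 th0 x01 pm.
have E (r : R) : (a y / t) `^ r = a y `^ r * t `^ (- r).
  by rewrite powRM// ?invr_ge0 ?(ltW t0)// -(powR_inv1 (ltW t0)) -powRrM mulN1r.
rewrite !E opprB in Y.
apply: le_trans (ler_wpM2l (powR_ge0 t (1 - p)) H1) _.
move: Y.
set T1 := t `^ (1 - p); set Xm := x ^+ m.-1; set Xn := x ^+ m; set T0 := t `^ (- p).
set a1 := a y `^ _; set ap := a y `^ _; set h1 := th `^ _; set h2 := _ `^ p.
set nb := n%:R * b => Y.
rewrite (_ : T1 * (a1 * Xm * nb) = a1 * T1 * Xm * nb); last by ring.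
by rewrite (_ : th * (Xn * T0) * ap = th * (ap * T0 * Xn)); last by ring.
Qed.

End averages.

Section continuity_of_powers.
Context (R : realType) (T : topologicalType).
Implicit Types (f : T -> R).

Lemma continuous_exprn f m : continuous f -> continuous (fun z => f z ^+ m).
Proof.
move=> cf; elim: m => [|m IH] z; first exact: cst_continuous.
under eq_fun do rewrite exprS.
by apply: cvgM; [exact: cf|exact: IH].
Qed.

Lemma continuous_powR f (k : R) : continuous f -> (forall z, 0 < f z) ->
  continuous (fun z => f z `^ k).
Proof.
move=> cf f0 z; apply: (@continuous_comp _ _ _ f (fun x : R => x `^ k)); first exact: cf.
apply/differentiable_continuous/derivable1_diffP.
by have [] := is_derive1_powR k (f0 z).
Qed.

End continuity_of_powers.

(** * Testing the mollified equation *)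

Section caccioppoli.
Context (R : realType) (n : nat).
Local Notation V := ('rV[R]_n * R)%type.
Local Notation X := ('rV[R]_n * measurableTypeR R)%type.
Local Notation integrable f := ((Leb R n).-integrable setT (EFin \o (f : X -> R))).

Lemma is_derive_powR_comp (f : V -> R) z v df (k : R) : 0 < f z ->
  is_derive z v f df -> is_derive z v (fun y => f y `^ k) (k * f z `^ (k - 1) * df).
Proof.
move=> f0 hf; apply: (is_derive_comp_line (F := fun x => x `^ k) hf).
exact: is_derive1_powR.
Qed.

Variables (p : R) (m : nat) (p2 : 2 < p) (pm : p <= m%:R).
Variables (B : R) (B0 : 0 <= B) (HB : forall (c z : V) (a b : R), 0 < a -> 0 < b ->
  (forall i, `|'D_(ebase R i) (cutoff c a b) z| <= B / a) /\
  `|'D_(etime R n) (cutoff c a b) z| <= B / b).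
Variables (c : V) (rho tau : R) (rho0 : 0 < rho) (tau0 : 0 < tau).
Variables (s : R) (K : V -> R) (s0 : 0 <= s) (kK : mollifier s K).
Variables (u : V -> R) (A G : 'I_n -> V -> R) (a e : V -> R).
Hypotheses (ui : integrable u) (u0 : forall z, 0 <= u z)
  (Ai : forall i, integrable (A i)) (Gi : forall i, integrable (G i))
  (ai : integrable (fun y => a y `^ p)) (a0 : forall y, 0 <= a y)
  (ei : integrable e) (e0 : forall y, 0 <= e y).
Let W : set V := cbox c rho tau.
Hypothesis HA : forall i y, `|A i y| <= a y `^ (p - 1).
Variables (C k : R) (C0 : 0 <= C) (k0 : 0 <= k).
(* [A] is the flux of [G].  Mollification does not commute with the flux, so
   monotonicity survives only up to the error [e] of approximating [G] by
   Lipschitz functions and their increment [k] at scale [s]. *)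
Hypothesis HAG : forall z y y', W z -> cbox z s s y -> cbox z s s y' ->
  2^-1 * a y `^ p - C * (e y + e y' + k) <= \sum_i A i y * G i y'.
Hypothesis Hdx : forall z i, W z ->
  convol u (fun y => 'D_(ebase R i) K y) z = convol (G i) K z.
Hypothesis Hdt : forall z, W z ->
  convol u (fun y => 'D_(etime R n) K y) z =
  \sum_i convol (A i) (fun y => 'D_(ebase R i) K y) z.
Variables (d : R) (d0 : 0 < d).

Let xi : V -> R := cutoff c rho tau.
Let U z : R := convol u K z + d.
Let Psi z : R := xi z ^+ m.
Let dPsi v z : R := m%:R * xi z ^+ m.-1 * 'D_v xi z.
Let dU v z : R := convol u (fun y => 'D_v K y) z.
Let As i z : R := convol (A i) K z.
Let dAs v i z : R := convol (A i) (fun y => 'D_v K y) z.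
Let CK : forall j, Ck j K. Proof. by case: kK. Qed.
Let cK : continuous K. Proof. exact: mollifier_continuous kK. Qed.
Let K0 : vanish_off (cbox 0 s s) K. Proof. by case: kK. Qed.
Let dK0 v : vanish_off (cbox 0 s s) (fun y => 'D_v K y).
Proof. exact: vanish_off_derive. Qed.
Let cdK v : continuous (fun y => 'D_v K y).
Proof. exact: (Ck_continuous (Ck_derive v (CK 1))). Qed.

Let U_ge z : d <= U z.
Proof. by rewrite /U lerDr (convol_ge0 z kK). Qed.
Let U0 z : 0 < U z. Proof. exact: lt_le_trans (U_ge z). Qed.

Let cU : continuous U.
Proof.
move=> z; apply: cvgD; last exact: cvg_cst.
exact: (continuous_convol ui cK K0).
Qed.
Let cdU v : continuous (dU v). Proof. exact: (continuous_convol ui (@cdK v) (@dK0 v)). Qed.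
Let cAs i : continuous (As i). Proof. exact: (continuous_convol (Ai i) cK K0). Qed.
Let cdAs v i : continuous (dAs v i).
Proof. exact: (continuous_convol (Ai i) (@cdK v) (@dK0 v)). Qed.
Let cxi : continuous xi. Proof. exact: (Ck_continuous (Ck_cutoff 0 _ _ _)). Qed.
Let cdxi v : continuous (fun z => 'D_v xi z).
Proof. exact: (Ck_continuous (Ck_derive v (Ck_cutoff 1 _ _ _))). Qed.
Let cPsi : continuous Psi. Proof. exact: continuous_exprn. Qed.
Let cdPsi v : continuous (dPsi v).
Proof.
move=> z; apply: cvgM; last exact: cdxi.
apply: cvgM; first exact: cvg_cst.
exact: continuous_exprn.
Qed.
Let cUp (r : R) : continuous (fun z => U z `^ r).
Proof. exact: continuous_powR. Qed.

Let is_derive_Psi z v : is_derive z v Psi (dPsi v z).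
Proof.
have := is_deriveX m (Ck_is_derive z v (Ck_cutoff 1 c rho tau)).
by rewrite exprfctE.
Qed.

Let is_derive_U z v : is_derive z v U (dU v z).
Proof.
have h := is_deriveD (is_derive_convol z v ui (CK 1) K0) (is_derive_cst d z v).
by rewrite addr0 in h.
Qed.

Let is_derive_As z v i : is_derive z v (As i) (dAs v i z).
Proof. exact: is_derive_convol (Ai i) (CK 1) K0. Qed.

Let m_gt1 : (1 < m)%N.
Proof.
rewrite -(ltr_nat R); apply: lt_le_trans pm; apply: lt_trans p2.
by rewrite ltr1n.
Qed.

Let xi01 z : 0 <= xi z <= 1. Proof. by rewrite cutoff_ge0 cutoff_le1. Qed.

Let xi_off : vanish_off W xi. Proof. exact: cutoff_eq0. Qed.

Let Psi_off : vanish_off W Psi.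
Proof. by move=> z /xi_off h; rewrite /Psi h expr0n gtn_eqF// ltnW. Qed.

Let dPsi_off v : vanish_off W (dPsi v).
Proof.
move=> z /xi_off h; rewrite /dPsi h expr0n (_ : m.-1 == 0%N = false) ?mulr0 ?mul0r//.
by case: m m_gt1 => // -[].
Qed.

(* [F] is the weight in the test function; [FF] is its primitive as a function of [U]. *)
Let FF z : R := - (U z `^ (2 - p)) / (p - 2).
Let F z : R := U z `^ (1 - p).
(** With [dHx], exact derivatives: of [Psi * FF] in time and of [Psi * F * As i] in direction i.
    Both integrate to 0, which does the work of all integrations by parts. *)
Let dHt z : R := dPsi (etime R n) z * FF z + Psi z * (F z * dU (etime R n) z).
Let dHx i z : R := (dPsi (ebase R i) z * F z -
   (p - 1) * Psi z * (U z `^ (- p) * dU (ebase R i) z)) * As i z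
   + Psi z * F z * dAs (ebase R i) i z.

Let cFF : continuous FF.
Proof.
move=> z; apply: cvgM; last exact: cvg_cst.
by apply: cvgN; exact: cUp.
Qed.

Let cdHt : continuous dHt.
Proof.
move=> z; apply: cvgD; apply: cvgM.
- exact: cdPsi.
- exact: cFF.
- exact: cPsi.
- by apply: cvgM; [exact: cUp|exact: cdU].
Qed.

Let cdHx i : continuous (dHx i).
Proof.
move=> z; apply: cvgD; apply: cvgM.
- apply: cvgB; first by apply: cvgM; [exact: cdPsi|exact: cUp].
  apply: cvgM; first by apply: cvgM; [exact: cvg_cst|exact: cPsi].
  by apply: cvgM; [exact: cUp|exact: cdU].
- exact: cAs.
- by apply: cvgM; [exact: cPsi|exact: cUp].
- exact: cdAs.
Qed.

Let is_derive_FF z v : is_derive z v FF (F z * dU v z).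
Proof.
have h := is_deriveZ (- (p - 2)^-1) (is_derive_powR_comp (2 - p) (U0 z) (is_derive_U z v)).
rewrite /FF (_ : (fun z => _) = (- (p - 2)^-1) \*: (fun y => U y `^ (2 - p))); last first.
  by apply/funext => y; rewrite /GRing.scale/= [LHS]mulNr [RHS]mulNr mulrC.
apply: (is_derive_eq h); rewrite /GRing.scale/= /F.
rewrite (_ : 2 - p - 1 = 1 - p); last by ring.
have : p - 2 != 0 by rewrite gt_eqF// subr_gt0.
by move=> pn; field.
Qed.

Let int_dHt : \int[Leb R n]_z dHt (z : V) = 0.
Proof.
apply: (@Rintegral_derive_eq0 R n c rho tau (etime R n) (fun z => Psi z * FF z)) => //.
- exact: ltW.
- exact: ltW.
- by split=> [i|]; rewrite ?mxE ?subr0 ?normr0// normr1.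
- by move=> z; apply: cvgM; [exact: cPsi|exact: cFF].
- by move=> z /Psi_off ->; rewrite mul0r.
- move=> z; have h := is_deriveM (is_derive_Psi z (etime R n)) (is_derive_FF z (etime R n)).
  apply: (is_derive_eq h); rewrite /GRing.scale/= /dHt; ring.
Qed.

Let int_dHx i : \int[Leb R n]_z dHx i (z : V) = 0.
Proof.
apply: (@Rintegral_derive_eq0 R n c rho tau (ebase R i) (fun z => Psi z * F z * As i z)) => //.
- exact: ltW.
- exact: ltW.
- split=> [j|]; last by rewrite /= subr0 normr0.
  by rewrite !mxE subr0; case: eqP; case: eqP => //= *; rewrite ?normr1 ?normr0.
- move=> z; apply: cvgM; last exact: cAs.
  by apply: cvgM; [exact: cPsi|exact: cUp].
- by move=> z /Psi_off ->; rewrite !mul0r.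
- move=> z; set v := ebase R i.
  have h := is_deriveM (is_deriveM (is_derive_Psi z v)
    (is_derive_powR_comp (1 - p) (U0 z) (is_derive_U z v))) (is_derive_As z v i).
  apply: (is_derive_eq h); rewrite /GRing.scale/= /dHx -/v /F.
  rewrite (_ : 1 - p - 1 = - p); last by ring.
  rewrite -[(Psi * _) z]/(Psi z * U z `^ (1 - p)); ring.
Qed.

Lemma powR_le_neg (x y r : R) : 0 < x -> x <= y -> 0 <= r -> y `^ (- r) <= x `^ (- r).
Proof.
move=> x0 xy r0; have y0 : 0 < y by exact: lt_le_trans xy.
rewrite !powRN lef_pV2 ?posrE ?powR_gt0//.
by apply: ge0_ler_powR => //; rewrite nnegrE ltW.
Qed.

(** Almost monotonicity leaves (p - 1) / 2 = 2 [th] in front of [Q]; Young's inequality with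
    parameter [th] costs one half of it. [k1] bounds the time term, [k2] is Young's remainder, and
    [M3] weighs the approximation error. *)
Let th : R := (p - 1) / 4.
Let M3 : R := (p - 1) * d `^ (- p) * C.
Let P z : R := convol (fun y => a y `^ p) K z.
Let Es z : R := convol e K z.
Let k1 : R := m%:R * B / tau * d `^ (2 - p) / (p - 2).
Let k2 : R := th `^ (1 - p) * (n%:R * (m%:R * B / rho)) `^ p.
Let Q z : R := Psi z * (U z `^ (- p) * P z).

Let cP : continuous P. Proof. exact: (continuous_convol ai cK K0). Qed.
Let Es_ge0 z : 0 <= Es z. Proof. exact: (convol_ge0 z kK). Qed.
Let Psi01 z : 0 <= Psi z <= 1.
Proof.
by have /andP[x0 x1] := xi01 z; rewrite exprn_ge0//= exprn_ile1.
Qed.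

(** In this combination the time derivative of [U] and the divergence of [As] cancel on [W] by the
    mollified equation [Hdt]. *)
Let T z : R := dHt z - \sum_i dHx i z.

Let T_ge z : W z -> th * Q z - k1 - k2 - M3 * (2 * Es z + k) <= T z.
Proof.
move=> Wz; have p1 : 0 < p - 1 by move: p2 => ?; lra.
have p20 : 0 < p - 2 by rewrite subr_gt0.
have th0 : 0 < th by rewrite divr_gt0.
pose S1 := \sum_i As i z * dPsi (ebase R i) z.
pose S2 := \sum_i As i z * convol (G i) K z.
pose S3 := \sum_i dAs (ebase R i) i z.
have ES : \sum_i dHx i z = F z * S1 - (p - 1) * Psi z * U z `^ (- p) * S2 + Psi z * F z * S3.
  rewrite /S1 /S2 /S3 !mulr_sumr -sumrB -big_split /=; apply: eq_bigr => i _.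
  rewrite /dHx {1}/dU (Hdx _ Wz); ring.
have h1 : 2^-1 * P z - C * (2 * Es z + k) <= S2.
  apply: (convol_dotv_ge s0 kK (q := fun y => a y `^ p)) => // y y' zy zy'.
  exact: HAG zy zy'.
have mB0 : 0 <= m%:R * B / rho by rewrite !mulr_ge0// invr_ge0 ltW.
have h2 : F z * S1 <= th * Q z + k2.
  have := @convol_dot_le R n s K s0 kK A a (fun i => dPsi (ebase R i) z) p (U z) th
    (xi z) (m%:R * B / rho) m z p2 (U0 z) th0 (xi01 z) pm mB0 Ai ai a0.
  apply; first by move=> i y _; exact: HA.
  move=> i; have /andP[x0 _] := xi01 z; rewrite /dPsi !normrM ger0_norm//.
  rewrite (ger0_norm (exprn_ge0 _ x0)) mulrAC mulrC ler_wpM2l ?exprn_ge0//.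
  rewrite -mulrA ler_wpM2l//; by have [] := HB c z rho0 tau0.
(* Since U >= d and 2 - p < 0, U^(2 - p) is at most d^(2 - p): no upper bound on the solution
   enters. *)
have h3 : - k1 <= dPsi (etime R n) z * FF z.
  have : `|dPsi (etime R n) z * FF z| <= k1.
    rewrite /k1 -mulrA normrM; apply: ler_pM => //.
      have /andP[x0 x1] := xi01 z; rewrite /dPsi !normrM ger0_norm//.
      rewrite (ger0_norm (exprn_ge0 _ x0)) -!mulrA ler_wpM2l//.
      have [_ hB] := HB c z rho0 tau0.
      by rewrite (le_trans _ hB)// ler_piMl// exprn_ile1.
    have -> : `|FF z| = U z `^ (2 - p) / (p - 2).
      by rewrite /FF mulNr normrN normrM (ger0_norm (powR_ge0 _ _)) gtr0_norm ?invr_gt0.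
    rewrite ler_wpM2r ?invr_ge0 ?(ltW p20)//.
    rewrite (_ : 2 - p = - (p - 2)); last by ring.
    exact: powR_le_neg (ltW p20).
  by rewrite ler_norml => /andP[].
have /andP[Ps0 Ps1] := Psi01 z.
have w0 : 0 <= (p - 1) * Psi z * U z `^ (- p).
  by rewrite !mulr_ge0 ?powR_ge0// ltW.
have h4 := ler_wpM2l w0 h1.
have h5 : (p - 1) * Psi z * U z `^ (- p) * (C * (2 * Es z + k)) <= M3 * (2 * Es z + k).
  rewrite mulrA ler_wpM2r ?addr_ge0 ?mulr_ge0//.
  rewrite /M3 ler_wpM2r// -!mulrA ler_wpM2l ?(ltW p1)//.
  rewrite -[leRHS]mul1r ler_pM ?powR_ge0//.
  by apply: powR_le_neg => //; move: p2 => ?; lra.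
rewrite /T ES {1}/dHt {1}/dU (Hdt Wz) -/S3.
have EQ : (p - 1) * Psi z * U z `^ (- p) * (2^-1 * P z) = 2 * (th * Q z).
  by rewrite /th /Q; field.
rewrite mulrBr EQ in h4.
rewrite (_ : Psi z * (F z * S3) = Psi z * F z * S3); last by ring.
lra.
Qed.

Let T_off : vanish_off W T.
Proof.
move=> z Wz; rewrite /T /dHt (@dPsi_off _ _ Wz) (@Psi_off _ Wz) !mul0r addr0 sub0r big1 ?oppr0//.
by move=> i _; rewrite /dHx (@dPsi_off _ _ Wz) (@Psi_off _ Wz) !(mulr0, mul0r) subr0 addr0 mul0r.
Qed.

(** [T] has integral 0 and vanishes off [W], so it remains to integrate the pointwise bound [T_ge];
    the product with the powers of [rho] and [tau] is the measure of [W]. *)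
Lemma caccioppoli_estimate :
  integrable Q /\
  th * \int[Leb R n]_z Q (z : V) <=
  (k1 + k2 + M3 * k) * ((2 * rho) ^+ n * (2 * tau)) +
  M3 * 2 * \int[Leb R n]_z e (z : V).
Proof.
have r0 := ltW rho0; have t0 := ltW tau0.
have cQ : continuous Q.
  by move=> z; apply: cvgM; [exact: cPsi|apply: cvgM; [exact: cUp|exact: cP]].
have Q_off : vanish_off W Q by move=> z /Psi_off h; rewrite /Q h mul0r.
have Qi := vanish_off_integrable r0 t0 cQ Q_off.
split => //.
have Hti : integrable dHt.
  apply: (vanish_off_integrable (c := c) r0 t0) => // z Wz.
  by rewrite /dHt (@dPsi_off _ _ Wz) (@Psi_off _ Wz) !mul0r addr0.
have Hxi i : integrable (dHx i).
  apply: (vanish_off_integrable (c := c) r0 t0) => // z Wz.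
  by rewrite /dHx (@dPsi_off _ _ Wz) (@Psi_off _ Wz) !(mulr0, mul0r) subr0 addr0 mul0r.
have [Sxi Sx0] := Rintegral_sum (index_enum 'I_n) Hxi.
rewrite big1 in Sx0; last by move=> i _; exact: int_dHx.
have Ti : integrable T by exact: integrableRB.
have T0 : \int[Leb R n]_z T (z : V) = 0.
  by rewrite RintegralB// Sx0 int_dHt subr0.
have [Ei Etot] := integrable_convol s0 kK ei e0.
have mW : measurable (W : set X) by exact: cbox_measurable.
have Wi : integrable (fun z => \1_W z).
  rewrite (_ : (fun z : V => _) = (fun=> 1 : R) \_ (W : set X)); last first.
    by apply/funext => z; rewrite patchE indicE; case: ifPn.
  rewrite -restrict_EFin; apply/(integrable_mkcond _ mW).
  apply: measurable_bounded_integrable => //; first exact: Leb_cbox_lty.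
  exact: (@bounded_cst _ R^o).
have W1 : \int[Leb R n]_z (\1_W (z : V) : R) = (2 * rho) ^+ n * (2 * tau).
  rewrite /Rintegral integral_indic// setIT.
  by rewrite [X in fine X](Leb_cbox c r0 t0).
have p1 : 0 < p - 1 by move: p2 => ?; lra.
have M30 : 0 <= M3 by rewrite !mulr_ge0 ?powR_ge0// ltW.
have k10 : 0 <= k1.
  by rewrite /k1 !mulr_ge0 ?powR_ge0 ?invr_ge0 ?(ltW tau0)// subr_ge0 ltW.
have k20 : 0 <= k2 by rewrite mulr_ge0 ?powR_ge0.
rewrite -RintegralZl//.
apply: (@le_trans _ _ (\int[Leb R n]_z
   (T (z : V) + ((k1 + k2 + M3 * k) * \1_W (z : V) + M3 * 2 * Es (z : V))))).
  apply: le_Rintegral => //.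
  - exact: integrableRZ.
  - by apply: integrableRD => //; apply: integrableRD; exact: integrableRZ.
  - move=> z _; have [Wz|Wz] := pselect (W z).
      have := T_ge Wz; rewrite indicE mem_set//= mulr1; lra.
    rewrite indicE memNset// (T_off Wz) (Q_off _ Wz) mulr0 mulr0 !add0r.
    by rewrite mulr_ge0// mulr_ge0.
have I1 : integrable (fun z => (k1 + k2 + M3 * k) * \1_W z) by exact: integrableRZ.
have I2 : integrable (fun z => M3 * 2 * Es z) by exact: integrableRZ.
rewrite RintegralD//; last exact: integrableRD.
rewrite T0 add0r RintegralD// RintegralZl// RintegralZl// W1.
by rewrite -Etot.
Qed.

End caccioppoli.

(** * The logarithmic oscillation estimate *)

Section linearity_of_derivative.
Context (R : realType) (W : normedModType R).
Implicit Types (f : W -> R) (z v w : W).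

(** [Ck] speaks of directional derivatives only, so additivity has to be proved. The increment is
    split at h v + z; on the second leg, whose base point moves with h, the mean value theorem and
    the continuity of ['D_w f] give the limit. *)
Lemma deriveDdir f z v w : Ck 1 f -> 'D_(v + w) f z = 'D_v f z + 'D_w f z.
Proof.
move=> Cf; have cDw := Ck_continuous (Ck_derive w Cf).
have Dv := Ck_is_derive z v Cf.
apply: cvg_lim => //.
pose A (h : R) := h^-1 *: (f (h *: w + (h *: v + z)) - f (h *: v + z)).
pose B (h : R) := h^-1 *: (f (h *: v + z) - f z).
rewrite (_ : (fun h => _) = fun h => B h + A h); last first.
  apply/funext => h; rewrite /A /B -scalerDr; congr (_ *: _).
  rewrite [RHS]addrC subrKA; congr (f _ - _).
  by rewrite /= scalerDr -addrA addrCA.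
apply: cvgD; first by case: Dv => + _.
apply/cvgrPdist_le => e e0.
have H : \forall y \near z, `|'D_w f z - 'D_w f y| <= e.
  by have /cvgrPdist_le/(_ _ e0) := cDw z.
have : (fun q : R * R => q.1 *: w + (q.2 *: v + z)) @ ((0 : R), (0 : R)) --> z.
  rewrite -[X in _ --> X](_ : (0 : R) *: w + ((0 : R) *: v + z) = z); last first.
    by rewrite !scale0r !add0r.
  apply: cvgD; first by apply: cvgZl; exact: cvg_fst.
  by apply: cvgD; [apply: cvgZl; exact: cvg_snd|exact: cvg_cst].
move=> /(_ _ H) [[A1 A2]/= [HA1 HA2] HA].
have /nbhs_ballP[r /= r0 hr] := HA1.
near=> h.
have hA2 : A2 h by near: h; exact: nbhs_dnbhs.
have hr' : `|h| < r by near: h; exact: dnbhs0_lt.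
have h0 : h != 0 by near: h; exact: nbhs_dnbhs_neq.
pose g (s : R) := f ((s * h) *: w + (h *: v + z)).
pose dg (s : R) := h * 'D_w f ((s * h) *: w + (h *: v + z)).
have gd (s : R) : is_derive s 1 g (dg s).
  have d1 := is_derive_at (Ck_is_derive ((s * h) *: w + (h *: v + z)) w Cf).
  have d2 : is_derive s 1 (fun x : R => x * h) h.
    apply: (is_derive_eq (is_deriveM (is_derive_id s 1) (is_derive_cst h s 1))).
    by rewrite scaler0 add0r [_ *: _]mulr1.
  have := @is_derive1_comp R (fun x => f (x *: w + (h *: v + z))) (fun x => x * h) s _ _ d1 d2.
  by rewrite mulrC.
have cg : {within `[0, 1], continuous g}.
  by apply: derivable_within_continuous => s _; have [] := gd s.
have [s s01 E] := MVT ltr01 (fun s _ => gd s) cg.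
have -> : A h = 'D_w f ((s * h) *: w + (h *: v + z)).
  rewrite subr0 mulr1 in E.
  rewrite /A; have -> : f (h *: w + (h *: v + z)) - f (h *: v + z) = dg s.
    by rewrite -E /g mul1r mul0r scale0r add0r.
  by rewrite /dg /GRing.scale/= mulKf.
apply: (HA (s * h, h)); split => //=.
apply: hr; rewrite /ball/= sub0r normrN normrM (le_lt_trans _ hr')//.
move: s01; rewrite in_itv/= => /andP[s0 s1].
by rewrite ler_piMl// gtr0_norm// ltW.
Unshelve. all: by end_near. Qed.

Lemma derive0dir f z : 'D_(0 : W) f z = 0.
Proof. exact: derive0. Qed.

End linearity_of_derivative.

Section oscillation.
Context (R : realType) (n : nat).
Local Notation V := ('rV[R]_n * R)%type.
Local Notation X := ('rV[R]_n * measurableTypeR R)%type.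
Local Notation integrable f := ((Leb R n).-integrable setT (EFin \o (f : X -> R))).

Lemma derive_space (f : V -> R) z (x : 'rV[R]_n) : Ck 1 f ->
  'D_((x, 0) : V) f z = \sum_i x ord0 i * 'D_(ebase R i) f z.
Proof.
move=> Cf.
have E : ((x, 0) : V) = \sum_(i < n) x ord0 i *: ebase R i.
  have -> : \sum_(i < n) x ord0 i *: ebase R i =
      ((\sum_i x ord0 i *: delta_mx ord0 i, \sum_(i < n) x ord0 i *: (0 : R)) : V).
    by elim/big_ind3 : _ => [//|v1 a1 b1 v2 a2 b2 -> ->|//]; exact: erefl.
  rewrite -row_sum_delta big1// => i _; exact: scaler0.
rewrite E; elim/big_ind2 : _ => [|v a w b <- <-|i _].
- exact: derive0dir.
- exact: deriveDdir.
- by have [_ ->] := is_deriveZdir (x ord0 i) (Ck_is_derive z (ebase R i) Cf).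
Qed.

Lemma Rintegral_subset_le (I : set X) f : measurable I -> integrable f ->
  (forall z, 0 <= f z) ->
  \int[Leb R n]_(z in I) f (z : V) <= \int[Leb R n]_z f (z : V).
Proof.
move=> mI fi f0; rewrite Rintegral_mkcond; apply: le_Rintegral => //.
  rewrite -restrict_EFin; apply/(integrable_mkcond _ mI).
  by apply: integrableS fi.
by move=> z _; rewrite patchE; case: ifPn.
Qed.

(* The drop of [ln (convol u K + d)] along the segments of direction [x] is the
   integral of its gradient, bounded by [g <= lam + lam^(1 - p) * g^p]. *)
Lemma oscillation_estimate (p : R) (m : nat) (c : V) (rho tau s d : R) (K u : V -> R)
    (G : 'I_n -> V -> R) (a : V -> R) (b1 : V) (r1 t1 : R) (x : 'rV[R]_n)
    (N l1 L lam : R) :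
  2 < p -> 0 < rho -> 0 < tau -> 0 <= s -> mollifier s K ->
  integrable u -> (forall z, 0 <= u z) ->
  (forall i, integrable (G i)) -> integrable (fun y => a y `^ p) ->
  (forall y, 0 <= a y) -> (forall i y, `|G i y| <= a y) ->
  (forall z i, cbox c rho tau z ->
    convol u (fun y => 'D_(ebase R i) K y) z = convol (G i) K z) ->
  0 < d -> 0 <= r1 -> 0 <= t1 -> 0 < N -> \sum_i `|x ord0 i| <= N ->
  (forall z (h : R), cbox b1 r1 t1 z -> 0 <= h <= 1 ->
    cbox c (2 / 3 * rho) (2 / 3 * tau) (h *: ((x, 0) : V) + z)) ->
  0 < l1 -> (forall z, cbox b1 r1 t1 z -> l1 <= convol u K z + d) ->
  (forall z, cbox b1 r1 t1 z -> convol u K (((x, 0) : V) + z) = 0) ->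
  L <= ln l1 - ln d -> 0 < lam ->
  integrable (fun z => cutoff c rho tau z ^+ m *
    ((convol u K z + d) `^ (- p) * convol (fun y => a y `^ p) K z)) ->
  L * ((2 * r1) ^+ n * (2 * t1)) <=
  N * (lam * ((2 * r1) ^+ n * (2 * t1)) + lam `^ (1 - p) * (cutoff_min R n ^+ m)^-1 *
    \int[Leb R n]_z (cutoff c rho tau (z : V) ^+ m *
      ((convol u K z + d) `^ (- p) * convol (fun y => a y `^ p) K z))).
Proof.
move=> p2 rho0 tau0 s0 kK ui u0 Gi ai a0 HG Hdx d0 r10 t10 N0 xN HI l10 Ul1 U2 LL lam0.
set Q := (fun z : V => _ * (_ * _)) => Qi.
set zm := cutoff_min R n ^+ m; set vol := (2 * r1) ^+ n * (2 * t1).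
have zm0 : 0 < zm by rewrite exprn_gt0// cutoff_min_gt0.
pose I : set X := cbox b1 r1 t1; pose v : V := (x, 0).
have mI : measurable I by exact: cbox_measurable.
have [CK _ _ K0 _] := kK; have cK := mollifier_continuous kK.
pose U z := convol u K z + d.
have U0 z : 0 < U z by rewrite ltr_wpDl// (convol_ge0 z kK).
pose dU z := convol u (fun y => 'D_v K y) z.
have dUP z : is_derive z v U (dU z).
  have h := is_deriveD (is_derive_convol z v ui (CK 1) K0) (is_derive_cst d z v).
  by rewrite addr0 in h.
have cU : continuous U.
  move=> z; apply: cvgD; last exact: cvg_cst.
  exact: (continuous_convol ui cK K0).
have cdU : continuous dU.
  apply: (continuous_convol ui); last exact: vanish_off_derive K0.
  exact: (Ck_continuous (Ck_derive v (CK 1))).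
pose w z := ln (U z); pose dw z := (U z)^-1 * dU z.
have dwP z : is_derive z v w (dw z).
  apply: (is_derive_comp_line (F := fun y : R => ln y) (dUP z)).
  exact: is_derive1_ln.
have cw : continuous w.
  by move=> z; apply: (@continuous_comp _ _ _ U (fun y : R => ln y)); [exact: cU|exact: continuous_ln].
have cdw : continuous dw.
  move=> z; apply: cvgM; last exact: cdU.
  by apply: cvgV; [rewrite gt_eqF|exact: cU].
pose P z := convol (fun y => a y `^ p) K z.
have P0 z : 0 <= P z by apply: (convol_ge0 z kK) => y; exact: powR_ge0.
have Q0 z : 0 <= Q z.
  by rewrite /Q !mulr_ge0 ?exprn_ge0 ?cutoff_ge0 ?powR_ge0// P0.
(* [le_add_powR] at a y / U z, multiplied by [U z] and averaged in y. *)
have Gb z i : `|convol (G i) K z| <= U z * (lam + lam `^ (1 - p) * (U z `^ (- p) * P z)).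
  have IG := integrable_convolI kK z (Gi i); have Ia := integrable_convolI kK z ai.
  have Ec : U z * (lam + lam `^ (1 - p) * (U z `^ (- p) * P z)) =
      convol (fun y => U z * lam + U z * lam `^ (1 - p) * U z `^ (- p) * a y `^ p) K z.
    rewrite (convolD (convol_integrable_cst s0 kK _ z) (convol_integrableZ _ Ia)).
    by rewrite (convol_cst s0 kK) convolZ// -/(P z); ring.
  have Ia' : convol_integrable K
      (fun y => U z * lam + U z * lam `^ (1 - p) * U z `^ (- p) * a y `^ p) z.
    by apply: convol_integrableD; [exact: (convol_integrable_cst s0 kK)|exact: convol_integrableZ].
  have pw y : a y <= U z * lam + U z * lam `^ (1 - p) * U z `^ (- p) * a y `^ p.
    have q0 : 0 <= a y / U z by rewrite divr_ge0// ltW.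
    have := le_add_powR p2 lam0 q0.
    rewrite ler_pdivrMr// powRM ?invr_ge0 ?(ltW (U0 z))//.
    rewrite -(powR_inv1 (ltW (U0 z))) -powRrM mulN1r => /le_trans; apply.
    by rewrite le_eqVlt; apply/orP; left; apply/eqP; ring.
  rewrite ler_norml Ec; apply/andP; split.
    rewrite lerNl -mulN1r -convolZ//.
    apply: (convol_le kK (convol_integrableZ _ IG) Ia') => y _.
    by rewrite mulN1r (le_trans _ (pw y))// (le_trans (ler_norm _))// normrN.
  apply: (convol_le kK IG Ia') => y _.
  by rewrite (le_trans _ (pw y))// (le_trans (ler_norm _)).
have dUE z : cbox c rho tau z -> dU z = \sum_i x ord0 i * convol (G i) K z.
  move=> Wz; rewrite /dU.
  rewrite (_ : (fun y => 'D_v K y) = fun y => \sum_i x ord0 i * 'D_(ebase R i) K y); last first.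
    by apply/funext => y; exact: derive_space.
  have cI i : convol u (fun y => 'D_(ebase R i) K y) z = convol (G i) K z by exact: Hdx.
  rewrite (eq_bigr (fun i => x ord0 i * convol u (fun y => 'D_(ebase R i) K y) z)); last first.
    by move=> i _; rewrite cI.
  have Ii i : integrable (fun y => u y * 'D_(ebase R i) K (z - y)).
    have c1 := Ck_continuous (Ck_derive (ebase R i) (CK 1)).
    exact: (convol_integrand z ui c1 (vanish_off_derive (ebase R i) K0)).
  have [_ S2] := Rintegral_sum (index_enum 'I_n) (fun i => integrableRZ (x ord0 i) (Ii i)).
  rewrite /convol; under eq_bigr do rewrite -RintegralZl//.
  rewrite -S2; apply: eq_Rintegral => y _; rewrite mulr_sumr.
  by apply: eq_bigr => i _; rewrite mulrCA.
(* On the box of ratio 2/3 the power of the cut-off is at least [zm], so the localized density [Q]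
   controls the unlocalized one up to the factor 1 / zm. *)
have dwb z : cbox c (2 / 3 * rho) (2 / 3 * tau) z ->
    `|dw z| <= N * (lam + lam `^ (1 - p) * zm^-1 * Q z).
  move=> Sz; have Wz : cbox c rho tau z by move: Sz; apply: cboxS; lra.
  have b1' : `|dw z| <= N * (lam + lam `^ (1 - p) * (U z `^ (- p) * P z)).
    rewrite /dw normrM gtr0_norm ?invr_gt0// mulrC ler_pdivrMr// dUE//.
    rewrite (le_trans (ler_norm_sum _ _ _))//.
    have cc0 : 0 <= lam + lam `^ (1 - p) * (U z `^ (- p) * P z).
      by rewrite addr_ge0 ?mulr_ge0 ?powR_ge0 ?P0// ltW.
    apply: (@le_trans _ _ ((\sum_i `|x ord0 i|) *
      (U z * (lam + lam `^ (1 - p) * (U z `^ (- p) * P z))))).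
      rewrite mulr_suml; apply: ler_sum => i _.
      by rewrite normrM ler_wpM2l.
    by rewrite mulrAC -mulrA ler_wpM2r ?mulr_ge0// ltW.
  rewrite (le_trans b1')// ler_wpM2l ?(ltW N0)// lerD2l -mulrA ler_wpM2l ?powR_ge0//.
  rewrite ler_pdivlMl// /Q -/(U z) -/(P z) ler_wpM2r ?mulr_ge0 ?powR_ge0//.
  rewrite /zm lerXn2r ?nnegrE ?cutoff_ge0 ?(ltW (cutoff_min_gt0 _ _))//.
  exact: cutoff_lb.
have volE : fine (Leb R n I) = vol by rewrite /I Leb_cbox.
(* By translation invariance the integral of [Q] over any shifted box is at most its total integral,
   uniformly in h. *)
have Qs (h : R) : integrable (fun z => Q (h *: v + z)) /\
    \int[Leb R n]_z Q (h *: v + (z : V)) = \int[Leb R n]_z Q (z : V).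
  have E : (fun z : X => Q (h *: v + (z : V))) = (Q : X -> R) \o translate (h *: v).
    by apply/funext => z; rewrite /translate /= addrC.
  rewrite E; split; first exact: integrable_translate.
  by rewrite -(Rintegral_translate (h *: v) Qi).
have sub0 : I `<=` cbox b1 r1 t1 by [].
have H := @path_integral_le R n I v w dw
  (N * (lam * vol + lam `^ (1 - p) * zm^-1 * \int[Leb R n]_z Q (z : V)))
  N b1 r1 t1 mI sub0 r10 t10 (ltW N0) _ cw cdw dwP _.
apply: le_trans (H _ _).
- have wi : (Leb R n).-integrable I (EFin \o (w : X -> R)).
    exact: (integrable_on_cbox mI sub0).
  have cwv : continuous (fun z : V => w (v + z)).
    move=> z; apply: (@continuous_comp _ _ _ (fun z : V => v + z) w); last exact: cw.
    by apply: cvgD; [exact: cvg_cst|exact: cvg_id].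
  have wvi : (Leb R n).-integrable I (EFin \o (fun z : X => w (v + (z : V)))).
    exact: (integrable_on_cbox mI sub0 r10 t10 cwv).
  rewrite -RintegralB// -volE -Rintegral_cst//.
  apply: le_Rintegral => //.
  + by apply: (integrable_on_cbox mI sub0 r10 t10) => z; exact: cst_continuous.
  + by apply: eq_integrable (integrableB mI wi wvi).
  + move=> z Iz; rewrite (le_trans LL)// lerB//.
      by rewrite /w ler_ln ?posrE// Ul1.
    by rewrite /w /U U2// add0r.
- split => [i|]; last by rewrite subr0 normr0 ltW.
  rewrite [X in _ - X]mxE subr0 (le_trans _ xN)//.
  by rewrite (bigD1 i)//= lerDl sumr_ge0.
- move=> h h01; have [Qhi Qh] := Qs h.
  have cs (f : V -> R) (hh : R) : continuous f -> continuous (fun z : V => f (hh *: v + z)).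
    move=> cf z; apply: (@continuous_comp _ _ _ (fun z : V => hh *: v + z) f); last exact: cf.
    by apply: cvgD; [exact: cvg_cst|exact: cvg_id].
  have dwi : (Leb R n).-integrable I (EFin \o (fun z : X => dw (h *: v + (z : V)))).
    exact: (integrable_on_cbox mI sub0 r10 t10 (cs _ h cdw)).
  have QI : (Leb R n).-integrable I (EFin \o (fun z : X => Q (h *: v + (z : V)))).
    by apply: integrableS Qhi.
  have cI : (Leb R n).-integrable I (EFin \o (fun _ : X => N * lam)).
    by apply: (integrable_on_cbox mI sub0 r10 t10) => z; exact: cst_continuous.
  have QI' : (Leb R n).-integrable I (EFin \o (fun z : X =>
      N * (lam `^ (1 - p) * zm^-1) * Q (h *: v + (z : V)))).
    by apply: eq_integrable (integrableZl mI _ QI).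
  apply: (@le_trans _ _ (\int[Leb R n]_(z in I)
    (N * lam + N * (lam `^ (1 - p) * zm^-1) * Q (h *: v + (z : V))))).
    apply: le_Rintegral => //.
    + exact: integrable_norm.
    + by apply: eq_integrable (integrableD mI cI QI').
    + by move=> z Iz; rewrite (le_trans (dwb _ (HI _ _ Iz h01)))// mulrDr mulrA.
  rewrite RintegralD// Rintegral_cst// [fine _]volE RintegralZl//.
  have le1 : \int[Leb R n]_(z in I) Q (h *: v + (z : V)) <= \int[Leb R n]_z Q (z : V).
    rewrite -Qh; apply: (@Rintegral_subset_le I (fun z => Q (h *: v + z)) mI Qhi).
    by move=> z; exact: Q0.
  have cc0 : 0 <= N * (lam `^ (1 - p) * zm^-1).
    by rewrite !mulr_ge0 ?powR_ge0 ?invr_ge0 ?(ltW zm0) ?(ltW N0).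
  rewrite [leRHS](_ : _ = N * lam * vol +
    N * (lam `^ (1 - p) * zm^-1) * \int[Leb R n]_z Q (z : V)); last by ring.
  by rewrite lerD2l ler_wpM2l.
Qed.

End oscillation.

(** * The mollified equation *)

Section localization.
Context (R : realType) (n : nat).
Local Notation V := ('rV[R]_n * R)%type.
Local Notation X := ('rV[R]_n * measurableTypeR R)%type.
Local Notation integrable f := ((Leb R n).-integrable setT (EFin \o (f : X -> R))).

Definition obox (x : 'rV[R]_n) (r : R) : set 'rV[R]_n :=
  [set y | forall i, `|y ord0 i - x ord0 i| < r].

Definition closed_obox (x : 'rV[R]_n) (r : R) : set 'rV[R]_n :=
  [set y | forall i, `|y ord0 i - x ord0 i| <= r].

Lemma open_obox x r : open (obox x r).
Proof.
rewrite /obox openE => y hy; rewrite /interior /=.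
apply: (@filter_forall _ _ _ _ (nbhs_filter y)) => i.
have r0 : 0 < r - `|y ord0 i - x ord0 i| by rewrite subr_gt0.
have /cvgrPdist_lt/(_ _ r0) := @coord_continuous R 1 n ord0 i y.
apply: filterS => z hz.
rewrite (le_lt_trans (ler_distD (y ord0 i) _ _))//.
by rewrite -ltrBrDr distrC.
Qed.

Lemma compact_closed_obox x r : compact (closed_obox x r).
Proof.
rewrite (_ : closed_obox x r =
    [set y | forall i, `[x ord0 i - r, x ord0 i + r]%classic (y ord0 i)]).
  exact: (@rV_compact R n (fun i => `[x ord0 i - r, x ord0 i + r]%classic)
    (fun i => @segment_compact _ _ _)).
by apply/seteqP; split => y /= h i; have := h i; rewrite /= in_itv/= ler_distl.
Qed.

Lemma closure_obox x r : closure (obox x r) `<=` closed_obox x r.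
Proof.
have cl : closed (closed_obox x r).
  exact: (compact_closed _ (@compact_closed_obox x r)).
rewrite [X in _ `<=` X](closure_id _).1//.
by apply: closureS => y h i; exact: ltW.
Qed.

Lemma compact_closure_obox x r : compact (closure (obox x r)).
Proof.
apply: (subclosed_compact _ (@compact_closed_obox x r)); last exact: closure_obox.
exact: closed_closure.
Qed.

Variables (p : R) (p2 : 2 < p) (w : V) (r tau : R) (r0 : 0 < r) (tau0 : 0 < tau).
Let O := obox w.1 r.
Let D : set X := cyl O (w.2 - tau) (w.2 + tau).

Lemma measurable_obox : measurable (obox w.1 r).
Proof. by apply: open_measurable_rV; exact: open_obox. Qed.

Lemma measurable_ocyl : measurable D.
Proof. by apply: measurableX; [exact: measurable_obox|exact: measurable_itv]. Qed.

Lemma sub_ocyl : D `<=` cbox w r tau.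
Proof.
move=> z [h1 h2]; split => [i|]; first by rewrite ltW// h1.
by move: h2 => /=; rewrite in_itv/= ler_distl => /andP[? ?]; rewrite !ltW.
Qed.

Variables (u : V -> R) (G : V -> 'rV[R]_n).
Hypothesis uG : Lp_sobolev p O (w.2 - tau) (w.2 + tau) u G.

(** Setting the data to 0 off [D] makes them integrable on all of space-time, hence fit for
    convolution. The equation is kept only at points whose kernel box lies in [D]. *)
Definition loc_u : V -> R := (u : X -> R) \_ D.
Definition loc_norm : V -> R := (fun z : X => enorm (G z)) \_ D.
Definition loc_G (i : 'I_n) : V -> R := (fun z : X => G z ord0 i) \_ D.
Definition loc_A (i : 'I_n) : V -> R := (fun z : X => p_flux p (G z) ord0 i) \_ D.

Lemma measurable_enorm : measurable_fun setT (@enorm R n).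
Proof.
have ms : measurable_fun setT (@Num.sqrt R).
  by apply: continuous_measurable_fun; exact: sqrt_continuous.
apply: (measurableT_comp ms); rewrite /dotv.
apply: measurable_sum => i; apply: measurable_funM; exact: measurable_coord_rV.
Qed.

Let mu : measurable_fun D (u : X -> R). Proof. by case: uG. Qed.
Let mG : measurable_fun D (G : X -> 'rV[R]_n). Proof. by case: uG. Qed.

Let mGi i : measurable_fun D (fun z : X => G z ord0 i).
Proof. exact: (measurableT_comp (measurable_coord_rV i) mG). Qed.

Let mN : measurable_fun D (fun z : X => enorm (G z)).
Proof. exact: (measurableT_comp measurable_enorm mG). Qed.

Let mA i : measurable_fun D (fun z : X => p_flux p (G z) ord0 i).
Proof.
under eq_fun do rewrite mxE.
apply: measurable_funM; last exact: mGi.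
exact: (measurableT_comp (measurable_powR (p - 2)) mN).
Qed.

Lemma loc_norm_ge0 z : 0 <= loc_norm z.
Proof. by rewrite /loc_norm patchE; case: ifPn => // _; exact: enorm_ge0. Qed.

Let p1 : 0 < p - 1. Proof. by move: p2 => ?; lra. Qed.
Let p0 : 0 < p. Proof. by move: p2 => ?; lra. Qed.

Lemma loc_A_le i z : `|loc_A i z| <= loc_norm z `^ (p - 1).
Proof.
rewrite /loc_A /loc_norm !patchE; case: ifPn => _; first exact: p_flux_coord.
by rewrite normr0 powR_ge0.
Qed.

Lemma loc_G_le i z : `|loc_G i z| <= loc_norm z.
Proof.
rewrite /loc_G /loc_norm !patchE; case: ifPn => _; first exact: coord_le_enorm.
by rewrite normr0.
Qed.

Lemma integrable_patchD (f : X -> R) :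
  (Leb R n).-integrable D (EFin \o f) -> integrable (f \_ D).
Proof.
by move=> fi; rewrite -restrict_EFin; apply/(integrable_mkcond _ measurable_ocyl).
Qed.

Let cst1i : (Leb R n).-integrable D (EFin \o cst (1 : R)).
Proof.
have := measurable_ocyl => mD.
have c1 : continuous (cst (1 : R) : V -> R) by move=> z; exact: cst_continuous.
exact: (integrable_on_cbox mD sub_ocyl (ltW r0) (ltW tau0) c1).
Qed.

(** On a cylinder of finite measure, integrability of the p-th power thus gives that of [u] and of
    the gradient (q = 1) and of the flux (q = p - 1). *)
Lemma le1_powR (x q : R) : 0 <= x -> 0 <= q -> q <= p -> x `^ q <= 1 + x `^ p.
Proof.
move=> x0 q0 qp; have [x1|x1] := leP x 1.
  rewrite (@le_trans _ _ 1)// ?lerDl ?powR_ge0//.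
  rewrite -[leRHS](_ : 1 `^ q = 1); last by rewrite powR1.
  by apply: ge0_ler_powR; rewrite ?nnegrE.
by rewrite (le_trans (ler_powR (ltW x1) qp))// lerDr.
Qed.

Let Di (f g : X -> R) (q : R) : measurable_fun D f -> measurable_fun D g ->
  0 <= q -> q <= p -> (forall z, 0 <= g z) ->
  (Leb R n).-integrable D (EFin \o (fun z => g z `^ p)) ->
  (forall z, D z -> `|f z| <= g z `^ q) -> (Leb R n).-integrable D (EFin \o f).
Proof.
move=> mf mg q0 qp g0 gi fg.
have H : (Leb R n).-integrable D (EFin \o (fun z => 1 + g z `^ p)).
  by apply: eq_integrable (integrableD measurable_ocyl cst1i gi); first exact: measurable_ocyl.
apply: le_integrable H; [exact: measurable_ocyl|exact/measurable_EFinP|].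
move=> z Dz /=; rewrite lee_fin (le_trans (fg z Dz))//.
by rewrite ger0_norm ?addr_ge0 ?powR_ge0// le1_powR.
Qed.

Let powi (f g : X -> R) : measurable_fun D f -> (forall z, 0 <= f z) ->
  (forall z, f z `^ p <= g z) -> measurable_fun D g ->
  (\int[Leb R n]_(z in D) (g z)%:E < +oo)%E ->
  (Leb R n).-integrable D (EFin \o (fun z => f z `^ p)).
Proof.
move=> mf f0 fg mg gi; apply/integrableP; split.
  by apply/measurable_EFinP; exact: (measurableT_comp (measurable_powR p) mf).
apply: le_lt_trans gi; apply: ge0_le_integral => //.
- exact: measurable_ocyl.
- apply: measurableT_comp => //; apply/measurable_EFinP.
  exact: (measurableT_comp (measurable_powR p) mf).
- exact/measurable_EFinP.
- by move=> z _ /=; rewrite lee_fin ger0_norm ?powR_ge0.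
Qed.

Let mUG : measurable_fun D (fun z : X => `|u z| `^ p + enorm (G z) `^ p).
Proof.
apply: measurable_funD; last exact: (measurableT_comp (measurable_powR p) mN).
by apply: (measurableT_comp (measurable_powR p)); exact: measurableT_comp.
Qed.

Let iUG : (\int[Leb R n]_(z in D) (`|u z| `^ p + enorm (G z) `^ p)%:E < +oo)%E.
Proof. by case: uG. Qed.

Let Gpi : (Leb R n).-integrable D (EFin \o (fun z : X => enorm (G z) `^ p)).
Proof.
apply: (powi mN _ _ mUG iUG) => z; first exact: enorm_ge0.
by rewrite lerDr powR_ge0.
Qed.

Let Upi : (Leb R n).-integrable D (EFin \o (fun z : X => `|u z| `^ p)).
Proof.
have mun : measurable_fun D (fun z : X => `|u z|) by exact: measurableT_comp.
apply: (powi mun _ _ mUG iUG) => z; first exact: normr_ge0.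
by rewrite lerDl powR_ge0.
Qed.

Lemma integrable_loc_u : integrable loc_u.
Proof.
apply: integrable_patchD.
have mun : measurable_fun D (fun z : X => `|u z|) by exact: measurableT_comp.
apply: (Di mu mun (q := 1) _ _ _ Upi) => // [|z _]; first by move: p2 => ?; lra.
by rewrite powRr1.
Qed.

Lemma integrable_loc_G i : integrable (loc_G i).
Proof.
apply: integrable_patchD; apply: (Di (mGi i) mN (q := 1) _ _ _ Gpi) => //.
- by move: p2 => ?; lra.
- by move=> z; exact: enorm_ge0.
- by move=> z _; rewrite powRr1 ?enorm_ge0// coord_le_enorm.
Qed.

Lemma integrable_loc_A i : integrable (loc_A i).
Proof.
apply: integrable_patchD; apply: (Di (mA i) mN (q := p - 1) _ _ _ Gpi) => //.
- exact: ltW.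
- by move: p2 => ?; lra.
- by move=> z; exact: enorm_ge0.
- by move=> z _; exact: p_flux_coord.
Qed.

Lemma integrable_loc_norm : integrable (fun z => loc_norm z `^ p).
Proof.
rewrite (_ : (fun z : V => _) = (fun z : X => enorm (G z) `^ p) \_ D).
  exact: integrable_patchD.
apply/funext => z; rewrite /loc_norm !patchE; case: ifPn => // _.
by rewrite powR0// gt_eqF.
Qed.

End localization.

Section mollified_equation.
Context (R : realType) (n : nat).
Local Notation V := ('rV[R]_n * R)%type.
Local Notation X := ('rV[R]_n * measurableTypeR R)%type.
Implicit Types (K : V -> R) (z v y : V).
Local Notation integrable f := ((Leb R n).-integrable setT (EFin \o (f : X -> R))).

Lemma compact_supp_sub (W : normedModType R) (B : set W) (f : W -> R) : compact B ->
  (forall x, ~ B x -> f x = 0) -> compact (supp f) /\ supp f `<=` B.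
Proof.
move=> cB f0.
have clB : closed B by exact: (compact_closed _ cB).
have sB : supp f `<=` B.
  rewrite [X in _ `<=` X](closure_id _).1//; apply: closureS => x /= fx.
  by apply: contrapT => /f0 /eqP; rewrite (negbTE fx).
by split => //; apply: (subclosed_compact _ cB sB); exact: closed_closure.
Qed.

Lemma Ck_reflect K k z : Ck k K -> Ck k (fun y => K (z - y)).
Proof.
move=> CK; apply: (@Ck_comp_affine R V V k K (fun y => z - y) (fun v => - v)) => //.
- exact: continuous_subl.
- by move=> y v h; rewrite scalerN opprD addrCA.
Qed.

Lemma derive_reflect K z v y : Ck 1 K -> 'D_v (fun y => K (z - y)) y = - 'D_v K (z - y).
Proof.
move=> CK; suff [] : is_derive y v (fun y => K (z - y)) (- 'D_v K (z - y)) by [].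
apply: (@is_derive_affine R V V K (fun y => z - y) (- v)).
  by move=> h; rewrite scalerN opprD addrCA.
have := is_deriveZdir (- 1) (Ck_is_derive (z - y) v CK).
by rewrite scaleN1r mulN1r.
Qed.

Lemma vanish_off_reflect K s z y : vanish_off (cbox 0 s s) K -> ~ cbox z s s y ->
  K (z - y) = 0.
Proof.
move=> K0 zy; apply: K0; apply: contra_not zy => -[h1 h2]; split => [i|].
  by have := h1 i; rewrite !mxE subr0 distrC.
by move: h2; rewrite /= subr0 distrC.
Qed.

Lemma RintegralN (f : V -> R) : integrable f ->
  \int[Leb R n]_z - f (z : V) = - \int[Leb R n]_z f (z : V).
Proof.
move=> fi; rewrite -mulN1r -RintegralZl//.
by apply: eq_Rintegral => z _; rewrite mulN1r.
Qed.

Variables (p : R) (p2 : 2 < p) (w : V) (r tau : R) (r0 : 0 < r) (tau0 : 0 < tau).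
Let O := obox w.1 r.
Let D : set X := cyl O (w.2 - tau) (w.2 + tau).
Variables (u : V -> R) (G : V -> 'rV[R]_n).
Hypothesis uG : Lp_sobolev p O (w.2 - tau) (w.2 + tau) u G.
Local Notation u_ := (loc_u w r tau u).
Local Notation G_ := (loc_G w r tau G).
Local Notation A_ := (loc_A p w r tau G).
Variables (s : R) (K : V -> R) (s0 : 0 <= s) (kK : mollifier s K).

Let CK k : Ck k K. Proof. by case: kK. Qed.
Let K0 : vanish_off (cbox 0 s s) K. Proof. by case: kK. Qed.
Let dK0 v : vanish_off (cbox 0 s s) (fun y => 'D_v K y).
Proof. exact: vanish_off_derive. Qed.
Let cK : continuous K. Proof. exact: (Ck_continuous (CK 0)). Qed.
Let cdK v : continuous (fun y => 'D_v K y).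
Proof. exact: (Ck_continuous (Ck_derive v (CK 1))). Qed.

(** The test function is y |-> K (z - y), supported in the kernel box of [z]. Each derivative of the
    reflected kernel brings a minus sign, on both sides of the equation. *)
Lemma convol_time_derivative (U : set 'rV[R]_n) (a b : R) z :
  (forall phi, test_function (cyl U a b) phi ->
    \int[lebesgue_spacetime R n]_(z in cyl U a b) (u z * dt phi z) =
    \int[lebesgue_spacetime R n]_(z in cyl U a b)
      dotv (p_flux p (G z)) (grad phi z)) ->
  cbox z s s `<=` D -> D `<=` cyl U a b ->
  convol u_ (fun y => 'D_(etime R n) K y) z =
  \sum_i convol (A_ i) (fun y => 'D_(ebase R i) K y) z.
Proof.
move=> weak zD DQ.
have [cphi sphi] := @compact_supp_sub V (cbox z s s) (fun y => K (z - y))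
  (@cbox_compact _ _ _ _ _) (fun y => vanish_off_reflect K0).
have /weak : test_function (cyl U a b) (fun y => K (z - y)).
  by split => // [k|]; [exact: Ck_reflect|exact: subset_trans sphi (subset_trans zD DQ)].
have Dv v y (q : R) : ~ D y -> q * - 'D_v K (z - y) = 0.
  move=> Dy; rewrite (vanish_off_reflect (@dK0 v)) ?oppr0 ?mulr0//.
  by move=> /zD.
have M (f : V -> R) : \int[lebesgue_spacetime R n]_(z in cyl U a b) f z =
    \int[Leb R n]_z ((f : X -> R) \_ (cyl U a b : set X)) z by exact: Rintegral_mkcond.
rewrite (M (fun y => u y * _)) (M (fun y => dotv (p_flux p (G y)) _)).
set lhs := Rintegral _ _ _; set rhs := Rintegral _ _ _.
have -> : lhs = - convol u_ (fun y => 'D_(etime R n) K y) z.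
  have ui : integrable (fun y => u_ y * 'D_(etime R n) K (z - y)).
    exact: (convol_integrand _ (integrable_loc_u p2 r0 tau0 uG) (@cdK _) (@dK0 _)).
  transitivity (- \int[Leb R n]_y (u_ (y : V) * 'D_(etime R n) K (z - (y : V)))) => //.
  rewrite -(RintegralN ui).
  apply: eq_Rintegral => y _; rewrite /loc_u !patchE /dt derive_reflect//.
  have [yQ|/negP yQ] := ifPn; have [yD|/negP yD] := ifPn.
  - by rewrite mulrN.
  - by rewrite mul0r oppr0 Dv// => /mem_set.
  - by case: yQ; apply/mem_set/DQ/set_mem.
  - by rewrite mul0r oppr0.
have -> : rhs = - \sum_i convol (A_ i) (fun y => 'D_(ebase R i) K y) z.
  have Ai i : integrable (fun y => A_ i y * 'D_(ebase R i) K (z - y)).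
    exact: (convol_integrand _ (integrable_loc_A p2 r0 tau0 uG i) (@cdK _) (@dK0 _)).
  have [iS /esym iE] := Rintegral_sum (index_enum 'I_n) Ai.
  transitivity (- \sum_i \int[Leb R n]_y (A_ i (y : V) * 'D_(ebase R i) K (z - (y : V)))) => //.
  rewrite [X in - X]iE -(RintegralN iS).
  apply: eq_Rintegral => y _; rewrite /loc_A !patchE.
  have [yQ|/negP yQ] := ifPn; last first.
    rewrite big1 ?oppr0// => i _; rewrite patchE ifF ?mul0r//.
    by apply/negP => yD; apply: yQ; apply/mem_set/DQ/set_mem.
  rewrite /dotv -sumrN; apply: eq_bigr => i _; rewrite patchE [grad _ _ _ _]mxE.
  rewrite derive_reflect//; case: ifPn => [|/negP yD]; first by rewrite mulrN.
  by rewrite mul0r oppr0 Dv// => /mem_set.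
by move/oppr_inj.
Qed.

(** The weak gradient is available on almost every time slice only. Both integrals are therefore
    computed by Fubini with time outside and compared slice by slice, with the slice of the
    reflected kernel as test function. *)
Lemma convol_space_derivative i z : cbox z s s `<=` D ->
  convol u_ (fun y => 'D_(ebase R i) K y) z = convol (G_ i) K z.
Proof.
move=> zD.
set f1 : X -> R := fun y => u_ y * 'D_(ebase R i) K (z - (y : V)).
set f2 : X -> R := fun y => G_ i y * K (z - (y : V)).
have i1 : integrable f1.
  exact: (convol_integrand _ (integrable_loc_u p2 r0 tau0 uG) (@cdK _) (@dK0 _)).
have i2 : integrable f2.
  exact: (convol_integrand _ (integrable_loc_G p2 r0 tau0 uG i) cK K0).
have F (f : X -> R) : integrable f -> (\int[Leb R n]_z (f z)%:E =
    \int[@lebesgue_measure R]_t \int[lebesgue_rV R n]_x (f (x, t))%:E)%E.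
  by move=> fi; rewrite -(integral21_prod_meas1 fi).
have mF (f : X -> R) : integrable f -> measurable_fun setT
    (fun t : measurableTypeR R => \int[lebesgue_rV R n]_x (f (x, t))%:E)%E.
  by move=> fi; exact: (measurable_fubini_G fi).
have aeI (f : X -> R) : integrable f -> {ae @lebesgue_measure R, forall t,
    (lebesgue_rV R n).-integrable setT (fun x => (f (x, t))%:E)}.
  by move=> fi; exact: (ae_integrable2 fi).
rewrite /convol /Rintegral; congr fine; rewrite (F _ i1) (F _ i2).
apply: ae_eq_integral => //; [exact: mF|exact: mF|].
have [_ _ aeS _] := uG.
have := aeI _ i1; have := aeI _ i2; move: aeS.
apply: (filterS3 (ae_filter_ringOfSetsType (@lebesgue_measure R))) => t St it2 it1 _.
rewrite -[LHS]fineK ?integrable_fin_num// -[RHS]fineK ?integrable_fin_num//.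
congr EFin.
(* Outside the time interval of the cylinder the truncated data vanish and both slices are 0. *)
have [tI|tI] := boolP (t \in `]w.2 - tau, w.2 + tau[); last first.
  have nD x : ((x, t) \in D) = false.
    by apply/negbTE/negP => /set_mem[_] /=; exact/negP.
  rewrite /f1 /f2 /loc_u /loc_G; congr fine; apply: eq_integral => x _.
  by rewrite !patchE nD !mul0r.
have [_ _ _ wg] := St tI.
pose phi (x : 'rV[R]_n) := K (z - (x, t)).
have Lphi (x v : 'rV[R]_n) (h : R) :
    z - (h *: v + x, t) = h *: ((- v, 0) : V) + (z - ((x, t) : V)).
  have E1 : z.1 - (h *: v + x) = h *: - v + (z.1 - x) by rewrite scalerN opprD addrCA.
  have E2 : z.2 - t = h *: 0 + (z.2 - t) by rewrite scaler0 add0r.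
  exact: (congr2 pair E1 E2).
have cphi : continuous (fun x : 'rV[R]_n => z - (x, t)).
  have cpair : continuous (fun x : 'rV[R]_n => ((x, t) : V)).
    move=> x; have c1 : {for x, continuous (fun x : 'rV[R]_n => x)} by exact: cvg_id.
    have c2 : {for x, continuous (fun _ : 'rV[R]_n => t : R)} by exact: cst_continuous.
    exact: (cvg_pair c1 c2).
  move=> x; apply: (@continuous_comp _ _ _ (fun x : 'rV[R]_n => ((x, t) : V)) (fun y => z - y)).
    exact: cpair.
  exact: continuous_subl.
have tphi : test_function O phi.
  have [x zx|c1 c2] := @compact_supp_sub _ (closed_obox z.1 s) phi (@compact_closed_obox _ _ _ _).
    apply: (vanish_off_reflect K0); apply: contra_not zx => -[h _] j; exact: h.
  split => //; first by move=> k; exact: (Ck_comp_affine cphi Lphi (CK k)).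
  move=> x /c2 zx.
  have /zD[] : cbox z s s (x, z.2) by split => //=; rewrite subrr normr0.
  by [].
have dphi x : 'D_(delta_mx ord0 i) phi x = - 'D_(ebase R i) K (z - ((x, t) : V)).
  have h := is_deriveZdir (- 1) (Ck_is_derive (z - ((x, t) : V)) (ebase R i) (CK 1)).
  suff [] : is_derive x (delta_mx ord0 i) phi (- 'D_(ebase R i) K (z - ((x, t) : V))) by [].
  apply: (@is_derive_affine R 'rV[R]_n V K (fun x => z - ((x, t) : V)) (- delta_mx ord0 i, 0)).
    by move=> k; exact: Lphi.
  move: h; rewrite mulN1r (_ : - 1 *: ebase R i = (- delta_mx ord0 i, 0))//.
  by rewrite scaleN1r; congr pair; rewrite oppr0.
have := wg _ tphi i; rewrite !(Rintegral_mkcond _ O) => wE.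
have memD x : ((x, t) \in D) = (x \in O).
  by apply/idP/idP => /set_mem; [move=> []/= h _; exact/mem_set|move=> h; exact/mem_set].
have P1 : (fun x => u (x, t) * 'D_(delta_mx ord0 i) phi x) \_ O = fun x => -1 * f1 (x, t).
  apply/funext => x; rewrite /f1 /loc_u !patchE memD dphi.
  by case: ifPn => _; rewrite ?mul0r ?mulr0// mulrN mulN1r.
have P2 : (fun x => G (x, t) ord0 i * phi x) \_ O = fun x => f2 (x, t).
  apply/funext => x; rewrite /f2 /loc_G !patchE memD.
  by case: ifPn => _; rewrite ?mul0r.
move: wE; rewrite P1 P2 RintegralZl// mulN1r => /oppr_inj; exact.
Qed.

End mollified_equation.

(** * Removing the mollification *)

Section mollification_limit.
Context (R : realType) (n : nat).
Local Notation V := ('rV[R]_n * R)%type.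
Local Notation X := ('rV[R]_n * measurableTypeR R)%type.
Local Notation integrable f := ((Leb R n).-integrable setT (EFin \o (f : X -> R))).
Variables (p : R) (p2 : 2 < p).

Let p0 : 0 < p. Proof. exact: lt_trans p2. Qed.
Let p1 : 0 < p - 1. Proof. by move: p2 => h; lra. Qed.

(** 2^(p - 1) comes from [dotv_p_flux_ge], and 3^p from splitting an increment into three terms. *)
Let C : R := 2 `^ (p - 1) * 3 `^ p.
Let C0 : 0 <= C. Proof. by rewrite mulr_ge0 ?powR_ge0. Qed.

(** [g] and [g'] are to be the values of the Lipschitz approximation at two points: b - a splits
    into two approximation errors and the increment g' - g. *)
Lemma p_flux_almost_monotone (a b : 'rV[R]_n) (g g' : 'I_n -> R) (omega : R) :
  \sum_i `|g' i - g i| <= omega ->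
  2^-1 * enorm a `^ p - C * (n%:R `^ p * \sum_i `|a ord0 i - g i| `^ p +
    n%:R `^ p * \sum_i `|b ord0 i - g' i| `^ p + omega `^ p) <=
  dotv (p_flux p a) b.
Proof.
move=> gg; apply: le_trans (dotv_p_flux_ge p2 a b).
rewrite lerD2l lerN2 /C -mulrA ler_wpM2l ?powR_ge0//.
have s0 (f : 'I_n -> R) : 0 <= \sum_i `|f i| by apply: sumr_ge0 => i _.
have om0 : 0 <= omega by exact: le_trans gg.
apply: le_trans (_ : (\sum_i `|a ord0 i - g i| + \sum_i `|b ord0 i - g' i| + omega) `^ p <= _).
  apply: ge0_ler_powR; rewrite ?nnegrE ?addr_ge0//; first exact: ltW.
  rewrite (le_trans _ (lerD (lexx _) gg))// -!big_split/=; apply: ler_sum => i _.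
  have -> : b ord0 i - a ord0 i = - (a ord0 i - g i) + (b ord0 i - g' i) + (g' i - g i) by ring.
  by rewrite (le_trans (ler_normD _ _))// lerD2r (le_trans (ler_normD _ _))// normrN.
apply: le_trans (powR_add3_le p2 _ _ _) _ => //.
rewrite ler_wpM2l ?powR_ge0// lerD2r lerD//; exact: powR_sum_le.
Qed.

Variables (m : nat) (pm : p <= m%:R).
Variables (B : R) (B0 : 0 <= B) (HB : forall (c z : V) (a b : R), 0 < a -> 0 < b ->
  (forall i, `|'D_(ebase R i) (cutoff c a b) z| <= B / a) /\
  `|'D_(etime R n) (cutoff c a b) z| <= B / b).
Variables (c : V) (r tau1 rho tau : R) (rho0 : 0 < rho) (rhor : rho < r)
  (tau0 : 0 < tau) (tau01 : tau < tau1).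
Let D : set X := cyl (obox c.1 r) (c.2 - tau1) (c.2 + tau1).
Variables (u : V -> R) (G : V -> 'rV[R]_n) (u0 : forall z, 0 <= u z).
Hypothesis uG : Lp_sobolev p (obox c.1 r) (c.2 - tau1) (c.2 + tau1) u G.
Variables (U : set 'rV[R]_n) (ta tb : R) (DQ : D `<=` cyl U ta tb).
Hypothesis weak : forall phi, test_function (cyl U ta tb) phi ->
  \int[lebesgue_spacetime R n]_(z in cyl U ta tb) (u z * dt phi z) =
  \int[lebesgue_spacetime R n]_(z in cyl U ta tb) dotv (p_flux p (G z)) (grad phi z).

Let r0 : 0 < r. Proof. exact: lt_trans rhor. Qed.
Let t10 : 0 < tau1. Proof. exact: lt_trans tau01. Qed.
Let u_ : V -> R := loc_u c r tau1 u.
Let G_ := loc_G c r tau1 G.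
Let A_ := loc_A p c r tau1 G.
Let a_ : V -> R := loc_norm c r tau1 G.

(** [e] is a multiple of the sum of the |G_i - g_i|^p for Lipschitz approximations g_i, so its
    integral is small. The scale [s1] comes after the g_i and makes their total increment at most
    [kap]. *)
Lemma loc_flux_approx (e0 kap : R) : 0 < e0 -> 0 < kap ->
  exists e : V -> R, exists2 s1 : R, 0 < s1 &
  [/\ integrable e, forall y, 0 <= e y,
      \int[Leb R n]_z e (z : V) <= n%:R `^ p * (n%:R * e0) &
      forall s z y y', s <= s1 -> cbox z s s `<=` D -> cbox z s s y -> cbox z s s y' ->
      2^-1 * a_ y `^ p - C * (e y + e y' + kap `^ p) <= \sum_i A_ i y * G_ i y'].
Proof.
move=> e00 kap0; pose N : set X := cbox c r tau1.
have mN : measurable N by exact: cbox_measurable.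
have mG i : measurable_fun setT (G_ i : X -> R).
  by apply/measurable_EFinP; exact: (measurable_int _ (integrable_loc_G p2 r0 t10 uG i)).
have ap i : lips_approx p c r tau1 (G_ i).
  apply: lips_approx_Lp => //; [exact: ltW|exact: ltW|].
  have ai := integrable_loc_norm p2 uG.
  apply: le_integrable (integrableS measurableT mN (@subsetT _ _) ai) => //.
    apply/measurable_EFinP/measurable_funTS.
    apply: (measurableT_comp (measurable_powR p)); exact: measurableT_comp.
  move=> z _ /=; rewrite lee_fin !(ger0_norm (powR_ge0 _ p)).
  by apply: ge0_ler_powR; rewrite ?nnegrE ?loc_norm_ge0 ?loc_G_le// ltW.
have /choice[g_ gP] : forall i, exists g : (V -> R) * R,
   [/\ 0 <= g.2, forall (q : R) (z h : V), cbox 0 q q h ->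
    `|g.1 (h + z) - g.1 z| <= g.2 * q, measurable_fun setT (g.1 : X -> R) &
      (\int[Leb R n]_(z in N) (`|G_ i z - g.1 z| `^ p)%:E < e0%:E)%E].
  move=> i; have [_ /(_ e0 e00)[g [[L L0 gL] mg gI]]] := ap i.
  by exists (g, L).
pose f i : X -> R := (fun z => `|G_ i z - (g_ i).1 z| `^ p) \_ N.
have mf i : measurable_fun N (fun z : X => `|G_ i z - (g_ i).1 z| `^ p).
  apply: measurable_funTS; apply: (measurableT_comp (measurable_powR p)).
  apply: measurableT_comp => //; apply: measurable_funB => //; by have [] := gP i.
have fi i : integrable (f i).
  rewrite /f -restrict_EFin; apply/(integrable_mkcond _ mN); apply/integrableP; split.
    exact/measurable_EFinP.
  have [_ _ _ h] := gP i.
  rewrite (eq_integral (fun z : X => (`|G_ i z - (g_ i).1 z| `^ p)%:E)).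
    by rewrite (lt_le_trans h)// leey.
  by move=> z _ /=; rewrite ger0_norm ?powR_ge0.
have fle i : \int[Leb R n]_z f i (z : V) <= e0.
  have [_ _ _ h] := gP i; rewrite /f -Rintegral_mkcond /Rintegral -lee_fin fineK ?ltW//.
  by apply: integrable_fin_num => //; apply/(integrable_mkcond _ mN); rewrite restrict_EFin; exact: fi.
have f0 i z : 0 <= f i z by rewrite /f patchE; case: ifPn => // _; exact: powR_ge0.
have [fS fE] := Rintegral_sum (index_enum 'I_n) fi.
pose SL := \sum_i (g_ i).2.
have SL0 : 0 <= SL by apply: sumr_ge0 => i _; case: (gP i).
(* Through the centre of a box of half-width s, the increments between two of its points add up to
   at most 2 SL s; the added 1 avoids a zero denominator. *)
exists (fun z => n%:R `^ p * \sum_i f i z); exists (kap / (2 * (SL + 1))).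
  by rewrite divr_gt0// mulr_gt0// ltr_wpDl.
split.
- exact: integrableRZ.
- by move=> y; rewrite mulr_ge0 ?powR_ge0// sumr_ge0.
- rewrite RintegralZl// fE ler_wpM2l ?powR_ge0//.
  rewrite (le_trans (ler_sum _ (fun i _ => fle i)))// sumr_const card_ord.
  by rewrite mulr_natl.
move=> s z y y' ss zD zy zy'.
have fE' i x : D x -> f i x = `|G x ord0 i - (g_ i).1 x| `^ p.
  move=> Dx; rewrite /f patchE mem_set; last exact: sub_ocyl.
  by rewrite /G_ /loc_G patchE mem_set.
have Dy := zD _ zy; have Dy' := zD _ zy'.
have -> : \sum_i A_ i y * G_ i y' = dotv (p_flux p (G y)) (G y').
  by apply: eq_bigr => i _; rewrite /A_ /G_ /loc_A /loc_G !patchE !mem_set.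
rewrite /a_ /loc_norm patchE mem_set//.
rewrite (eq_bigr _ (fun i _ => fE' i y Dy)) (eq_bigr _ (fun i _ => fE' i y' Dy')).
apply: p_flux_almost_monotone.
have s0 : 0 <= s by case: zy => _; exact: le_trans.
have gs i : `|(g_ i).1 y' - (g_ i).1 y| <= (g_ i).2 * (2 * s).
  have [_ gL _ _] := gP i.
  have gz x : cbox z s s x -> `|(g_ i).1 x - (g_ i).1 z| <= (g_ i).2 * s.
    move=> [x1 x2]; rewrite -{1}(subrK z x); apply: gL; split => [j|]; rewrite ?subr0//.
    by have := x1 j; rewrite !mxE subr0.
  have -> : (g_ i).1 y' - (g_ i).1 y =
    ((g_ i).1 y' - (g_ i).1 z) - ((g_ i).1 y - (g_ i).1 z) by ring.
  by rewrite (le_trans (ler_normB _ _))// mulrCA mulr_natl mulr2n lerD// gz.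
rewrite (le_trans (ler_sum _ (fun i _ => gs i)))// -mulr_suml -/SL.
have h : SL * (2 * s) <= SL * (2 * (kap / (2 * (SL + 1)))).
  by rewrite ler_wpM2l// ler_wpM2l.
apply: le_trans h _.
have -> : SL * (2 * (kap / (2 * (SL + 1)))) = kap * (SL / (SL + 1)).
  by field; apply/eqP; move: SL0; lra.
by rewrite ler_piMr ?ler_pdivrMr ?mul1r ?lerDl//; [exact: ltW|move: SL0; lra].
Qed.

Variables (d : R) (d0 : 0 < d) (b1 : V) (r1 t1 sigma : R) (r10 : 0 <= r1) (t1pos : 0 <= t1)
  (sigma0 : 0 < sigma) (x : 'rV[R]_n) (N L lam l0 : R) (N0 : 0 < N) (lam0 : 0 < lam).
Hypotheses (xN : \sum_i `|x ord0 i| <= N)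
  (HI : forall z (h : R), cbox b1 r1 t1 z -> 0 <= h <= 1 ->
    cbox c (2 / 3 * rho) (2 / 3 * tau) (h *: ((x, 0) : V) + z))
  (l00 : 0 <= l0)
  (ul0 : forall z, cbox b1 (r1 + sigma) (t1 + sigma) z -> l0 <= u z)
  (ux0 : forall z, cbox b1 (r1 + sigma) (t1 + sigma) z -> u (((x, 0) : V) + z) = 0)
  (LL : L <= ln (l0 + d) - ln d).

Let vI : R := (2 * r1) ^+ n * (2 * t1).
Let vW : R := (2 * rho) ^+ n * (2 * tau).
Let th : R := (p - 1) / 4.
Let zm : R := cutoff_min R n ^+ m.
Let k1 : R := m%:R * B / tau * d `^ (2 - p) / (p - 2).
Let k2 : R := th `^ (1 - p) * (n%:R * (m%:R * B / rho)) `^ p.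

(** The Caccioppoli estimate bounds the energy in the oscillation estimate. The mollification leaves
    only two error terms, made smaller than any [eta] by choosing first the approximation of the
    gradient, then the kernel. *)
Lemma oscillation_energy_le :
  L * vI <= N * (lam * vI + lam `^ (1 - p) * zm^-1 * (th^-1 * ((k1 + k2) * vW))).
Proof.
apply/ler_addgt0Pr => eta eta0.
have th0 : 0 < th by rewrite divr_gt0.
have zm0 : 0 < zm by rewrite exprn_gt0// cutoff_min_gt0.
pose Z : R := N * lam `^ (1 - p) * zm^-1 * th^-1.
have Z0 : 0 < Z by rewrite !mulr_gt0 ?invr_gt0 ?powR_gt0.
pose M3 : R := (p - 1) * d `^ (- p) * C.
have M30 : 0 <= M3 by rewrite !mulr_ge0 ?powR_ge0// ltW.
have vW0 : 0 <= vW by rewrite mulr_ge0 ?exprn_ge0 ?mulr_ge0// ltW.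
(* The total coefficients of [e0] and of the p-th power of [kap] in the final bound. Each
   contribution is made at most eta / 2; the minimum with 1 ensures that this power is at most
   [kap]. *)
pose Y1 := Z * (M3 * 2 * (n%:R `^ p * n%:R)); pose Y2 := Z * (M3 * vW).
have Y10 : 0 <= Y1.
  apply: mulr_ge0; first exact: ltW.
  by apply: mulr_ge0; [exact: mulr_ge0|rewrite mulr_ge0 ?powR_ge0].
have Y20 : 0 <= Y2 by apply: mulr_ge0; [exact: ltW|exact: mulr_ge0].
pose e0 := eta / (2 * (Y1 + 1)).
have e00 : 0 < e0 by rewrite divr_gt0// mulr_gt0// ltr_wpDl.
pose kap := Num.min 1 (eta / (2 * (Y2 + 1))).
have kap0 : 0 < kap by rewrite lt_min ltr01 divr_gt0// mulr_gt0// ltr_wpDl.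
have kapp : kap `^ p <= eta / (2 * (Y2 + 1)).
  apply: (@le_trans _ _ kap); last by rewrite ge_min lexx orbT.
  apply: ge1r_powR; first by rewrite kap0 ge_min lexx.
  by move: p2 => ?; lra.
have [e [s1 s10 [ei e0' eE eP]]] := loc_flux_approx e00 kap0.
(* Besides [s1], the kernel must fit in the margin [sigma] around the two boxes where [u] is
   controlled, and in the margins between the cut-off box and [D]. *)
pose s := Num.min (Num.min s1 sigma) (Num.min ((r - rho) / 2) ((tau1 - tau) / 2)).
have s0 : 0 < s.
  by rewrite !lt_min s10 sigma0 !divr_gt0// subr_gt0.
have ss1 : s <= s1 by rewrite !ge_min lexx.
have ssig : s <= sigma by rewrite !ge_min lexx !orbT.
have srho : rho + s < r.
  have : s <= (r - rho) / 2 by rewrite !ge_min lexx !orbT.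
  by move: rhor; lra.
have stau : tau + s < tau1.
  have : s <= (tau1 - tau) / 2 by rewrite !ge_min lexx !orbT.
  by move: tau01; lra.
have WD z : cbox c rho tau z -> cbox z s s `<=` D.
  move=> [z1 z2] y [y1 y2]; split => [i|].
    rewrite (le_lt_trans (ler_distD (z.1 ord0 i) _ _))// (le_lt_trans (lerD (y1 i) (z1 i)))//.
    by rewrite addrC.
  rewrite /= in_itv/= -ltr_distlC distrC (le_lt_trans (ler_distD z.2 _ _))//.
  by rewrite (le_lt_trans (lerD y2 z2))// addrC.
have [K kK] := mollifier_exists n s0.
have s0' := ltW s0.
have ui : integrable u_ by exact: (integrable_loc_u p2 r0 t10 uG).
have u_0 z : 0 <= u_ z by rewrite /u_ /loc_u patchE; case: ifPn.
have Ai i : integrable (A_ i) by exact: (integrable_loc_A p2 r0 t10 uG i).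
have Gi i : integrable (G_ i) by exact: (integrable_loc_G p2 r0 t10 uG i).
have ai : integrable (fun y => a_ y `^ p) by exact: (integrable_loc_norm p2 uG).
have a0 y : 0 <= a_ y by exact: loc_norm_ge0.
have Hdx z i : cbox c rho tau z ->
    convol u_ (fun y => 'D_(ebase R i) K y) z = convol (G_ i) K z.
  by move=> /WD zD; exact: (convol_space_derivative p2 r0 t10 uG s0' kK i zD).
have Hdt z : cbox c rho tau z -> convol u_ (fun y => 'D_(etime R n) K y) z =
    \sum_i convol (A_ i) (fun y => 'D_(ebase R i) K y) z.
  by move=> /WD zD; exact: (convol_time_derivative p2 r0 t10 uG kK weak zD DQ).
have [Qi QE] := caccioppoli_estimate p2 pm B0 HB rho0 tau0 s0' kK ui u_0 Ai Gi ai a0 ei e0'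
  (loc_A_le p2 c r tau1 G) C0 (powR_ge0 kap p)
  (fun z y y' Wz zy zy' => eP s z y y' ss1 (WD z Wz) zy zy') Hdx Hdt d0.
have IW z (h : R) : cbox b1 r1 t1 z -> 0 <= h <= 1 -> cbox c rho tau (h *: ((x, 0) : V) + z).
  move=> Iz /(HI Iz); apply: cboxS; rewrite ler_piMl//; (by rewrite ltW) || lra.
have Is z y : cbox b1 r1 t1 z -> cbox z s s y -> cbox b1 (r1 + sigma) (t1 + sigma) y.
  move=> Iz zy; have -> : y = (y - z) + z by rewrite subrK.
  have : cbox b1 (s + r1) (s + t1) ((y - z) + z).
    apply: cboxD Iz; case: zy => y1 y2; split=> [i|]; last by rewrite subr0.
    by have := y1 i; rewrite !mxE subr0.
  by apply: cboxS; rewrite addrC lerD2l.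
have uu z y : cbox c rho tau z -> cbox z s s y -> u_ y = u y.
  by move=> /WD zD /zD Dy; rewrite /u_ /loc_u patchE mem_set.
have Ul z : cbox b1 r1 t1 z -> l0 + d <= convol u_ K z + d.
  move=> Iz; have Wz : cbox c rho tau z.
    have := IW z 0 Iz; by rewrite scale0r add0r; apply; rewrite lexx ler01.
  rewrite lerD2r -(convol_cst s0' kK l0 z); apply: (convol_le kK).
  - exact: (convol_integrable_cst s0' kK).
  - exact: (integrable_convolI kK).
  - move=> y zy; rewrite (uu z y Wz zy); apply: ul0; exact: (Is z).
have U2 z : cbox b1 r1 t1 z -> convol u_ K (((x, 0) : V) + z) = 0.
  move=> Iz; have Wz : cbox c rho tau (((x, 0) : V) + z).
    have := IW z 1 Iz; by rewrite scale1r; apply; rewrite lexx ler01.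
  apply/eqP; rewrite eq_le (convol_ge0 _ kK)// andbT.
  rewrite -[leRHS](convol_cst s0' kK 0 (((x, 0) : V) + z)); apply: (convol_le kK).
  - exact: (integrable_convolI kK).
  - exact: (convol_integrable_cst s0' kK).
  - move=> y zy; rewrite (uu _ y Wz zy).
    have -> : y = ((x, 0) : V) + (y - ((x, 0) : V)) by rewrite addrC subrK.
    rewrite ux0//; apply: (Is z) => //; case: zy => y1 y2; split => [i|].
      by have := y1 i; rewrite !mxE opprD addrA.
    by move: y2; rewrite /= add0r subr0.
have l10 : 0 < l0 + d by rewrite ltr_wpDl.
have := oscillation_estimate p2 rho0 tau0 s0' kK ui u_0 Gi ai a0 (loc_G_le c r tau1 G)
  Hdx d0 r10 t1pos N0 xN HI l10 Ul U2 LL lam0 Qi.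
move=> OE; apply: le_trans OE _.
move: QE; set J := Rintegral _ _ _; set E := \int[Leb R n]_z e (z : V) => QE.
have half (Y : R) : 0 <= Y -> Y * (eta / (2 * (Y + 1))) <= eta / 2.
  move=> Y0; have -> : Y * (eta / (2 * (Y + 1))) = eta / 2 * (Y / (Y + 1)).
    by field; apply/eqP; move: Y0; lra.
  by rewrite ler_piMr ?ler_pdivrMr ?mul1r ?lerDl//; [rewrite ltW// divr_gt0|move: Y0; lra].
have E1 : Y2 * kap `^ p <= eta / 2.
  by rewrite (le_trans _ (half _ Y20))// ler_wpM2l.
have E2 : Z * (M3 * 2) * E <= eta / 2.
  apply: le_trans (half _ Y10); rewrite /Y1 -/e0.
  have -> : Z * (M3 * 2 * (n%:R `^ p * n%:R)) * e0 = Z * (M3 * 2) * (n%:R `^ p * (n%:R * e0)).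
    by ring.
  by apply: ler_wpM2l eE; apply: mulr_ge0; [exact: ltW|exact: mulr_ge0].
have JE : J <= th^-1 * ((k1 + k2 + M3 * kap `^ p) * vW + M3 * 2 * E).
  by rewrite ler_pdivlMl//; exact: QE.
rewrite -/zm -/vI [leLHS]mulrDr [leRHS](_ : _ = N * (lam * vI) +
  (Z * ((k1 + k2) * vW) + eta)); last by rewrite /Z; ring.
rewrite lerD2l.
have -> : N * (lam `^ (1 - p) * zm^-1 * J) = (Z * th) * J.
  by rewrite /Z; field; rewrite !gt_eqF.
apply: le_trans (_ : Z * th * (th^-1 * ((k1 + k2 + M3 * kap `^ p) * vW + M3 * 2 * E)) <= _).
  by apply: ler_wpM2l JE; rewrite mulr_ge0// ltW.
have -> : Z * th * (th^-1 * ((k1 + k2 + M3 * kap `^ p) * vW + M3 * 2 * E)) =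
  Z * ((k1 + k2) * vW) + (Y2 * kap `^ p + Z * (M3 * 2) * E).
  by rewrite /Y2; field; rewrite gt_eqF.
by rewrite lerD2l (le_trans (lerD E1 E2))// -splitr.
Qed.

End mollification_limit.

(** * The choice of the parameters *)

Section parameter_choice.
Context (R : realType) (n : nat).
Local Notation V := ('rV[R]_n * R)%type.
Local Notation X := ('rV[R]_n * measurableTypeR R)%type.
Variables (p : R) (p2 : 2 < p).

Lemma mul_powR (x y q : R) : 0 < x -> 0 < y -> (x * y) `^ q = x `^ q * y `^ q.
Proof. by move=> x0 y0; rewrite powRM ?ltW. Qed.

Lemma powR_invr (x q : R) : 0 < x -> x^-1 `^ q = (x `^ q)^-1.
Proof. by move=> x0; rewrite -(powR_inv1 (ltW x0)) -powRrM mulN1r powRN. Qed.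

(* All powers of [q] cancel except the favourable [q^2] in front of [c1]. *)
Lemma scaled_estimate (zm th kappa q tau ell c1 c2 k1 k2 N L lam : R) :
  0 < zm -> 0 < th -> 0 < kappa -> 0 < q -> 0 < tau -> 0 < ell ->
  k1 = c1 * q ^+ 2 / q `^ p -> k2 = c2 / q `^ p ->
  lam = ell / q -> 0 < N -> L = 2 * (N * lam) ->
  L * ((2 * (kappa * q / 2)) ^+ n * (2 * (tau / 2))) <=
  N * (lam * ((2 * (kappa * q / 2)) ^+ n * (2 * (tau / 2))) +
    lam `^ (1 - p) * zm^-1 * (th^-1 * ((k1 + k2) * ((2 * (3 * q)) ^+ n * (2 * tau))))) ->
  ell `^ p * zm * th * kappa ^+ n <= (c1 * q ^+ 2 + c2) * (6 ^+ n * 2).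
Proof.
move=> zm0 th0 k0 q0 t0 l0 k1E k2E lamE N0 LE.
have lam0 : 0 < lam by rewrite lamE divr_gt0.
have qp0 : 0 < q `^ p by rewrite powR_gt0.
have lp0 : 0 < ell `^ p by rewrite powR_gt0.
have lamp : lam `^ p = ell `^ p / q `^ p.
  by rewrite lamE mul_powR ?invr_gt0// powR_invr.
have -> : 2 * (kappa * q / 2) = kappa * q by field.
have -> : 2 * (tau / 2) = tau by field.
have -> : 2 * (3 * q) = 6 * q by ring.
rewrite !exprMn.
have -> : lam `^ (1 - p) = lam / lam `^ p.
  by rewrite powRB ?powRr1 ?(ltW lam0)// (gt_eqF lam0) implybT.
rewrite LE lamp k1E k2E.
have qn0 : 0 < q ^+ n by rewrite exprn_gt0.
set kn := kappa ^+ n; set qn := q ^+ n.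
set sn := 6 ^+ n.
move=> H.
have {}H : N * lam * (kn * qn * tau) <= N * (lam / (ell `^ p / q `^ p) / zm *
    (th^-1 * ((c1 * q ^+ 2 / q `^ p + c2 / q `^ p) * (sn * qn * (2 * tau))))).
  by move: H; rewrite [leRHS]mulrDr -mulrA mulr_natl mulr2n [N * (lam * (_ * _))]mulrA lerD2l.
have D0 : 0 < ell `^ p * zm * th / (N * lam * qn * tau) by rewrite !(divr_gt0, mulr_gt0).
have := ler_wpM2l (ltW D0) H.
rewrite (_ : _ * (N * lam * (kn * qn * tau)) = ell `^ p * zm * th * kn); last first.
  by field; rewrite !gt_eqF.
rewrite (_ : ell `^ p * zm * th / _ * _ = (c1 * q ^+ 2 + c2) * (sn * 2))//.
by field; rewrite !gt_eqF.
Qed.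

Variables (c : V) (r tau1 tau : R) (r0 : 0 < r) (tau0 : 0 < tau) (tau01 : tau < tau1).
Let D : set X := cyl (obox c.1 r) (c.2 - tau1) (c.2 + tau1).
Variables (u : V -> R) (G : V -> 'rV[R]_n) (u0 : forall z, 0 <= u z).
Hypothesis uG : Lp_sobolev p (obox c.1 r) (c.2 - tau1) (c.2 + tau1) u G.
Variables (U : set 'rV[R]_n) (ta tb : R) (DQ : D `<=` cyl U ta tb).
Hypothesis weak : forall phi, test_function (cyl U ta tb) phi ->
  \int[lebesgue_spacetime R n]_(z in cyl U ta tb) (u z * dt phi z) =
  \int[lebesgue_spacetime R n]_(z in cyl U ta tb) dotv (p_flux p (G z)) (grad phi z).

(** For all small q, the two boxes force a drop of the logarithm that the energy bound forbids.
    [ell], then [L] and [h], depend on constants without q; [q] is chosen last. *)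
Lemma no_linear_growth (kappa c0 q0 : R) : 0 < kappa <= 1 -> 0 < c0 -> 0 < q0 ->
  (forall q : R, 0 < q < q0 -> exists a b : 'rV[R]_n,
    [/\ forall i, `|a ord0 i - c.1 ord0 i| <= q, forall i, `|b ord0 i - c.1 ord0 i| <= q,
        forall z : V, cbox (a, c.2) (kappa * q) tau z -> c0 * q <= u z &
        forall z : V, cbox (b, c.2) (kappa * q) tau z -> u z = 0]) -> False.
Proof.
move=> /andP[kap0 kap1] c00 q00 H.
have p0 : 0 < p by exact: lt_trans p2.
have p20 : 0 < p - 2 by rewrite subr_gt0.
have [m pm] : exists m : nat, p <= m%:R.
  by exists (Num.truncn p).+1; apply: ltW; rewrite truncnS_gt.
have [B B0 HB0] := cutoff_derive_bound R n.
have HB (c z : V) (a b : R) := HB0 c a b z.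
pose zm := cutoff_min R n ^+ m.
have zm0 : 0 < zm by rewrite exprn_gt0// cutoff_min_gt0.
pose th := (p - 1) / 4.
have th0 : 0 < th by rewrite divr_gt0//; move: p2 => ?; lra.
pose c2 := th `^ (1 - p) * (n%:R * (m%:R * B / 3)) `^ p.
have c20 : 0 <= c2 by rewrite mulr_ge0 ?powR_ge0.
pose Y := (1 + c2) * (6 ^+ n * 2) : R.
have Y0 : 0 < Y by apply: mulr_gt0; [rewrite ltr_pwDl|rewrite mulr_gt0 ?exprn_gt0].
pose W := zm * th * kappa ^+ n.
have W0 : 0 < W by apply: mulr_gt0; [exact: mulr_gt0|exact: exprn_gt0].
(* Makes ell^p W > Y, through ell <= ell^p for ell >= 1. [Y] bounds the right-hand side of
   [scaled_estimate] once c1 q^2 <= 1. *)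
pose ell := Y / W + 1.
have ell1 : 1 < ell by rewrite ltrDr divr_gt0.
have ellY : Y < ell `^ p * zm * th * kappa ^+ n.
  have -> : ell `^ p * zm * th * kappa ^+ n = ell `^ p * W by rewrite /W; ring.
  rewrite -ltr_pdivrMr//; apply: (@lt_le_trans _ _ ell); first by rewrite ltrDl.
  by apply: le1r_powR; [exact: ltW|move: p2 => ?; lra].
(* Equal to 2 N lam for the later N = 2 (n + 1) q and lam = ell / q: the scale cancels, and half of
   the drop remains after the term in [lam] is absorbed. *)
pose L := 4 * n.+1%:R * ell.
have L0 : 0 < L by rewrite !mulr_gt0// (lt_trans ltr01 ell1).
(* Solves ln (1 + c0 / h) = L, the drop of ln (u + h q) from a point where u = c0 q to a zero of
   u. *)
pose h := c0 / (expR L - 1).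
have eL : 0 < expR L - 1 by rewrite subr_gt0 expR_gt1.
have h0 : 0 < h by rewrite divr_gt0.
pose c1 := m%:R * B / tau * h `^ (2 - p) / (p - 2).
have c10 : 0 <= c1.
  by rewrite divr_ge0 ?(ltW p20)// mulr_ge0 ?powR_ge0// divr_ge0 ?mulr_ge0// ltW.
(* The first pair keeps q admissible and the box of half-width 3 q inside the cylinder; the second
   gives c1 q^2 <= 1. *)
pose q := Num.min (Num.min (q0 / 2) (r / 4)) (Num.min 1 (c1 + 1)^-1).
have c11 : 0 < c1 + 1 by rewrite ltr_wpDl.
have qpos : 0 < q by rewrite !lt_min divr_gt0// divr_gt0// ltr01 invr_gt0 c11.
have qq0 : q < q0.
  by rewrite (@le_lt_trans _ _ (q0 / 2))// ?ge_min ?lexx//; move: q00; lra.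
have qr : 3 * q < r.
  have : q <= r / 4 by rewrite !ge_min lexx orbT.
  by move: r0; lra.
have q1 : q <= 1 by rewrite !ge_min lexx !orbT.
have qc1 : q <= (c1 + 1)^-1 by rewrite !ge_min lexx !orbT.
have cq : c1 * q ^+ 2 <= 1.
  have cq1 : q * (c1 + 1) <= 1 by rewrite -ler_pdivlMr// mul1r.
  by move: c10 qpos q1 cq1; nra.
have [a [b [aq bq ua ub]]] := H q (introT andP (conj qpos qq0)).
(* The working boxes have half of the given sizes; [sigma] is the room this leaves for the
   kernel. *)
pose sigma := Num.min (kappa * q / 2) (tau / 2).
have sig0 : 0 < sigma by rewrite lt_min !divr_gt0 ?mulr_gt0.
pose d := h * q; have d0 : 0 < d by rewrite mulr_gt0.
pose N := 2 * n.+1%:R * q; have N0 : 0 < N by rewrite !mulr_gt0.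
pose lam := ell / q; have lam0 : 0 < lam by rewrite divr_gt0// (lt_trans ltr01 ell1).
have LE : L = 2 * (N * lam).
  by rewrite /L /N /lam; field; rewrite gt_eqF.
have tq : 0 < 3 * q by rewrite mulr_gt0.
pose x := b - a.
have xN : \sum_i `|x ord0 i| <= N.
  apply: (@le_trans _ _ (\sum_(i < n) (2 * q))).
    apply: ler_sum => i _; rewrite !mxE.
    have -> : b ord0 i - a ord0 i = (b ord0 i - c.1 ord0 i) - (a ord0 i - c.1 ord0 i) by ring.
    by rewrite (le_trans (ler_normB _ _))// mulr_natl mulr2n lerD.
  rewrite sumr_const card_ord -mulr_natr /N.
  have : n%:R <= n.+1%:R :> R by rewrite ler_nat.
  by move: qpos; nra.
(* Points of the segments stay within q + q / 2 of the centre, hence within 2 q, which is 2/3 of the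
   cut-off width 3 q. *)
have HI z (k : R) : cbox (a, c.2) (kappa * q / 2) (tau / 2) z -> 0 <= k <= 1 ->
    cbox c (2 / 3 * (3 * q)) (2 / 3 * tau) (k *: ((x, 0) : V) + z).
  move=> [z1 z2] /andP[k0 k1]; split => [i|]; last first.
    rewrite /= scaler0 add0r; apply: le_trans z2 _; move: tau0; lra.
  rewrite !mxE (_ : _ - c.1 ord0 i = (1 - k) * (a ord0 i - c.1 ord0 i) +
    (k * (b ord0 i - c.1 ord0 i) + (z.1 ord0 i - a ord0 i))); last by ring.
  have k1' : 0 <= 1 - k by rewrite subr_ge0.
  have h1 : `|(1 - k) * (a ord0 i - c.1 ord0 i)| <= (1 - k) * q.
    by rewrite normrM ger0_norm// ler_wpM2l.
  have h2 : `|k * (b ord0 i - c.1 ord0 i)| <= k * q by rewrite normrM ger0_norm// ler_wpM2l.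
  have h3 : `|z.1 ord0 i - a ord0 i| <= q / 2.
    apply: le_trans (z1 i) _; rewrite ler_wpM2r// ler_piMl// ltW//.
  rewrite (le_trans (ler_normD _ _))// (le_trans (lerD h1 (ler_normD _ _)))//.
  rewrite (le_trans (lerD (lexx _) (lerD h2 h3)))//; move: qpos; lra.
have ul0 z : cbox (a, c.2) (kappa * q / 2 + sigma) (tau / 2 + sigma) z -> c0 * q <= u z.
  move=> hz; apply: ua; move: hz; apply: cboxS.
    have : sigma <= kappa * q / 2 by rewrite ge_min lexx.
    by lra.
  have : sigma <= tau / 2 by rewrite ge_min lexx orbT.
  by lra.
have ux0 z : cbox (a, c.2) (kappa * q / 2 + sigma) (tau / 2 + sigma) z ->
    u (((x, 0) : V) + z) = 0.
  move=> [z1 z2]; apply: ub; split => [i|].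
    have := z1 i; rewrite !mxE /= => h1.
    have -> : b ord0 i - a ord0 i + z.1 ord0 i - b ord0 i = z.1 ord0 i - a ord0 i by ring.
    apply: le_trans h1 _; have : sigma <= kappa * q / 2 by rewrite ge_min lexx.
    by lra.
  move: z2; rewrite /= add0r => h2; apply: le_trans h2 _.
  have : sigma <= tau / 2 by rewrite ge_min lexx orbT.
  by lra.
have LL : L <= ln (c0 * q + d) - ln d.
  have cd0 : 0 < c0 * q + d by apply: addr_gt0 => //; exact: mulr_gt0.
  rewrite -ln_div ?posrE// (_ : (c0 * q + d) / d = expR L) ?expRK//.
  by rewrite /d /h; field; rewrite ?(gt_eqF qpos) ?(gt_eqF eL) ?(gt_eqF c00).
have kq0 : 0 <= kappa * q / 2 by rewrite divr_ge0// mulr_ge0// ltW.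
have t20 : 0 <= tau / 2 by rewrite divr_ge0// ltW.
have c0q : 0 <= c0 * q by rewrite mulr_ge0// ltW.
have EST := oscillation_energy_le p2 pm B0 HB tq qr tau0 tau01 u0 uG DQ weak d0 kq0 t20 sig0
  N0 lam0 xN HI c0q ul0 ux0 LL.
have k1E : m%:R * B / tau * d `^ (2 - p) / (p - 2) = c1 * q ^+ 2 / q `^ p.
  rewrite /d mul_powR// (powRB (x := q)) ?(gt_eqF qpos) ?implybT// (powR_mulrn 2 (ltW qpos)) /c1.
  by rewrite !mulrA; ring.
have k2E : th `^ (1 - p) * (n%:R * (m%:R * B / (3 * q))) `^ p = c2 / q `^ p.
  have -> : n%:R * (m%:R * B / (3 * q)) = n%:R * (m%:R * B / 3) * q^-1.
    by field; rewrite gt_eqF.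
  have nB : 0 <= n%:R * (m%:R * B / 3) by rewrite mulr_ge0// divr_ge0// mulr_ge0.
  have qi : 0 <= q^-1 by rewrite invr_ge0 ltW.
  by rewrite (powRM _ nB qi) powR_invr// mulrA.
have ell0 : 0 < ell by exact: lt_trans ell1.
have := scaled_estimate zm0 th0 kap0 qpos tau0 ell0 k1E k2E erefl N0 LE EST.
apply/negP; rewrite -ltNge (le_lt_trans _ ellY)// /Y ler_wpM2r ?mulr_ge0 ?exprn_ge0//.
by rewrite lerD2r.
Qed.

End parameter_choice.

(** * Corkscrew balls *)

Section boundary_distance.
Context (R : realType) (n : nat).
Implicit Types (A : set 'rV[R]_n) (a x y : 'rV[R]_n).

Lemma bdryC A : bdry (~` A) = bdry A.
Proof.
have cC : closure (~` A) = ~` A^° by rewrite -[A in RHS]setCK interiorC setCK.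
by rewrite /bdry cC interiorC setDE setCK setIC setDE.
Qed.

Lemma dist_to_le A x y : A y -> dist_to x A <= enorm (x - y).
Proof.
move=> Ay; apply: ge_inf; last by exists y.
by exists 0 => _ [z _ <-]; exact: enorm_ge0.
Qed.

(** The segment from [a] to [x] avoids the boundary, so along it lying in the interior and lying in
    the closure of [A] are the same. The corresponding parameters are open and closed in [0, 1],
    which is connected. *)
Lemma mem_of_dist_to A a x : A a -> enorm (x - a) < dist_to a (bdry A) -> A x.
Proof.
move=> Aa xa; pose g (t : R) := a + t *: (x - a).
have cg : continuous g.
  move=> t; apply: cvgD; first exact: cvg_cst.
  by apply: cvgZl; exact: cvg_id.
have gE t : 0 <= t <= 1 -> ~ bdry A (g t).
  move=> /andP[t0 t1] /(dist_to_le a); apply/negP; rewrite -ltNge.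
  apply: le_lt_trans xa; rewrite /g opprD addrA subrr sub0r.
  have -> : enorm (- (t *: (x - a))) = t * enorm (x - a).
    rewrite /enorm -[t in RHS](ger0_norm t0) -sqrtr_sqr -sqrtrM ?sqr_ge0//.
    congr Num.sqrt.
    by rewrite /dotv mulr_sumr; apply: eq_bigr => i _; rewrite !mxE; ring.
  by rewrite ler_piMl// enorm_ge0.
pose B : set R := `[0, 1] `&` (g @^-1` A^°).
have BE : B = `[0, 1] `&` (g @^-1` closure A).
  apply/seteqP; split => t [tI] /= h; split => //.
    by apply: subset_closure; exact: interior_subset.
  apply: contrapT => nA; apply: (gE t) => //.
have B1 : B = `[0, 1]%classic.
  apply: (@segment_connected R 0 1).
  - exists 0; rewrite BE; split; first by rewrite /= in_itv/= lexx ler01.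
    by rewrite /= /g scale0r addr0; exact: subset_closure.
  - exists (g @^-1` A^°) => //; apply: open_comp; last exact: open_interior.
    by move=> t _; exact: cg.
  - exists (g @^-1` closure A) => //; apply: closed_comp; last exact: closed_closure.
    by move=> t _; exact: cg.
have : B 1 by rewrite B1 /= in_itv/= ler01 lexx.
by move=> [_] /interior_subset; rewrite /= /g scale1r addrC subrK.
Qed.

(* The factor [n] in front of the distance avoids the triangle inequality for
   [enorm]: distances are compared coordinatewise. *)
Lemma dist_to_ge A (a x : 'rV[R]_n) (D e : R) : A !=set0 -> D <= dist_to a A ->
  (forall i, `|x ord0 i - a ord0 i| <= e) ->
  D <= n%:R * e + n%:R * dist_to x A.
Proof.
move=> A0 Da xa; case: (posnP n) => [n0|n0].
  have nR : n%:R = 0 :> R by rewrite n0.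
  case: A0 => y Ay; apply: le_trans Da _; apply: le_trans (dist_to_le a Ay) _.
  apply: le_trans (enorm_le_sum _) _; rewrite big1 ?nR ?mul0r ?addr0// => i _.
  by move: (ltn_ord i); rewrite {2}n0.
rewrite -lerBlDl -ler_pdivrMl ?ltr0n//; apply: lb_le_inf.
  by case: A0 => y Ay; exists (enorm (x - y)); exists y.
move=> _ [y Ay <-]; rewrite ler_pdivrMl ?ltr0n// lerBlDl.
apply: le_trans Da _; apply: le_trans (dist_to_le a Ay) _.
apply: le_trans (enorm_le_sum _) _.
apply: (@le_trans _ _ (\sum_(i < n) (e + enorm (x - y)))).
  apply: ler_sum => i _; rewrite !mxE.
  have -> : a ord0 i - y ord0 i = - (x ord0 i - a ord0 i) + (x - y) ord0 i.
    by rewrite !mxE; ring.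
  by rewrite (le_trans (ler_normD _ _))// normrN lerD// coord_le_enorm.
by rewrite sumr_const card_ord -mulrDr mulr_natl.
Qed.

End boundary_distance.

Lemma Rintegral_null d (T : measurableType d) (R : realType)
    (mu : {measure set T -> \bar R}) (D : set T) (f : T -> R) :
  mu setT = 0%E -> \int[mu]_(x in D) f x = 0.
Proof.
move=> mu0; rewrite /Rintegral (eq_measure_integral mzero) ?integral_measure_zero//.
move=> A mA _; apply/eqP; rewrite eq_le measure_ge0 andbT [leRHS](_ : _ = mu setT)//.
by apply: le_measure; rewrite ?inE.
Qed.

(** * Measurability of the sets in the statement *)

Section parabolic_sets.
Context (R : realType) (n : nat).
Implicit Types (A : set 'rV[R]_n) (w : 'rV[R]_n) (r : R).

Lemma measurable_eball w r : measurable (eball w r).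
Proof.
have mf : measurable_fun setT (fun y : 'rV[R]_n => enorm (y - w)).
  exact: (measurableT_comp (@measurable_enorm R n) (@measurable_fun_translation_rV R n (- w))).
rewrite (_ : eball w r = setT `&` (fun y => enorm (y - w)) @^-1` `]-oo, r[).
  exact: mf.
by apply/seteqP; split => y; rewrite /eball /= in_itv/=; [split|case].
Qed.

Lemma closed_measurable_rV A : closed A -> measurable A.
Proof.
move=> cA; rewrite -(setCK A); apply: measurableC; apply: open_measurable_rV.
exact: closed_openC.
Qed.

Lemma measurable_bdry A : measurable (bdry A).
Proof.
apply: measurableD; first by apply: closed_measurable_rV; exact: closed_closure.
by apply: open_measurable_rV; exact: open_interior.
Qed.

(** The Euclidean norm is at most the sum of n coordinates; dividing by n + 1 makes the inequality
    strict and is meaningful for n = 0. *)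
Lemma closed_obox_sub_eball w (q r : R) : 0 < r -> q <= r / n.+1%:R ->
  closed_obox w q `<=` eball w r.
Proof.
move=> r0 qr y hy; apply: le_lt_trans (enorm_le_sum _) _.
apply: (@le_lt_trans _ _ (\sum_(i < n) q)).
  by apply: ler_sum => i _; rewrite !mxE.
rewrite sumr_const card_ord -mulr_natl.
apply: (@le_lt_trans _ _ (n%:R * (r / n.+1%:R))); first by rewrite ler_wpM2l.
by rewrite mulrA ltr_pdivrMr// mulrC ltr_pM2l// ltr_nat.
Qed.

End parabolic_sets.

(** * Positivity of the Riesz measure, by contradiction *)

Theorem theorem4p8 (R : realType) (n : nat) (p : R) (Omega : set 'rV[R]_n)
    (M r0 T : R) (u : 'rV[R]_n * R -> R) (w : 'rV[R]_n)
    (r epsilon t0 Lambda : R)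
    (mu : {measure set ('rV[R]_n * R) -> \bar R})
    (E := cyl (eball w r) (t0 - epsilon) t0)
    (Omega_T := cyl Omega 0 T)
    (dp_Omega_T := parabolic_boundary Omega T) :
  2 < p ->
  NTA_domain M r0 Omega ->
  0 < T ->
  p_parabolic_solution p Omega T u ->
  (forall z, Omega_T z -> 0 <= u z) ->
  bdry Omega w ->
  0 < r ->
  0 < epsilon ->
  `]t0 - epsilon, t0[ `<=` `]0, T[ ->
  vanishes_continuously Omega T u (E `&` dp_Omega_T) ->
  ereal_sup [set dist_quotient Omega u z | z in E `&` Omega_T]
    = (Lambda^-1)%:E ->
  riesz_measure p Omega T u (eball w r) (t0 - epsilon) t0 mu ->
  (0 < mu (E `&` dp_Omega_T))%E.
Proof.
move=> p2 [[oO _ _ _] [M2 r00] ckO ckC _] T0 _ u0 wO rpos e0 tI _ supE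
  [_ muC [G [uG weakG]]].
rewrite lt0e measure_ge0 andbT; apply/negP => /eqP mu0.
pose Q := cyl (eball w r) (t0 - epsilon) t0.
pose ubar : 'rV[R]_n * R -> R := patch (fun=> 0) (cyl Omega 0 T) u.
have M0 : 0 < M by exact: lt_le_trans M2.
have mQ : measurable (Q : set ('rV[R]_n * R)).
  by apply: measurableX; [exact: measurable_eball|exact: measurable_itv].
have mL : measurable (lateral_boundary Omega T : set ('rV[R]_n * R)).
  by apply: measurableX; [exact: measurable_bdry|exact: measurable_itv].
have mdp : measurable (dp_Omega_T : set ('rV[R]_n * R)).
  apply: measurableU => //; apply: measurableX; last exact: measurable_set1.
  by apply: closed_measurable_rV; exact: closed_closure.
(* The measure lives on the lateral boundary inside [Q], which is part of the set assumed null, so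
   it vanishes altogether. *)
have muT : mu setT = 0%E.
  have mLQ : measurable (lateral_boundary Omega T `&` Q : set ('rV[R]_n * R)).
    exact: measurableI.
  apply/eqP; rewrite eq_le measure_ge0 andbT -(setUv (lateral_boundary Omega T `&` Q)).
  apply: le_trans (measureU2 _ _ _) _ => //; first exact: measurableC.
  rewrite [X in (_ + X <= _)%E]muC adde0 -mu0; apply: le_measure; rewrite ?inE//.
    exact: measurableI.
  by move=> z [Lz Qz]; split => //; left.
(* With [mu] null the right-hand side disappears: the zero extension is a weak solution across the
   boundary, with spatial gradient [G]. *)
have weak phi : test_function Q phi ->
    \int[lebesgue_spacetime R n]_(z in Q) (ubar z * dt phi z) =
    \int[lebesgue_spacetime R n]_(z in Q) dotv (p_flux p (G z)) (grad phi z).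
  move=> /weakG; rewrite (Rintegral_null _ _ muT) oppr0.
  by move/eqP; rewrite addrC subr_eq0 => /eqP.
(* The midpoint in time. The half-heights epsilon / 4 < epsilon / 3 < epsilon / 2 nest the cut-off
   box, the cylinder and [Q]. *)
pose c : 'rV[R]_n * R := (w, t0 - epsilon / 2).
pose q1 := r / n.+1%:R.
have q10 : 0 < q1 by rewrite divr_gt0.
have O1 : closed_obox w q1 `<=` eball w r by exact: closed_obox_sub_eball.
have Lp : Lp_sobolev p (obox c.1 q1) (c.2 - epsilon / 3) (c.2 + epsilon / 3) ubar G.
  apply: uG.
  - exact: open_obox.
  - exact: compact_closure_obox.
  - by apply: subset_trans O1; exact: closure_obox.
  - by rewrite /c/=; move: e0; lra.
  - by rewrite /c/=; move: e0; lra.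
have ubar0 z : 0 <= ubar z.
  by rewrite /ubar patchE; case: ifPn => // /set_mem/u0.
have DQ : cyl (obox c.1 q1) (c.2 - epsilon / 3) (c.2 + epsilon / 3) `<=` Q.
  move=> z [z1 z2]; split; first by apply: O1 => i; exact: ltW.
  move: z2; rewrite /c/= !in_itv/= => /andP[h1 h2]; apply/andP.
  by move: e0 h1 h2; split; lra.
have tauP : 0 < epsilon / 4 by rewrite divr_gt0.
have tau34 : epsilon / 4 < epsilon / 3 by move: e0; lra.
(* A positive majorant of the supremum, whatever its sign. *)
pose C := `|Lambda^-1| + 1.
have C0 : 0 < C by rewrite ltr_wpDl.
(* A box of half-width kappa q has Euclidean radius at most n kappa q <= q / (2 M), half of the
   distance to the boundary granted by the corkscrew condition. *)
pose kappa := (2 * M * n.+1%:R)^-1.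
have n10 : 0 < n.+1%:R :> R by [].
have n11 : 1 <= n.+1%:R :> R by rewrite ler1n.
have kap0 : 0 < kappa by rewrite invr_gt0 !mulr_gt0.
have kap1 : kappa <= 1 by rewrite invf_le1 ?mulr_gt0//; move: M2 n11; nra.
have kapM : n%:R * kappa <= M^-1 / 2.
  have -> : n%:R * kappa = M^-1 / 2 * (n%:R / n.+1%:R) by rewrite /kappa; field; rewrite !gt_eqF.
  rewrite ler_piMr ?divr_ge0 ?invr_ge0 ?(ltW M0)//.
  by rewrite ler_pdivrMr// mul1r ler_nat.
(* [r0] is the corkscrew range; below q1 / 2 the box around [a], within 2 q of [w], stays in the
   ball. *)
pose q0 := Num.min r0 (q1 / 2).
have q00 : 0 < q0 by rewrite lt_min r00 divr_gt0.
have box_in (A : set 'rV[R]_n) (a : 'rV[R]_n) (q : R) (x : 'rV[R]_n) : 0 < q -> A a ->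
    M^-1 * q < dist_to a (bdry A) ->
    (forall i, `|x ord0 i - a ord0 i| <= kappa * q) -> A x.
  move=> qp Aa ad xa; apply: (mem_of_dist_to Aa); apply: le_lt_trans ad.
  apply: le_trans (enorm_le_sum _) _.
  apply: (@le_trans _ _ (\sum_(i < n) kappa * q)).
    by apply: ler_sum => i _; rewrite !mxE.
  rewrite sumr_const card_ord -mulr_natl mulrA ler_wpM2r ?(ltW qp)//.
  by apply: le_trans kapM _; have := M0; rewrite -invr_gt0; lra.
apply: (no_linear_growth p2 q10 tauP tau34 ubar0 Lp DQ weak (kappa := kappa)
  (c0 := (2 * M * n.+1%:R * C)^-1) (q0 := q0)) => //.
- by rewrite kap0.
- by rewrite invr_gt0 !mulr_gt0.
move=> q /andP[qp qq0].
have qr0 : 0 < q < r0 by rewrite qp (lt_le_trans qq0)// ge_min lexx.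
have qq1 : 2 * q <= q1.
  have : q < q1 / 2 by rewrite (lt_le_trans qq0)// ge_min lexx orbT.
  by lra.
have wC : bdry (~` Omega) w by rewrite bdryC.
have [a [Oa /andP[_ aw] ad]] := ckO w q wO qr0.
have [b [Ob /andP[_ bw] bd]] := ckC w q wC qr0.
exists a, b; split.
- by move=> i; have := coord_le_enorm (a - w) i; rewrite !mxE => /le_trans; apply; exact: ltW.
- by move=> i; have := coord_le_enorm (b - w) i; rewrite !mxE => /le_trans; apply; exact: ltW.
- move=> z [z1 z2].
  have zO : Omega z.1 by exact: (box_in _ _ _ z.1 qp Oa ad z1).
  have kq : kappa * q <= q by rewrite ler_piMl// ltW.
  have zw : closed_obox w q1 z.1.
    move=> i; apply: le_trans qq1; rewrite mulr_natl mulr2n.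
    apply: le_trans (ler_distD (a ord0 i) _ _) _; apply: lerD (le_trans (z1 i) kq) _.
    have := coord_le_enorm (a - w) i; rewrite !mxE => /le_trans; apply; exact: ltW.
  have z2I : z.2 \in `]t0 - epsilon, t0[.
    move: z2; rewrite /c/= in_itv/= ler_distl => /andP[h1 h2]; apply/andP.
    by move: e0 h1 h2; split; lra.
  have zT : cyl Omega 0 T z by split => //; exact: tI.
  have zE : (E `&` Omega_T) z by split => //; split => //; exact: O1.
  rewrite /ubar patchE mem_set//.
  have := ereal_sup_ubound (imageP (dist_quotient Omega u) zE); rewrite supE /dist_quotient.
  (* A zero of [u] would make the quotient +oo, above the finite supremum. *)
  case: ifPn => [_|uz]; first by rewrite leye_eq.
  have uz0 : 0 < u z by rewrite lt0r uz u0.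
  rewrite lee_fin ler_pdivrMr// => dz.
  have dC : dist_to z.1 (bdry Omega) <= C * u z.
    apply: le_trans dz _; rewrite ler_wpM2r ?(ltW uz0)//.
    by rewrite (le_trans (ler_norm _))// lerDl.
  (* Each coordinate moves by at most kappa q from [a], so n times the distance to the boundary is
     still at least q / (2 M). With the bound by C u this yields [c0]. *)
  have := dist_to_ge (ex_intro _ w wO) (ltW ad) z1.
  rewrite mulrA => h.
  have h2 : M^-1 / 2 * q <= n.+1%:R * (C * u z).
    have hk : n%:R * kappa * q <= M^-1 / 2 * q by rewrite ler_wpM2r// ltW.
    have hn : n%:R * dist_to z.1 (bdry Omega) <= n.+1%:R * (C * u z).
      apply: (@le_trans _ _ (n%:R * (C * u z))); first by rewrite ler_wpM2l.
      by rewrite ler_wpM2r ?ler_nat// ltW// mulr_gt0.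
    by move: h hk hn; lra.
  rewrite ler_pdivrMl ?mulr_gt0//.
  have -> : 2 * M * n.+1%:R * C * u z = (2 * M) * (n.+1%:R * (C * u z)) by ring.
  rewrite -ler_pdivrMl ?mulr_gt0//.
  by rewrite invfM [2^-1 * _]mulrC.
(* The box around the exterior corkscrew point stays in the complement of [Omega], where the
   extension is 0. *)
- move=> z [z1 _]; rewrite /ubar patchE ifF//; apply/negP => /set_mem[zO _].
  by apply: (box_in _ _ _ z.1 qp Ob bd z1).
Qed.
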